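(* Let $\Lambda$ be a basic finite dimensional algebra over an algebraically closed field $K$, and let $Q$ be an indecomposable projective-injective direct summand of $\Lambda$ as a $\Lambda$-module. Put $S:=\operatorname{soc}Q$, $\overline{\Lambda}:=\Lambda/S$, $\overline{Q}:=Q/S$. Decompose $\mathrm{s}\tau\text{-}\mathrm{tilt}\,\Lambda=\mathcal M_1\sqcup\mathcal M_2^-\sqcup\mathcal M_2^+\sqcup\mathcal M_3$, where $\mathcal M_1=\{M\in\mathrm{s}\tau\text{-}\mathrm{tilt}\,\Lambda\mid Q,\overline Q\notin\operatorname{add}M\}$, $\mathcal M_2^-=\{M\in\mathrm{s}\tau\text{-}\mathrm{tilt}\,\Lambda\mid Q\notin\operatorname{add}M,\ \overline Q\in\operatorname{add}M\}$, $\mathcal M_2^+=\{M\in\mathrm{s}\tau\text{-}\mathrm{tilt}\,\Lambda\mid Q\oplus\overline Q\in\operatorname{add}M\}$, $\mathcal M_3=\{M\in\mathrm{s}\tau\text{-}\mathrm{tilt}\,\Lambda\mid Q\in\operatorname{add}M,\ \overline Q\notin\operatorname{add}M\}$, and put $\mathcal N_1=\{N\in\mathrm{s}\tau\text{-}\mathrm{tilt}\,\overline\Lambda\mid\overline Q\notin\operatorname{add}N\}$, $\mathcal N_2=\{N\in\mathrm{s}\tau\text{-}\mathrm{tilt}\,\overline\Lambda\mid\overline Q\in\operatorname{add}N,\ \operatorname{Hom}_\Lambda(N,Q)=0\}$, $\mathcal N_3=\{N\in\mathrm{s}\tau\text{-}\mathrm{tilt}\,\overline\Lambda\mid\overline Q\in\operatorname{add}N,\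 \operatorname{Hom}_\Lambda(N,Q)\neq0\}$, with $\mathcal N_2^+$ a copy of $\mathcal N_2$. Then the following hold. (1) The map $M\mapsto\alpha(M)$ gives bijections $\mathcal M_1\to\mathcal N_1$, $\mathcal M_2^-\to\mathcal N_2$, $\mathcal M_2^+\to\mathcal N_2^+$, $\mathcal M_3\to\mathcal N_3$. In particular, these bijections give a bijection from $\mathrm{s}\tau\text{-}\mathrm{tilt}\,\Lambda$ to the set $(\mathrm{s}\tau\text{-}\mathrm{tilt}\,\overline\Lambda)^{\mathcal N_2}:=\mathrm{s}\tau\text{-}\mathrm{tilt}\,\overline\Lambda\sqcup\mathcal N_2^+$. (2) We have $$\mathrm{s}\tau\text{-}\mathrm{tilt}\,\Lambda=\{N\mid N\in\mathcal N_1\sqcup\mathcal N_2\}\sqcup\{Q\oplus N\mid N\in\mathcal N_2\}\sqcup\{Q\oplus(N/\overline Q)\mid N\in\mathcal N_3\}.$$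
   Context: Modules are finitely generated right modules; $\operatorname{add}M$ is the class of direct summands of finite direct sums of copies of $M$. $S=\operatorname{soc}Q$ is a two-sided ideal of $\Lambda$, and $\overline{\Lambda}$-modules are regarded as $\Lambda$-modules via $\Lambda\to\overline{\Lambda}$. Write $\overline{M}:=M\otimes_\Lambda\overline{\Lambda}$; $\alpha(M)$ denotes a basic module with $\operatorname{add}\alpha(M)=\operatorname{add}\overline{M}$. On $\mathcal M_2^+$ the map is $M\mapsto\alpha(M)\in\mathcal N_2$ composed with the identification of $\mathcal N_2$ with its copy $\mathcal N_2^+$. For $N\in\mathcal N_3$, $N/\overline Q$ denotes the complement of the direct summand $\overline Q$ in the basic module $N$. $M$ is $\tau$-rigid if $\operatorname{Hom}_\Lambda(M,\tau M)=0$ ($\tau$ the Auslander-Reiten translation), $\tau$-tilting if it is $\tau$-rigid and $|M|=|\Lambda|$ (where $|M|$ is the number of nonisomorphic indecomposable summands), and support $\tau$-tilting if it is a $\tau$-tilting $(\Lambda/\langle e\rangle)$-module for some idempotent $e$. $\mathrm{s}\tau\text{-}\mathrm{tilt}\,\Lambda$ is the set of isomorphism classes of basic support $\tau$-tilting $\Lambda$-modules. *)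

(* Defs.v *)
From HB Require Import structures.
From mathcomp Require Import all_boot all_order all_algebra.
From mathcomp Require Import falgebra mxrepresentation generic_quotient finmap.
From mathcomp Require Import boolp classical_sets functions cardinality.

Set Implicit Arguments.
Unset Strict Implicit.
Unset Printing Implicit Defensive.

Import GRing.Theory VectorInternalTheory.
Local Open Scope ring_scope.
Local Open Scope classical_set_scope.
Local Open Scope quotient_scope.

(* The falgType of the library excludes the zero algebra, which is needed
   here: it is the quotient of an algebra by the ideal generated by 1. *)
Record fdalg (K : fieldType) := Fdalg {
  fdcar :> vectType K;
  fdmul : fdcar -> fdcar -> fdcar;
  fdone : fdcar;
  fdmulA : associative fdmul;
  fdmul1l : left_id fdone fdmul;
  fdmul1r : right_id fdone fdmul;
  fdmul_linr : forall a, linear (fdmul a);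
  fdmul_linl : forall a, linear (fdmul^~ a)
}.
Arguments fdone {K} f.

Declare Scope fdalg_scope.
Delimit Scope fdalg_scope with fd.
Local Open Scope fdalg_scope.
Notation "a ** b" := (fdmul a b) (at level 40, left associativity) : fdalg_scope.

Section OfFalgebra.
Variables (K : fieldType) (A : falgType K).
Fact falg_linr (a : A) : linear ( *%R a).
Proof. by move=> k x y; rewrite mulrDr scalerAr. Qed.
Fact falg_linl (a : A) : linear ( *%R^~ a).
Proof. by move=> k x y; rewrite mulrDl scalerAl. Qed.
Definition fdalg_of : fdalg K :=
  Fdalg (@mulrA A) (@mul1r A) (@mulr1 A) falg_linr falg_linl.
End OfFalgebra.

Section Opposite.
Variables (K : fieldType) (A : fdalg K).
Fact op_mulA : associative (fun a b : A => b ** a).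
Proof. by move=> a b c; rewrite fdmulA. Qed.
Definition opalg : fdalg K :=
  Fdalg op_mulA (@fdmul1r K A) (@fdmul1l K A) (@fdmul_linl K A) (@fdmul_linr K A).
End Opposite.

Section Span.
Variable K : fieldType.

Fact mxspan_ex n (P : set 'rV[K]_n) : exists U : 'M[K]_n,
  (forall v, P v -> (v <= U)%MS) /\
  (forall W : 'M[K]_n, (forall v, P v -> (v <= W)%MS) -> (U <= W)%MS).
Proof.
pose low (U : 'M[K]_n) :=
  forall W : 'M[K]_n, (forall v, P v -> (v <= W)%MS) -> (U <= W)%MS.
pose p k := `[< exists2 U, low U & \rank U = k >].
have exp : exists k, p k.
  by exists 0%N; apply/asboolP; exists 0; [move=> W _; apply: sub0mx|rewrite mxrank0].
have ubp k : p k -> (k <= n)%N by move/asboolP => [U _ <-]; apply: rank_leq_row.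
case: (ex_maxnP exp ubp) => k /asboolP[U lowU rkU] maxk.
exists U; split=> // v Pv.
have lowUv : low (U + v)%MS.
  by move=> W PW; rewrite addsmx_sub lowU //= PW.
have /maxk : p (\rank (U + v)%MS) by apply/asboolP; exists (U + v)%MS.
rewrite -rkU => rkUv; apply: submx_trans (addsmxSr U v) _.
by rewrite -(geq_leqif (mxrank_leqif_sup (addsmxSl U v))).
Qed.

(* The linear span of a set of row vectors, as the row space of a matrix. *)
Definition mxspan n (P : set 'rV[K]_n) : 'M[K]_n := projT1 (cid (mxspan_ex P)).

Lemma mxspan_in n (P : set 'rV[K]_n) v : P v -> (v <= mxspan P)%MS.
Proof. by rewrite /mxspan; case: cid => U /= [inU _]; apply: inU. Qed.

Lemma mxspan_min n (P : set 'rV[K]_n) m (W : 'M[K]_(m, n)) :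
  (forall v, P v -> (v <= W)%MS) -> (mxspan P <= W)%MS.
Proof.
rewrite /mxspan; case: cid => U /= [_ minU] PW.
by rewrite -(genmxE W); apply: minU => v Pv; rewrite genmxE PW.
Qed.

Lemma mxspan_mul n m (P : set 'rV[K]_n) p (W : 'M[K]_(p, m)) (B : 'M[K]_(n, m)) :
  (forall v, P v -> (v *m B <= W)%MS) -> (mxspan P *m B <= W)%MS.
Proof.
move=> PW; rewrite submxE -mulmxA; apply/eqP/sub_kermxP.
by apply: mxspan_min => v /PW; rewrite submxE -mulmxA => /eqP /sub_kermxP.
Qed.

Lemma mem_vs2mx (V : vectType K) (x : V) (W : {vspace V}) :
  (x \in W) = (v2r x <= vs2mx W)%MS.
Proof. by rewrite memvE /subsetv genmxE. Qed.

Definition vspan (V : vectType K) (P : set V) : {vspace V} :=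
  mx2vs (mxspan [set v2r x | x in P]).

Lemma vspan_in (V : vectType K) (P : set V) x : P x -> x \in vspan P.
Proof. by move=> Px; rewrite mem_vs2mx mx2vsK; apply: mxspan_in; exists x. Qed.

Lemma vspan_min (V : vectType K) (P : set V) (W : {vspace V}) :
  (forall x, P x -> x \in W) -> (vspan P <= W)%VS.
Proof.
move=> PW; rewrite /subsetv mx2vsK; apply: mxspan_min => _ [x Px <-].
by have := PW x Px; rewrite mem_vs2mx.
Qed.

End Span.

(* Two-sided ideals and quotient algebras *)

Section Ideals.
Variables (K : fieldType) (A : fdalg K).

Record ideal := Ideal {
  ideal_space :> {vspace A};
  ideal_mull : forall a x : A, x \in ideal_space -> a ** x \in ideal_space;
  ideal_mulr : forall a x : A, x \in ideal_space -> x ** a \in ideal_space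
}.

Definition genideal_space (X : set A) : {vspace A} :=
  vspan [set y | exists a x b, X x /\ y = a ** x ** b].

Fact genideal_stable (X : set A) (f : A -> A) : linear f ->
    (forall a x b, X x -> f (a ** x ** b) \in genideal_space X) ->
  forall x, x \in genideal_space X -> f x \in genideal_space X.
Proof.
move=> lf Xf x; set I := genideal_space X => Ix.
pose fL := GRing.isSemilinear.Build _ _ _ _ f (GRing.semilinear_linear lf).
pose g : {linear A -> A} := HB.pack f fL.
suff /subvP/(_ x Ix) : (I <= linfun g @^-1: I)%VS by rewrite -memv_preim lfunE.
by apply: vspan_min => _ [a [y [b [Xy ->]]]]; rewrite -memv_preim lfunE Xf.
Qed.

Fact genideal_mull (X : set A) (a x : A) :
  x \in genideal_space X -> a ** x \in genideal_space X.
Proof.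
apply: (genideal_stable (@fdmul_linr _ _ a)) => b y c Xy.
by apply: vspan_in; exists (a ** b), y, c; split; rewrite // !fdmulA.
Qed.

Fact genideal_mulr (X : set A) (a x : A) :
  x \in genideal_space X -> x ** a \in genideal_space X.
Proof.
apply: (genideal_stable (@fdmul_linl _ _ a)) => b y c Xy.
by apply: vspan_in; exists b, y, (c ** a); split; rewrite // !fdmulA.
Qed.

Definition genideal (X : set A) : ideal :=
  Ideal (@genideal_mull X) (@genideal_mulr X).

Lemma genideal_in (X : set A) x : X x -> x \in genideal X.
Proof.
by move=> Xx; apply: vspan_in; exists (fdone A), x, (fdone A);
  rewrite fdmul1l fdmul1r.
Qed.

Lemma genideal_min (X : set A) (I : ideal) :
  (forall x, X x -> x \in I) -> (genideal X <= I)%VS.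
Proof.
move=> XI; apply: vspan_min => _ [a [x [b [Xx ->]]]].
by apply/ideal_mulr/ideal_mull/XI.
Qed.

End Ideals.

Record algmor (K : fieldType) (A B : fdalg K) := Algmor {
  algmor_fun :> A -> B;
  algmor_lin : linear algmor_fun;
  algmor1 : algmor_fun (fdone A) = fdone B;
  algmorM : forall a b, algmor_fun (a ** b) = algmor_fun a ** algmor_fun b
}.

(* The quotient A/I, carried by a vector space complement of I in A; the
   canonical map A -> A/I is the projection along I. *)
Section Quotient.
Variables (K : fieldType) (A : fdalg K) (I : ideal A).

Definition quo_proj (x : A) : subvs_of (I^C)%VS :=
  vsproj (I^C)%VS (daddv_pi (I^C)%VS I x).

Fact quo_proj_lin : linear quo_proj.
Proof. by move=> k x y; rewrite /quo_proj !linearP. Qed.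

Fact quo_projK (x : subvs_of (I^C)%VS) : quo_proj (vsval x) = x.
Proof.
rewrite /quo_proj daddv_pi_id ?vsvalK ?subvsP //.
by rewrite capvC capv_compl.
Qed.

Fact quo_proj_eq (x y : A) : x - y \in I <-> quo_proj x = quo_proj y.
Proof.
have dx : (I^C :&: I = 0)%VS by rewrite capvC capv_compl.
have tot z : z \in (I^C + I)%VS by rewrite addvC addv_complf memvf.
split=> [Ixy | /(congr1 vsval)].
  congr vsproj; apply/eqP; rewrite -subr_eq0 -linearB /=; apply/eqP.
  have := daddv_pi_add dx (tot (x - y)).
  rewrite (daddv_pi_id (capv_compl I) Ixy) => eqxy.
  by apply: (addIr (x - y)); rewrite eqxy add0r.
rewrite !vsprojK ?memv_pi // => eq_pi.
have := daddv_pi_add dx (tot (x - y)).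
by rewrite linearB /= eq_pi subrr add0r => <-; rewrite memv_pi.
Qed.

Fact quo_projM (x y : A) :
  quo_proj (vsval (quo_proj x) ** vsval (quo_proj y)) = quo_proj (x ** y).
Proof.
have linl z := GRing.isSemilinear.Build _ _ _ _ _ (GRing.semilinear_linear (@fdmul_linl K A z)).
have linr z := GRing.isSemilinear.Build _ _ _ _ _ (GRing.semilinear_linear (@fdmul_linr K A z)).
pose ml z : {linear A -> A} := HB.pack (fun t : A => t ** z) (linl z).
pose mr z : {linear A -> A} := HB.pack (fun t : A => z ** t) (linr z).
have Isub z : vsval (quo_proj z) - z \in I by apply/quo_proj_eq; rewrite quo_projK.
apply/quo_proj_eq; set x' := vsval _; set y' := vsval _.
have mulBl u v z : u ** z - v ** z = (u - v) ** z :> A.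
  exact/esym/(linearB (ml z)).
have mulBr u v z : z ** u - z ** v = z ** (u - v) :> A.
  exact/esym/(linearB (mr z)).
rewrite -(subrKA (x ** y')) mulBl mulBr.
by apply: memvD; [apply: ideal_mulr | apply: ideal_mull]; apply: Isub.
Qed.

Definition quo_mul (x y : subvs_of (I^C)%VS) := quo_proj (vsval x ** vsval y).

Fact quo_mulA : associative quo_mul.
Proof.
move=> x y z; rewrite /quo_mul -{1}[x]quo_projK -{2}[z]quo_projK.
by rewrite !quo_projM fdmulA.
Qed.
Fact quo_mul1l : left_id (quo_proj (fdone A)) quo_mul.
Proof.
by move=> x; rewrite /quo_mul -{1}[x]quo_projK quo_projM fdmul1l quo_projK.
Qed.
Fact quo_mul1r : right_id (quo_proj (fdone A)) quo_mul.
Proof.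
by move=> x; rewrite /quo_mul -{1}[x]quo_projK quo_projM fdmul1r quo_projK.
Qed.
Fact quo_mul_linr x : linear (quo_mul x).
Proof. by move=> k y z; rewrite /quo_mul linearP fdmul_linr quo_proj_lin. Qed.
Fact quo_mul_linl x : linear (quo_mul^~ x).
Proof. by move=> k y z; rewrite /quo_mul linearP fdmul_linl quo_proj_lin. Qed.

Definition quoalg : fdalg K :=
  Fdalg quo_mulA quo_mul1l quo_mul1r quo_mul_linr quo_mul_linl.

Definition quo_mor : algmor A quoalg :=
  @Algmor K A quoalg quo_proj quo_proj_lin erefl
    (fun x y => esym (quo_projM x y)).

Lemma quo_mor_surj (y : quoalg) : exists x, quo_mor x = y.
Proof. by exists (vsval y); apply: quo_projK. Qed.

Lemma quo_mor_ker (x : A) : quo_mor x = 0 <-> x \in I.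
Proof.
have q0 : quo_proj 0 = 0 by rewrite /quo_proj !linear0.
by rewrite -[in x \in I](subr0 x); split=> [qx|/quo_proj_eq]; [apply/quo_proj_eq|]; rewrite q0.
Qed.

End Quotient.

(* Finitely generated right A-modules, as matrix representations acting on
   row vectors: the element v *m M a is the product v.a *)

Record rmod (K : fieldType) (A : fdalg K) := Rmod {
  rdim : nat;
  ract :> A -> 'M[K]_rdim;
  ract_lin : linear ract;
  ract1 : ract (fdone A) = 1%:M;
  ractM : forall a b, ract (a ** b) = ract a *m ract b
}.

HB.instance Definition _ (K : fieldType) (A : fdalg K) := gen_eqMixin (rmod A).
HB.instance Definition _ (K : fieldType) (A : fdalg K) := gen_choiceMixin (rmod A).

Section Modules.
Variables (K : fieldType) (A : fdalg K).
Implicit Types M N : rmod A.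

Definition is_hom M N (f : 'M[K]_(rdim M, rdim N)) :=
  forall a, M a *m f = f *m N a.

Record hom M N := Hom {
  hom_mx :> 'M[K]_(rdim M, rdim N);
  homP : is_hom hom_mx
}.

Definition iso M N := exists (f : hom M N) (g : hom N M),
  f *m g = 1%:M /\ g *m f = 1%:M.

Definition surj_hom M N (f : hom M N) := row_full f.
Definition inj_hom M N (f : hom M N) := row_free f.
Definition hom_zero M N := forall f : hom M N, f = 0 :> 'M_(_, _).

Fact id_homP M : @is_hom M M 1%:M.
Proof. by move=> a; rewrite mulmx1 mul1mx. Qed.
Definition id_hom M : hom M M := Hom (@id_homP M).

Fact comp_homP M N P (f : hom M N) (g : hom N P) : is_hom (f *m g).
Proof. by move=> a; rewrite mulmxA homP -!mulmxA homP. Qed.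
Definition comp_hom M N P (f : hom M N) (g : hom N P) : hom M P :=
  Hom (comp_homP f g).

Lemma iso_refl M : iso M M.
Proof. by exists (id_hom M), (id_hom M); rewrite mulmx1. Qed.
Lemma iso_sym M N : iso M N -> iso N M.
Proof. by case=> f [g [fg gf]]; exists g, f. Qed.
Lemma iso_trans M N P : iso M N -> iso N P -> iso M P.
Proof.
case=> f [f' [ff' f'f]] [g [g' [gg' g'g]]].
exists (comp_hom f g), (comp_hom g' f') => /=; split.
  by rewrite mulmxA -(mulmxA f) gg' mulmx1.
by rewrite mulmxA -(mulmxA g') f'f mulmx1.
Qed.

Fact rmod0_lin : linear (fun _ : A => 0 : 'M[K]_0).
Proof. by move=> k a b; rewrite scaler0 addr0. Qed.
Fact rmod0_1 : 0 = 1%:M :> 'M[K]_0.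
Proof. by rewrite [RHS]flatmx0. Qed.
Fact rmod0_M (a b : A) : 0 = (0 : 'M[K]_0) *m (0 : 'M[K]_0).
Proof. by rewrite mul0mx. Qed.
Definition rmod0 : rmod A := Rmod rmod0_lin rmod0_1 rmod0_M.

Definition dsum_act M N (a : A) := block_mx (M a) 0 0 (N a).
Fact dsum_lin M N : linear (dsum_act M N).
Proof.
move=> k a b; rewrite /dsum_act !ract_lin scale_block_mx add_block_mx.
by rewrite !scaler0 !addr0.
Qed.
Fact dsum1 M N : dsum_act M N (fdone A) = 1%:M.
Proof. by rewrite /dsum_act !ract1 -scalar_mx_block. Qed.
Fact dsumM M N a b : dsum_act M N (a ** b) = dsum_act M N a *m dsum_act M N b.
Proof.
by rewrite /dsum_act !ractM mulmx_block !mul0mx !mulmx0 !addr0 !add0r.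
Qed.
Definition dsum M N : rmod A := Rmod (dsum_lin M N) (dsum1 M N) (@dsumM M N).

Definition bigdsum (s : seq (rmod A)) : rmod A := foldr dsum rmod0 s.

Definition summand X M := exists Y, iso M (dsum X Y).
Definition in_add X M := exists n, summand X (bigdsum (nseq n M)).

Definition indecomposable M :=
  (0 < rdim M)%N /\
  forall X Y, iso M (dsum X Y) -> rdim X = 0%N \/ rdim Y = 0%N.

Definition projective_mod P := forall M N (p : hom M N) (f : hom P N),
  surj_hom p -> exists g : hom P M, g *m p = f.
Definition injective_mod I := forall M N (i : hom M N) (f : hom M I),
  inj_hom i -> exists g : hom N I, i *m g = f.

(* Direct sums of pairwise nonisomorphic indecomposable modules *)
Definition basic_mod M := exists s : seq (rmod A),
  [/\ iso M (bigdsum s),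
      forall i, (i < size s)%N -> indecomposable (nth rmod0 s i) &
      forall i j, (i < size s)%N -> (j < size s)%N ->
        iso (nth rmod0 s i) (nth rmod0 s j) -> i = j].

(* Submodules are given by the row space of a matrix. *)
Record submodule M := Submodule {
  submodule_mx :> 'M[K]_(rdim M);
  submoduleP : forall a, (submodule_mx *m M a <= submodule_mx)%MS
}.

Section SubFactor.
Variables (M : rmod A) (U : submodule M).

Definition submod_act (a : A) := in_submod U (val_submod (1%:M : 'M_(\rank U)) *m M a).
Fact submod_lin : linear submod_act.
Proof.
by move=> k a b; rewrite /submod_act ract_lin mulmxDr -scalemxAr linearP.
Qed.
Fact submod1 : submod_act (fdone A) = 1%:M.
Proof. by rewrite /submod_act ract1 mulmx1 val_submodK. Qed.
Fact submod_val m (W : 'M_(m, \rank U)) a :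
  val_submod (W *m submod_act a) = val_submod W *m M a.
Proof.
rewrite val_submodE -mulmxA -val_submodE in_submodK; last first.
  apply: submx_trans (submoduleP U a); exact/submxMr/val_submodP.
by rewrite mulmxA -val_submodE.
Qed.
Fact submodM a b : submod_act (a ** b) = submod_act a *m submod_act b.
Proof.
apply: (can_inj val_submodK); rewrite submod_val -[submod_act a]mul1mx.
by rewrite submod_val -[submod_act _]mul1mx submod_val ractM mulmxA.
Qed.
Definition submod : rmod A := Rmod submod_lin submod1 submodM.

Definition factmod_act (a : A) := in_factmod U (val_factmod (1%:M : 'M_(\rank (cokermx U))) *m M a).
Fact factmod_lin : linear factmod_act.
Proof.
by move=> k a b; rewrite /factmod_act ract_lin mulmxDr -scalemxAr linearP.
Qed.
Fact factmod1 : factmod_act (fdone A) = 1%:M.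
Proof. by rewrite /factmod_act ract1 mulmx1 val_factmodK. Qed.
Fact factmod_in m (W : 'M_(m, rdim M)) a :
  in_factmod U W *m factmod_act a = in_factmod U (W *m M a).
Proof.
have sub0 : in_factmod U ((W - val_factmod (in_factmod U W)) *m M a) = 0.
  apply/eqP; rewrite in_factmod_eq0; apply: submx_trans (submoduleP U a).
  apply: submxMr; set w := val_factmod _.
  by rewrite -[X in X - w](add_sub_fact_mod U) addrK val_submodP.
move: sub0; rewrite mulmxBl linearB /= => /eqP; rewrite subr_eq0 => /eqP ->.
rewrite /factmod_act [val_factmod (in_factmod U W)]val_factmodE -mulmxA.
by rewrite in_factmodE [RHS]in_factmodE !mulmxA.
Qed.
Fact factmodM a b : factmod_act (a ** b) = factmod_act a *m factmod_act b.
Proof. by rewrite [factmod_act a]/factmod_act factmod_in -mulmxA -ractM. Qed.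
Definition factmod : rmod A := Rmod factmod_lin factmod1 factmodM.

End SubFactor.

Fact ker_stable M N (f : hom M N) a : (kermx f *m M a <= kermx f)%MS.
Proof. by apply/sub_kermxP; rewrite -mulmxA homP mulmxA mulmx_ker mul0mx. Qed.
Definition ker M N (f : hom M N) : submodule M := Submodule (ker_stable f).

Fact im_stable M N (f : hom M N) a : (<<f>>%MS *m N a <= <<f>>%MS)%MS.
Proof. by rewrite (eqmxMr _ (genmxE f)) genmxE -homP submxMl. Qed.
Definition im M N (f : hom M N) : submodule N := Submodule (im_stable f).

Definition coker M N (f : hom M N) : rmod A := factmod (im f).

Definition simple_mod M :=
  (0 < rdim M)%N /\
  forall U : submodule M, U = 0 :> 'M_(rdim M) \/ row_full U.

Definition soc_mx M : 'M[K]_(rdim M) :=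
  mxspan [set v | exists U : submodule M, simple_mod (submod U) /\ (v <= U)%MS].
Fact soc_stable M a : (soc_mx M *m M a <= soc_mx M)%MS.
Proof.
apply: mxspan_mul => v [U [simU vU]]; apply: mxspan_in; exists U; split=> //.
exact: submx_trans (submxMr _ vU) (submoduleP U a).
Qed.
Definition soc M : submodule M := Submodule (@soc_stable M).

Definition superfluous M (U : submodule M) :=
  forall V : submodule M, row_full (U + V)%MS -> row_full V.

End Modules.

Section AuslanderReiten.
Variables (K : fieldType) (A : fdalg K).
Implicit Types M N P : rmod A.

(* Matrices of right and left multiplication by a in the coordinates v2r *)
Definition rmul_mx (a : A) : 'M[K]_(dim A) := lin1_mx (fun v => v2r (r2v v ** a)).
Definition lmul_mx (a : A) : 'M[K]_(dim A) := lin1_mx (fun v => v2r (a ** r2v v)).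

Lemma mul_rmul_mx (v : 'rV_(dim A)) a : v *m rmul_mx a = v2r (r2v v ** a).
Proof.
have lf : linear (fun v : 'rV_(dim A) => v2r (r2v v ** a)).
  by move=> k x y; rewrite linearP fdmul_linl linearP.
pose fL := GRing.isLinear.Build _ _ _ _ _ lf.
pose f : {linear 'rV_(dim A) -> 'rV_(dim A)} := HB.pack (fun v => v2r (r2v v ** a)) fL.
exact: (mul_rV_lin1 f).
Qed.

Lemma mul_lmul_mx (v : 'rV_(dim A)) a : v *m lmul_mx a = v2r (a ** r2v v).
Proof.
have lf : linear (fun v : 'rV_(dim A) => v2r (a ** r2v v)).
  by move=> k x y; rewrite linearP fdmul_linr linearP.
pose fL := GRing.isLinear.Build _ _ _ _ _ lf.
pose f : {linear 'rV_(dim A) -> 'rV_(dim A)} := HB.pack (fun v => v2r (a ** r2v v)) fL.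
exact: (mul_rV_lin1 f).
Qed.

Lemma lmul_rmul_mxC a b : lmul_mx a *m rmul_mx b = rmul_mx b *m lmul_mx a.
Proof.
apply/row_matrixP => i; rewrite !rowE !mulmxA.
by rewrite !(mul_rmul_mx, mul_lmul_mx) !v2rK fdmulA.
Qed.

Fact rmul_mx_lin : linear rmul_mx.
Proof.
move=> k a b; apply/row_matrixP => i; rewrite !rowE mulmxDr -scalemxAr.
by rewrite !mul_rmul_mx fdmul_linr linearP.
Qed.
Fact rmul_mx1 : rmul_mx (fdone A) = 1%:M.
Proof.
by apply/row_matrixP => i; rewrite !rowE mul_rmul_mx fdmul1r r2vK mulmx1.
Qed.
Fact rmul_mxM a b : rmul_mx (a ** b) = rmul_mx a *m rmul_mx b.
Proof.
apply/row_matrixP => i; rewrite !rowE mulmxA !mul_rmul_mx v2rK.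
by rewrite fdmulA.
Qed.

(* The module A_A *)
Definition reg : rmod A := Rmod rmul_mx_lin rmul_mx1 rmul_mxM.

Fact lmul_mx_lin : linear lmul_mx.
Proof.
move=> k a b; apply/row_matrixP => i; rewrite !rowE mulmxDr -scalemxAr.
by rewrite !mul_lmul_mx fdmul_linl linearP.
Qed.
Fact lmul_mx1 : lmul_mx (fdone A) = 1%:M.
Proof.
by apply/row_matrixP => i; rewrite !rowE mul_lmul_mx fdmul1l r2vK mulmx1.
Qed.
Fact lmul_mxM a b : lmul_mx (a ** b) = lmul_mx b *m lmul_mx a.
Proof.
apply/row_matrixP => i; rewrite !rowE mulmxA !mul_lmul_mx v2rK.
by rewrite fdmulA.
Qed.

Section Star.
Variable M : rmod A.

(* Left A-modules are right modules over the opposite algebra. Here a acts on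
   f : M -> A by (a f)(x) = a f(x), first on all K-linear maps f, coordinatised
   by mxvec, then on the submodule Hom_A(M, A). *)
Definition lin_act (a : opalg A) : 'M[K]_(rdim M * dim A) :=
  lin_mulmxr (lmul_mx a).
Lemma lin_actE (X : 'M_(rdim M, dim A)) a :
  mxvec X *m lin_act a = mxvec (X *m lmul_mx a).
Proof. by rewrite mul_vec_lin. Qed.
Fact lin_act_lin : linear lin_act.
Proof.
move=> k a b; apply/row_matrixP => i; rewrite !rowE mulmxDr -scalemxAr.
rewrite -[delta_mx _ _]vec_mxK !lin_actE lmul_mx_lin mulmxDr -scalemxAr.
by rewrite linearP.
Qed.
Fact lin_act1 : lin_act (fdone (opalg A)) = 1%:M.
Proof.
apply/row_matrixP => i; rewrite !rowE mulmx1 -[delta_mx _ _]vec_mxK.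
by rewrite lin_actE lmul_mx1 mulmx1.
Qed.
Fact lin_actM (a b : opalg A) : lin_act (a ** b) = lin_act a *m lin_act b.
Proof.
apply/row_matrixP => i; rewrite !rowE mulmxA -[delta_mx _ _]vec_mxK.
by rewrite !lin_actE lmul_mxM mulmxA.
Qed.
Definition linmod : rmod (opalg A) := Rmod lin_act_lin lin_act1 lin_actM.

Definition hom_mxs : 'M[K]_(rdim linmod) :=
  mxspan [set mxvec f | f in @is_hom K A M reg].

Lemma hom_mxsP (X : 'M_(rdim M, dim A)) :
  (mxvec X <= hom_mxs)%MS <-> @is_hom K A M reg X.
Proof.
split=> [XH a|homX]; last by apply: mxspan_in; exists X.
pose L := lin_mulmx (M a) - lin_mulmxr (reg a) : 'M_(_, rdim M * dim A).
have LE (Y : 'M_(rdim M, dim A)) :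
    (mxvec Y <= kermx L)%MS = (M a *m Y == Y *m reg a).
  rewrite (sameP sub_kermxP eqP) mulmxBr !mul_vec_lin /= -linearB mxvec_eq0.
  by rewrite subr_eq0.
apply/eqP; rewrite -LE; apply: submx_trans XH _.
by apply: mxspan_min => _ [Y homY <-]; rewrite LE homY.
Qed.

Fact hom_mxs_stable (a : opalg A) : (hom_mxs *m linmod a <= hom_mxs)%MS.
Proof.
apply: mxspan_mul => _ [X homX <-]; rewrite lin_actE; apply/hom_mxsP => b.
by rewrite mulmxA homX -!mulmxA lmul_rmul_mxC.
Qed.
Definition homs : submodule linmod := Submodule hom_mxs_stable.
Definition star : rmod (opalg A) := submod homs.

End Star.

Section StarHom.
Variables (M N : rmod A) (f : hom M N).

Definition star_mx : 'M[K]_(rdim (star N), rdim (star M)) :=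
  in_submod (homs M) (val_submod (1%:M : 'M_(\rank (homs N))) *m lin_mulmx f).

Fact homs_precomp : (homs N *m lin_mulmx f <= homs M)%MS.
Proof.
apply: mxspan_mul => _ [X homX <-]; rewrite mul_vec_lin; apply/hom_mxsP => a.
by rewrite mulmxA homP -!mulmxA homX.
Qed.
Fact val_star_mx m (W : 'M_(m, \rank (homs N))) :
  val_submod (W *m star_mx) = val_submod W *m lin_mulmx f.
Proof.
rewrite val_submodE -mulmxA -val_submodE in_submodK.
  by rewrite mulmxA -val_submodE.
by apply: submx_trans homs_precomp; apply/submxMr/val_submodP.
Qed.
Fact star_mx_homP : @is_hom K (opalg A) (star N) (star M) star_mx.
Proof.
have comm a : lin_act N a *m lin_mulmx f = lin_mulmx f *m lin_act M a.
  apply/row_matrixP => i; rewrite !rowE !mulmxA -[delta_mx _ _]vec_mxK.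
  by rewrite !mul_vec_lin /= mulmxA.
move=> a; apply: (can_inj val_submodK).
apply: etrans (val_star_mx _) _.
apply: etrans (esym (submod_val (U := homs M) _ _)).
have -> : val_submod star_mx = val_submod 1%:M *m lin_mulmx f.
  by rewrite -[in LHS](mul1mx star_mx) val_star_mx.
have -> : val_submod (star N a) = val_submod 1%:M *m lin_act N a.
  by rewrite -[in LHS](mul1mx (star N a)) (submod_val (U := homs N)).
by rewrite -!mulmxA comm.
Qed.
Definition star_hom : hom (star N) (star M) := Hom star_mx_homP.
End StarHom.

Section Dual.
Variable N : rmod (opalg A).
Fact dual_lin : linear (fun a : A => (N a)^T).
Proof. by move=> k a b; rewrite (ract_lin N) linearP. Qed.
Fact dual1 : (N (fdone A))^T = 1%:M.
Proof. by rewrite (ract1 N) trmx1. Qed.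
Fact dualM (a b : A) : (N (a ** b))^T = (N a)^T *m (N b)^T.
Proof. by rewrite -trmx_mul -(ractM N). Qed.
(* Hom_K(N, K) for a left module N *)
Definition dual : rmod A := Rmod dual_lin dual1 dualM.
End Dual.

(* P1 -f-> P0 -g-> M -> 0 *)
Definition min_proj_pres P1 P0 M (f : hom P1 P0) (g : hom P0 M) :=
  [/\ projective_mod P1, projective_mod P0, surj_hom g, (f :=: ker g)%MS &
      superfluous (ker g) /\ superfluous (ker f)].

(* The transpose Tr M is the cokernel of Hom_A(P0, A) -> Hom_A(P1, A), and the
   Auslander-Reiten translate of M is the K-dual of Tr M. *)
Definition is_tau M T := exists P1 P0 (f : hom P1 P0) (g : hom P0 M),
  min_proj_pres f g /\ iso T (dual (coker (star_hom f))).

Definition tau M : rmod A := xget (rmod0 A) [set T | is_tau M T].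

Definition isob M N := `[< iso M N >].
Fact isob_refl : reflexive isob.
Proof. by move=> M; apply/asboolP/iso_refl. Qed.
Fact isob_sym : symmetric isob.
Proof. by move=> M N; apply/asboolP/asboolP; apply: iso_sym. Qed.
Fact isob_trans : transitive isob.
Proof.
by move=> N M P /asboolP MN /asboolP NP; apply/asboolP; apply: iso_trans MN NP.
Qed.
Canonical isob_equiv := EquivRel isob isob_refl isob_sym isob_trans.

Definition isoclass := {eq_quot isob}.
Definition cls M : isoclass := \pi_isoclass M.

Lemma clsP M N : cls M = cls N <-> iso M N.
Proof. by split=> [/eqmodP/asboolP|MN] //; apply/eqmodP/asboolP. Qed.

(* The number |M| of isomorphism classes of indecomposable summands of M *)
Definition nsummands M : nat :=
  #|` fset_set [set cls X | X in [set X | indecomposable X /\ summand X M]]|.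

Definition tau_rigid M := hom_zero M (tau M).
Definition tau_tilting M := tau_rigid M /\ nsummands M = nsummands reg.
End AuslanderReiten.

Section ChangeOfRings.
Variables (K : fieldType) (A B : fdalg K) (phi : algmor A B).

Section Restriction.
Variable N : rmod B.
Fact res_lin : linear (fun a => N (phi a)).
Proof. by move=> k a b; rewrite algmor_lin ract_lin. Qed.
Fact res1 : N (phi (fdone A)) = 1%:M.
Proof. by rewrite algmor1 ract1. Qed.
Fact resM a b : N (phi (a ** b)) = N (phi a) *m N (phi b).
Proof. by rewrite algmorM ractM. Qed.
Definition res : rmod A := Rmod res_lin res1 resM.
End Restriction.

(* M (x)_A B is the quotient of M (x)_K B by the relations va (x) b - v (x) ab,
   where v (x) b is coordinatised as mxvec (v^T *m v2r b). *)
Section Tensor.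
Variable M : rmod A.
Definition tensK_act (b : B) : 'M[K]_(rdim M * dim B) := lin_mulmxr (rmul_mx b).
Lemma tensK_actE (X : 'M_(rdim M, dim B)) b :
  mxvec X *m tensK_act b = mxvec (X *m rmul_mx b).
Proof. by rewrite mul_vec_lin. Qed.
Fact tensK_lin : linear tensK_act.
Proof.
move=> k a b; apply/row_matrixP => i; rewrite !rowE mulmxDr -scalemxAr.
rewrite -[delta_mx _ _]vec_mxK !tensK_actE rmul_mx_lin mulmxDr -scalemxAr.
by rewrite linearP.
Qed.
Fact tensK1 : tensK_act (fdone B) = 1%:M.
Proof.
apply/row_matrixP => i; rewrite !rowE mulmx1 -[delta_mx _ _]vec_mxK.
by rewrite tensK_actE rmul_mx1 mulmx1.
Qed.
Fact tensKM (a b : B) : tensK_act (a ** b) = tensK_act a *m tensK_act b.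
Proof.
apply/row_matrixP => i; rewrite !rowE mulmxA -[delta_mx _ _]vec_mxK.
by rewrite !tensK_actE rmul_mxM mulmxA.
Qed.
Definition tensK : rmod B := Rmod tensK_lin tensK1 tensKM.

Definition ptens (v : 'rV[K]_(rdim M)) (b : B) : 'rV[K]_(rdim M * dim B) :=
  mxvec (v^T *m v2r b).

Definition tens_rel : 'M[K]_(rdim tensK) :=
  mxspan [set w | exists v a b, w = ptens (v *m M a) b - ptens v (phi a ** b)].
Fact tens_rel_stable b : (tens_rel *m tensK b <= tens_rel)%MS.
Proof.
apply: mxspan_mul => _ [v [a [c ->]]]; apply: mxspan_in.
exists v, a, (c ** b); rewrite mulmxBl /ptens !tensK_actE -!mulmxA.
by rewrite !mul_rmul_mx !v2rK fdmulA.
Qed.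
Definition tensor : rmod B := factmod (Submodule tens_rel_stable).
End Tensor.

(* The class of the basic module N with add N = add (M (x)_A B) *)
Definition is_alpha (M : rmod A) (N : rmod B) :=
  basic_mod N /\ forall X, in_add X N <-> in_add X (tensor M).
Definition alpha (c : isoclass A) : isoclass B :=
  xget (cls (rmod0 B)) [set cls N | N in is_alpha (repr c)].
End ChangeOfRings.

Definition support_tau_tilting (K : fieldType) (A : fdalg K) (M : rmod A) :=
  exists (e : A) (N : rmod (quoalg (genideal [set e]))),
    [/\ e ** e = e, tau_tilting N & iso M (res (quo_mor _) N)].

Definition sttilt (K : fieldType) (A : fdalg K) : set (isoclass A) :=
  [set cls M | M in [set M | basic_mod M /\ support_tau_tilting M]].
Arguments sttilt {K} A _.

Section ProjectiveInjective.
Variables (K : fieldType) (A : fdalg K) (Q : submodule (reg A)).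

Definition direct_summand := exists Q' : submodule (reg A),
  row_full (Q + Q')%MS /\ (Q :&: Q' = 0)%MS.

Definition Qmod : rmod A := submod Q.
Definition Qbar : rmod A := factmod (soc Qmod).

(* The socle S of Q as a subset of A *)
Definition socQ : set A := [set x : A | (v2r x <= val_submod (soc Qmod))%MS].

(* The algebra A/S: when A is basic and Q is an indecomposable injective
   summand of A, the set S is itself a two-sided ideal. *)
Definition Abar : fdalg K := quoalg (genideal socQ).
Definition Abar_mor : algmor A Abar := quo_mor (genideal socQ).

(* Representatives: an A-module for a class over A, and an Abar-module viewed
   as an A-module for a class over Abar *)
Definition rep (c : isoclass A) : rmod A := repr c.
Definition repbar (d : isoclass Abar) : rmod A := res Abar_mor (repr d).

Definition setM1 : set (isoclass A) := [set c | [/\ sttilt A c,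
  ~ in_add Qmod (rep c) & ~ in_add Qbar (rep c)]].
Definition setM2m : set (isoclass A) := [set c | [/\ sttilt A c,
  ~ in_add Qmod (rep c) & in_add Qbar (rep c)]].
Definition setM2p : set (isoclass A) := [set c | sttilt A c /\
  in_add (dsum Qmod Qbar) (rep c)].
Definition setM3 : set (isoclass A) := [set c | [/\ sttilt A c,
  in_add Qmod (rep c) & ~ in_add Qbar (rep c)]].

Definition setN1 : set (isoclass Abar) := [set d | sttilt Abar d /\
  ~ in_add Qbar (repbar d)].
Definition setN2 : set (isoclass Abar) := [set d | [/\ sttilt Abar d,
  in_add Qbar (repbar d) & hom_zero (repbar d) Qmod]].
Definition setN3 : set (isoclass Abar) := [set d | [/\ sttilt Abar d,
  in_add Qbar (repbar d) & ~ hom_zero (repbar d) Qmod]].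

(* sttilt Abar disjoint union with a copy of setN2 *)
Definition sttilt_bar_N2 : set (isoclass Abar + isoclass Abar) :=
  [set inl d | d in sttilt Abar] `|` [set inr d | d in setN2].

Definition alphaQ : isoclass A -> isoclass Abar := alpha Abar_mor.
Definition alphaQ_all (c : isoclass A) : isoclass Abar + isoclass Abar :=
  if `[< setM2p c >] then inr (alphaQ c) else inl (alphaQ c).

(* The classes of N, of Q (+) N and of Q (+) (N / Qbar), where N / Qbar is a
   complement of Qbar in N *)
Definition inflate (X : set (isoclass Abar)) : set (isoclass A) :=
  [set cls (repbar d) | d in X].
Definition add_Q (X : set (isoclass Abar)) : set (isoclass A) :=
  [set cls (dsum Qmod (repbar d)) | d in X].
Definition exchange_Q (X : set (isoclass Abar)) : set (isoclass A) :=
  [set c | exists d (C : rmod A),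
    [/\ X d, iso (repbar d) (dsum Qbar C) & c = cls (dsum Qmod C)]].

End ProjectiveInjective.
Arguments setM1 {K A} Q _.
Arguments setM2m {K A} Q _.
Arguments setM2p {K A} Q _.
Arguments setM3 {K A} Q _.
Arguments setN1 {K A} Q _.
Arguments setN2 {K A} Q _.
Arguments setN3 {K A} Q _.
Arguments sttilt_bar_N2 {K A} Q _.
Arguments alphaQ {K A} Q c.
Arguments alphaQ_all {K A} Q c.

Definition disjoint_union (T : Type) (X : set T) (s : seq (set T)) :=
  X = \big[setU/set0]_(Y <- s) Y /\
  forall i j, (i < j)%N -> (j < size s)%N ->
    nth set0 s i `&` nth set0 s j = set0.

(* Main.v *)
From HB Require Import structures.
Require Import Defs.
From mathcomp Require Import all_boot all_order all_algebra.
From mathcomp Require Import falgebra mxrepresentation generic_quotient finmap.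
From mathcomp Require Import boolp classical_sets functions cardinality.

(** Support tau-tilting modules over an algebra A are first described without
the Auslander-Reiten translate. Write Fac M for the class of modules generated
by M. Then M is tau-rigid iff Ext^1(M, Fac M) = 0 (tau_rigidP): for a minimal
presentation P1 -> P0 -> M -> 0 the space Hom(X, tau M) is dual to the cokernel
of Hom(P0, X) -> Hom(P1, X), and minimality turns the vanishing of this cokernel
at X = M into the vanishing of extensions. Next, a tau-rigid M is support
tau-tilting iff it has as many indecomposable summands as there are
indecomposable projectives P with Hom(P, M) <> 0 (support_tau_tiltingP). This
needs the inequality nsummands_le_supp for every tau-rigid M. If it failed, the
g-vectors of the summands would satisfy a linear relation, which yields modules
U and V in add M without common summand such that dim Hom(U, X) = dim Hom(V, X)
for all X in Fac M; but then V is a direct summand of some U^r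
(hdim_eq_retract).

Let now S be the socle of Q. It is the least nonzero submodule of Q, so a module
on which S does not act by zero contains a copy of Q, which splits off because Q
is injective. Hence the indecomposable A-modules are Q and the indecomposable
modules over A/S. Three facts compare the two algebras, for modules N and C over
A/S and for Qbar = Q/S.

- An A-extension of C by a module Y in Fac N which is not an A/S-extension
contains Q. It produces a nonzero map from Y to Q, with image J say, and a
surjection from C to Q/J. This is impossible if Hom(N, Q) = 0. If the extensions
over A/S vanish, then the surjection lifts to C -> Qbar, which is again
surjective since Q has a unique maximal submodule, so that Qbar is a summand of C
(ext0_lift).

- Conversely, let Qbar be a summand of N and let J be the image of a nonzero map
N -> Q. The map Qbar -> Q/J does not lift to Q, so Ext^1(N, Fac N) is not zero
over A (ext0_Qbar_hom).

- The composition factors of Q are those of Qbar together with S, and S is a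
composition factor of N iff Hom(N, Q) <> 0 (suppset_Q, soc_proj_mem).

They combine into stt_criterion_killed, stt_criterion_addQ and
stt_criterion_exchange, which decide when N, Q + N and Q + C are support
tau-tilting over A in terms of N and Qbar + C over A/S. The bijections follow by
the Krull-Schmidt theorem: tensoring with A/S fixes the modules over A/S and
sends Q to Qbar. *)

Set Implicit Arguments.
Unset Strict Implicit.
Unset Printing Implicit Defensive.

Import GRing.Theory VectorInternalTheory.
Local Open Scope ring_scope.
Local Open Scope classical_set_scope.
Local Open Scope quotient_scope.

(** * Homomorphisms of modules as matrices *)

Notation ishom M N f := (@is_hom _ _ M N f).

Section Homomorphisms.
Variables (K : fieldType) (A : fdalg K).
Implicit Types M N P X Y Z : rmod A.

Lemma ishom0 M N : ishom M N 0.
Proof. by move=> a; rewrite mulmx0 mul0mx. Qed.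
Lemma ishom1 M : ishom M M 1%:M.
Proof. by move=> a; rewrite mulmx1 mul1mx. Qed.
Lemma ishomD M N f g : ishom M N f -> ishom M N g -> ishom M N (f + g).
Proof. by move=> hf hg a; rewrite mulmxDr hf hg mulmxDl. Qed.
Lemma ishomZ M N k f : ishom M N f -> ishom M N (k *: f).
Proof. by move=> hf a; rewrite -scalemxAr hf scalemxAl. Qed.
Lemma ishomN M N f : ishom M N f -> ishom M N (- f).
Proof. by move=> hf a; rewrite mulmxN hf mulNmx. Qed.
Lemma ishomB M N f g : ishom M N f -> ishom M N g -> ishom M N (f - g).
Proof. by move=> hf hg; apply: ishomD => //; apply: ishomN. Qed.
Lemma ishomM M N P f g : ishom M N f -> ishom N P g -> ishom M P (f *m g).
Proof. by move=> hf hg a; rewrite mulmxA hf -!mulmxA hg. Qed.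
Lemma ishomX M f k : ishom M M f -> ishom M M (f ^+ k).
Proof.
move=> hf; elim: k => [|k IH]; first by rewrite expr0; apply: ishom1.
by rewrite exprS; apply: ishomM.
Qed.

Lemma isoP M N : iso M N <-> exists f g,
  [/\ ishom M N f, ishom N M g, f *m g = 1%:M & g *m f = 1%:M].
Proof.
split=> [[f [g [fg gf]]]|[f [g [hf hg fg gf]]]].
  by exists f, g; split=> //; apply: homP.
by exists (Defs.Hom hf), (Defs.Hom hg).
Qed.

Lemma ishom_unit M N f g : ishom M N f -> f *m g = 1%:M -> g *m f = 1%:M ->
  ishom N M g.
Proof.
move=> hf fg gf a.
by rewrite -{1}[N a]mul1mx -gf -(mulmxA g f) -hf !mulmxA -(mulmxA _ f) fg mulmx1.
Qed.

Lemma mulmx1_leq m n (f : 'M[K]_(m, n)) g : f *m g = 1%:M -> (m <= n)%N.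
Proof.
move=> fg; rewrite -{1}(mxrank1 K m) -fg.
exact: leq_trans (mxrankM_maxl _ _) (rank_leq_col _).
Qed.

Lemma iso_dim M N : iso M N -> rdim M = rdim N.
Proof.
case/isoP=> f [g [_ _ fg gf]]; apply/eqP.
by rewrite eqn_leq (mulmx1_leq fg) (mulmx1_leq gf).
Qed.

Lemma row_full_canl m n p (q : 'M[K]_(m, n)) (f g : 'M_(n, p)) :
  row_full q -> q *m f = q *m g -> f = g.
Proof.
by case/row_fullP=> B Bq qfg; rewrite -[f]mul1mx -[g]mul1mx -Bq -!mulmxA qfg.
Qed.
Lemma row_free_canr m n p (i : 'M[K]_(m, n)) (f g : 'M_(p, m)) :
  row_free i -> f *m i = g *m i -> f = g.
Proof.
by case/row_freeP=> B iB fig; rewrite -[f]mulmx1 -[g]mulmx1 -iB !mulmxA fig.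
Qed.

Lemma row_fullM m n p (f : 'M[K]_(m, n)) (g : 'M_(n, p)) :
  row_full f -> row_full g -> row_full (f *m g).
Proof.
case/row_fullP=> B B1 /row_fullP[C C1]; apply/row_fullP; exists (C *m B).
by rewrite mulmxA -(mulmxA C) B1 mulmx1.
Qed.
Lemma row_full_mull m n p (f : 'M[K]_(m, n)) (g : 'M_(n, p)) :
  row_full (f *m g) -> row_full g.
Proof. by case/row_fullP=> B B1; apply/row_fullP; exists (B *m f); rewrite -mulmxA. Qed.

Lemma bij_iso M N f : ishom M N f -> row_free f -> row_full f -> iso M N.
Proof.
move=> hf /row_freeP[B fB] /row_fullP[C Cf]; apply/isoP.
have CB : C = B by rewrite -[C]mulmx1 -fB mulmxA Cf mul1mx.
move: Cf; rewrite CB => Bf.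
by exists f, B; split=> //; apply: (ishom_unit hf).
Qed.

Lemma inj_dim_iso M N f : ishom M N f -> row_free f -> (rdim N <= rdim M)%N -> iso M N.
Proof.
move=> hf ff le; apply: (bij_iso hf ff); rewrite -col_leq_rank.
by move: ff; rewrite /row_free => /eqP ->.
Qed.

Lemma sub_ex M k (U : 'M[K]_(k, rdim M)) : (forall a, (U *m M a <= U)%MS) ->
  exists X i, [/\ ishom X M i, row_free i & (i :=: U)%MS].
Proof.
move=> stU.
have st a : (<<U>>%MS *m M a <= <<U>>%MS)%MS.
  by rewrite (eqmxMr _ (genmxE U)) genmxE.
pose V : submodule M := Submodule st.
have eV : (val_submod (1%:M : 'M_(\rank V)) :=: U)%MS.
  exact: eqmx_trans (val_submod1 V) (genmxE U).
exists (submod V), (val_submod (1%:M : 'M_(\rank V))); split=> //.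
  move=> a; rewrite -val_submodE -[X in val_submod X]mul1mx.
  by rewrite (submod_val (U := V)).
by rewrite /row_free eV /= genmxE.
Qed.

Lemma quo_ex M k (U : 'M[K]_(k, rdim M)) : (forall a, (U *m M a <= U)%MS) ->
  exists X q, [/\ ishom M X q, row_full q & (kermx q :=: U)%MS].
Proof.
move=> stU.
have st a : (<<U>>%MS *m M a <= <<U>>%MS)%MS.
  by rewrite (eqmxMr _ (genmxE U)) genmxE.
pose V : submodule M := Submodule st.
have kE m (W : 'M_(m, rdim M)) : (W *m in_factmod V 1%:M == 0) = (W <= U)%MS.
  by rewrite -in_factmodE in_factmod_eq0 genmxE.
exists (factmod V), (in_factmod V 1%:M); split.
- move=> a; rewrite -in_factmodE -[in LHS](mul1mx (M a)).
  by rewrite -(factmod_in V).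
- apply/row_fullP; exists (val_factmod 1%:M).
  by rewrite -in_factmodE val_factmodK.
- apply/eqmxP/andP; split; first by rewrite -kE mulmx_ker.
  by apply/sub_kermxP/eqP; rewrite kE.
Qed.

Lemma ker_ex M N f : ishom M N f ->
  exists X i, [/\ ishom X M i, row_free i & (i :=: kermx f)%MS].
Proof.
move=> hf; apply: sub_ex => a.
by apply/sub_kermxP; rewrite -mulmxA hf mulmxA mulmx_ker mul0mx.
Qed.

Lemma im_ex M N f : ishom M N f -> exists X p i,
  [/\ ishom M X p, ishom X N i, row_full p, row_free i & f = p *m i].
Proof.
move=> hf; have [|X [i [hi ii iE]]] := @sub_ex N _ f.
  by move=> a; rewrite -hf submxMl.
have fE : f *m pinvmx i *m i = f by rewrite mulmxKpV // iE.
exists X, (f *m pinvmx i), i; split=> //.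
  move=> a; apply: (row_free_canr ii).
  by rewrite -mulmxA fE hf -{1}fE -!mulmxA hi.
have rX : rdim X = \rank f by rewrite -iE; apply/esym/eqP.
rewrite -col_leq_rank {1}rX -{1}fE; exact: mxrankM_maxl.
Qed.

Lemma coker_ex M N f : ishom M N f ->
  exists X q, [/\ ishom N X q, row_full q & (kermx q :=: f)%MS].
Proof. by move=> hf; apply: quo_ex => a; rewrite -hf submxMl. Qed.

Lemma mul_kermxK m n k (W : 'M[K]_(k, m)) (f : 'M_(m, n)) : W *m kermx f *m f = 0.
Proof. by rewrite -(mulmxA W) mulmx_ker mulmx0. Qed.

Lemma factor_inj W X M f i : ishom W M f -> ishom X M i -> row_free i ->
  (f <= i)%MS -> exists2 g, ishom W X g & g *m i = f.
Proof.
move=> hf hi ii fi; have fE : f *m pinvmx i *m i = f by rewrite mulmxKpV.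
exists (f *m pinvmx i) => // a; apply: (row_free_canr ii).
by rewrite -mulmxA fE hf -{1}fE -!mulmxA hi.
Qed.

Lemma ker_sub_mul m n p k (q : 'M[K]_(m, n)) (f : 'M_(m, p)) (W : 'M_(k, m)) :
  (kermx q <= kermx f)%MS -> W *m q = 0 -> W *m f = 0.
Proof. by move=> qf /sub_kermxP Wq; apply/sub_kermxP/(submx_trans Wq). Qed.

Lemma factor_surj M X W f q : ishom M W f -> ishom M X q -> row_full q ->
  (kermx q <= kermx f)%MS -> exists2 g, ishom X W g & q *m g = f.
Proof.
move=> hf hq fq kqf; have /row_fullP[B Bq] := fq.
have qBf : q *m (B *m f) = f.
  apply/eqP; rewrite -subr_eq0 mulmxA -{2}(mul1mx f) -mulmxBl.
  by apply/eqP/(ker_sub_mul kqf); rewrite mulmxBl -mulmxA Bq mulmx1 mul1mx subrr.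
exists (B *m f) => // a; apply: (row_full_canl fq).
by rewrite mulmxA -hq -mulmxA qBf hf -{1}qBf -!mulmxA.
Qed.

(** The preimage of the row space of U under q; by premxP it is characterised
without reference to the dimensions. *)
Definition premx m n k (q : 'M[K]_(m, n)) (U : 'M_(k, n)) := kermx (q *m cokermx U).
Lemma premxP m n k l (q : 'M[K]_(m, n)) (U : 'M_(k, n)) (W : 'M_(l, m)) :
  (W <= premx q U)%MS = (W *m q <= U)%MS.
Proof.
by rewrite [RHS]submxE -mulmxA; apply/sub_kermxP/eqP.
Qed.

Lemma projP P : projective_mod P -> forall M N p f, ishom M N p -> row_full p ->
  ishom P N f -> exists2 g, ishom P M g & g *m p = f.
Proof.
move=> prP M N p f hp fp hf; have [//|g gE] := prP M N (Defs.Hom hp) (Defs.Hom hf).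
by exists g => //; apply: homP.
Qed.

Lemma injP I : injective_mod I -> forall M N i f, ishom M N i -> row_free i ->
  ishom M I f -> exists2 g, ishom N I g & i *m g = f.
Proof.
move=> inI M N i f hi fi hf; have [//|g gE] := inI M N (Defs.Hom hi) (Defs.Hom hf).
by exists g => //; apply: homP.
Qed.

End Homomorphisms.

(** * Direct sums, Krull-Schmidt theorem and cancellation *)

Section DirectSums.
Variables (K : fieldType) (A : fdalg K).
Implicit Types M N P X Y Z : rmod A.

Lemma ishom_col M N P f g : ishom M P f -> ishom N P g ->
  ishom (dsum M N) P (col_mx f g).
Proof.
move=> hf hg a; rewrite /= /dsum_act mul_block_col !mul0mx addr0 add0r.
by rewrite hf hg mul_col_mx.
Qed.
Lemma ishom_row M N P f g : ishom P M f -> ishom P N g ->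
  ishom P (dsum M N) (row_mx f g).
Proof.
move=> hf hg a; rewrite /= /dsum_act mul_row_block !mulmx0 addr0 add0r.
by rewrite -hf -hg mul_mx_row.
Qed.

Definition inl_mx M N : 'M[K]_(rdim M, rdim (dsum M N)) := row_mx 1%:M 0.
Definition inr_mx M N : 'M[K]_(rdim N, rdim (dsum M N)) := row_mx 0 1%:M.
Definition fst_mx M N : 'M[K]_(rdim (dsum M N), rdim M) := col_mx 1%:M 0.
Definition snd_mx M N : 'M[K]_(rdim (dsum M N), rdim N) := col_mx 0 1%:M.

Lemma inl_hom M N : ishom M (dsum M N) (inl_mx M N).
Proof. by apply: ishom_row; [apply: ishom1|apply: ishom0]. Qed.
Lemma inr_hom M N : ishom N (dsum M N) (inr_mx M N).
Proof. by apply: ishom_row; [apply: ishom0|apply: ishom1]. Qed.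
Lemma fst_hom M N : ishom (dsum M N) M (fst_mx M N).
Proof. by apply: ishom_col; [apply: ishom1|apply: ishom0]. Qed.
Lemma snd_hom M N : ishom (dsum M N) N (snd_mx M N).
Proof. by apply: ishom_col; [apply: ishom0|apply: ishom1]. Qed.

Lemma inl_fst M N : inl_mx M N *m fst_mx M N = 1%:M.
Proof. by rewrite /inl_mx /fst_mx mul_row_col mulmx1 mulmx0 addr0. Qed.
Lemma inl_snd M N : inl_mx M N *m snd_mx M N = 0.
Proof. by rewrite /inl_mx /snd_mx mul_row_col mulmx0 mul0mx addr0. Qed.
Lemma inr_fst M N : inr_mx M N *m fst_mx M N = 0.
Proof. by rewrite /inr_mx /fst_mx mul_row_col mulmx0 mul0mx addr0. Qed.
Lemma inr_snd M N : inr_mx M N *m snd_mx M N = 1%:M.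
Proof. by rewrite /inr_mx /snd_mx mul_row_col mulmx1 mul0mx add0r. Qed.
Lemma fst_inl_snd_inr M N : fst_mx M N *m inl_mx M N + snd_mx M N *m inr_mx M N = 1%:M.
Proof.
rewrite /fst_mx /inl_mx /snd_mx /inr_mx !mul_col_row !mul1mx !mulmx0 !mul0mx add_block_mx.
by rewrite !addr0 !add0r -scalar_mx_block.
Qed.

Lemma inl_col M N p (f : 'M[K]_(rdim M, p)) (g : 'M_(rdim N, p)) :
  inl_mx M N *m col_mx f g = f.
Proof. by rewrite /inl_mx mul_row_col mul1mx mul0mx addr0. Qed.
Lemma inr_col M N p (f : 'M[K]_(rdim M, p)) (g : 'M_(rdim N, p)) :
  inr_mx M N *m col_mx f g = g.
Proof. by rewrite /inr_mx mul_row_col mul1mx mul0mx add0r. Qed.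
Lemma row_snd M N p (f : 'M[K]_(p, rdim M)) (g : 'M_(p, rdim N)) :
  row_mx f g *m snd_mx M N = g.
Proof. by rewrite /snd_mx mul_row_col mulmx1 mulmx0 add0r. Qed.

Lemma dsum_rowE M N m (W : 'M[K]_(m, rdim (dsum M N))) :
  W = row_mx (W *m fst_mx M N) (W *m snd_mx M N).
Proof.
rewrite -[LHS]mulmx1 -(fst_inl_snd_inr M N) mulmxDr /inl_mx /inr_mx !mulmxA.
by rewrite !mul_mx_row !mulmx1 !mulmx0 add_row_mx addr0 add0r.
Qed.
Lemma dsum_colE M N p (W : 'M[K]_(rdim (dsum M N), p)) :
  W = col_mx (inl_mx M N *m W) (inr_mx M N *m W).
Proof.
rewrite -mul_col_mx -[X in X *m _]/(block_mx 1%:M 0 0 1%:M).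
by rewrite -scalar_mx_block mul1mx.
Qed.

Lemma biprod_iso M X Y i1 p1 i2 p2 :
  ishom X M i1 -> ishom M X p1 -> ishom Y M i2 -> ishom M Y p2 ->
  i1 *m p1 = 1%:M -> i2 *m p2 = 1%:M -> i1 *m p2 = 0 -> i2 *m p1 = 0 ->
  p1 *m i1 + p2 *m i2 = 1%:M -> iso M (dsum X Y).
Proof.
move=> hi1 hp1 hi2 hp2 e11 e22 e12 e21 e1; apply/isoP.
exists (row_mx p1 p2), (col_mx i1 i2); split.
- exact: ishom_row.
- exact: ishom_col.
- by rewrite mul_row_col.
- by rewrite mul_col_row e11 e22 e12 e21 -scalar_mx_block.
Qed.

(** Direct summands given by maps. Unlike an isomorphism with a direct sum, this
form composes and is preserved by additive functors. *)
Definition retract X M := exists i p,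
  [/\ ishom X M i, ishom M X p & i *m p = 1%:M].

Lemma retract_compl X M i p : ishom X M i -> ishom M X p -> i *m p = 1%:M ->
  exists Y j q, [/\ ishom Y M j, ishom M Y q, j *m q = 1%:M &
    [/\ j *m p = 0, i *m q = 0, p *m i + q *m j = 1%:M & (j :=: kermx p)%MS]].
Proof.
move=> hi hp ip; have [Y [j [hj fj jE]]] := ker_ex hp.
have jp : j *m p = 0 by apply/sub_kermxP; rewrite jE.
have [||q hq qj] := factor_inj (f := 1%:M - p *m i) _ hj fj.
- by apply: ishomB; [apply: ishom1|apply: ishomM hp hi].
- by rewrite jE; apply/sub_kermxP; rewrite mulmxBl -mulmxA ip mulmx1 mul1mx subrr.
exists Y, j, q; split=> //.
  by apply: (row_free_canr fj); rewrite -mulmxA qj mulmxBr mulmxA jp mul0mx subr0 mulmx1 mul1mx.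
split=> //; last by rewrite qj addrC subrK.
by apply: (row_free_canr fj); rewrite -mulmxA qj mul0mx mulmxBr mulmxA ip mul1mx mulmx1 subrr.
Qed.

Lemma summandP X M : summand X M <-> retract X M.
Proof.
split=> [[Y /isoP[f [g [hf hg fg gf]]]]|[i [p [hi hp ip]]]].
  exists (inl_mx X Y *m g), (f *m fst_mx X Y); split.
  - exact: ishomM (inl_hom X Y) hg.
  - exact: ishomM hf (fst_hom X Y).
  - by rewrite mulmxA -(mulmxA _ g) gf mulmx1 inl_fst.
have [Y [j [q [hj hq jq [jp iq e1 _]]]]] := retract_compl hi hp ip.
by exists Y; apply: (biprod_iso hi hp hj hq).
Qed.

Lemma iso_retract X M : iso X M -> retract X M.
Proof. by case/isoP=> f [g [hf hg fg _]]; exists f, g. Qed.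
Lemma retract_refl M : retract M M.
Proof. exact/iso_retract/iso_refl. Qed.
Lemma retract_trans X Y Z : retract X Y -> retract Y Z -> retract X Z.
Proof.
case=> i [p [hi hp ip]] [j [q [hj hq jq]]]; exists (i *m j), (q *m p); split.
- exact: ishomM hi hj.
- exact: ishomM hq hp.
- by rewrite mulmxA -(mulmxA i) jq mulmx1.
Qed.
Lemma retract_dim X M : retract X M -> (rdim X <= rdim M)%N.
Proof. by case=> i [p [_ _ ip]]; apply: mulmx1_leq ip. Qed.
(** Many isomorphisms below are obtained from a one-sided inverse and a count of
dimensions, which saves the verification of the second identity. *)
Lemma retract_dim_iso X M : retract X M -> (rdim M <= rdim X)%N -> iso X M.
Proof.
by case=> i [p [hi _ ip]]; apply: (inj_dim_iso hi); apply/row_freeP; exists p.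
Qed.
Lemma retract_inl X Y : retract X (dsum X Y).
Proof. by exists (inl_mx X Y), (fst_mx X Y); split; [apply: inl_hom|apply: fst_hom|apply: inl_fst]. Qed.
Lemma retract_inr X Y : retract Y (dsum X Y).
Proof. by exists (inr_mx X Y), (snd_mx X Y); split; [apply: inr_hom|apply: snd_hom|apply: inr_snd]. Qed.
Lemma retract0 X M : rdim X = 0%N -> retract X M.
Proof.
move=> X0; have z m (f g : 'M[K]_(rdim X, m)) : f = g.
  by apply/matrixP => i; move: (ltn_ord i); rewrite {2}X0.
by exists 0, 0; split; [apply: ishom0|apply: ishom0|apply: z].
Qed.

Lemma retract_dsum X X' Y Y' : retract X Y -> retract X' Y' ->
  retract (dsum X X') (dsum Y Y').
Proof.
case=> i [p [hi hp ip]] [j [q [hj hq jq]]].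
exists (col_mx (row_mx i 0) (row_mx 0 j)), (col_mx (row_mx p 0) (row_mx 0 q)); split.
- apply: ishom_col; apply: ishom_row => //; exact: ishom0.
- apply: ishom_col; apply: ishom_row => //; exact: ishom0.
rewrite mul_col_mx !mul_row_col !mul0mx addr0 add0r !mul_mx_row !mulmx0 ip jq.
by rewrite [RHS](scalar_mx_block (rdim X)).
Qed.

Lemma iso_dsum X X' Y Y' : iso X Y -> iso X' Y' -> iso (dsum X X') (dsum Y Y').
Proof.
move=> iX iX'; apply: retract_dim_iso.
  by apply: retract_dsum; apply: iso_retract.
by rewrite /= (iso_dim iX) (iso_dim iX').
Qed.

Lemma dsumC X Y : iso (dsum X Y) (dsum Y X).
Proof.
apply: (biprod_iso (inr_hom X Y) (snd_hom X Y) (inl_hom X Y) (fst_hom X Y)).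
- exact: inr_snd.
- exact: inl_fst.
- exact: inr_fst.
- exact: inl_snd.
- by rewrite addrC fst_inl_snd_inr.
Qed.

Lemma dsumA X Y Z : iso (dsum X (dsum Y Z)) (dsum (dsum X Y) Z).
Proof.
apply: retract_dim_iso; last by rewrite /= addnA.
exists (col_mx (row_mx (row_mx 1%:M 0) 0)
          (col_mx (row_mx (row_mx 0 1%:M) 0) (row_mx (row_mx 0 0) 1%:M))).
exists (col_mx (col_mx (row_mx 1%:M 0) (row_mx 0 (row_mx 1%:M 0)))
          (row_mx 0 (row_mx 0 1%:M))); split.
- by do ?apply: ishom_col; do ?apply: ishom_row; (exact: ishom0 || exact: ishom1).
- by do ?apply: ishom_col; do ?apply: ishom_row; (exact: ishom0 || exact: ishom1).
rewrite !mul_col_mx !mul_row_col !mul0mx !mul1mx !addr0 !add0r.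
rewrite [RHS](scalar_mx_block (rdim X)) /block_mx; congr col_mx.
rewrite [in RHS](scalar_mx_block (rdim Y)) /block_mx.
by rewrite -[LHS]/(block_mx _ _ _ _) block_mxEh col_mx0.
Qed.

Lemma dsumCA X Y Z : iso (dsum X (dsum Y Z)) (dsum Y (dsum X Z)).
Proof.
apply: iso_trans (dsumA X Y Z) _; apply: iso_trans _ (iso_sym (dsumA Y X Z)).
by apply: iso_dsum; [apply: dsumC|apply: iso_refl].
Qed.

Lemma dsum0 X Y : rdim Y = 0%N -> iso (dsum X Y) X.
Proof.
move=> Y0; apply: iso_sym; apply: retract_dim_iso; first exact: retract_inl.
by rewrite /= Y0 addn0.
Qed.

Lemma iso_dim0 X Y : rdim X = 0%N -> rdim Y = 0%N -> iso X Y.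
Proof. by move=> X0 Y0; apply: retract_dim_iso; [apply: retract0|rewrite Y0]. Qed.

Lemma bigdsum_cat (s t : seq (rmod A)) :
  iso (bigdsum (s ++ t)) (dsum (bigdsum s) (bigdsum t)).
Proof.
elim: s => [|X s IH] /=.
  by apply: iso_sym; apply: iso_trans (dsumC _ _) _; apply: dsum0.
apply: iso_trans (iso_dsum (iso_refl X) IH) _; exact: dsumA.
Qed.

Lemma retract_dsum_l X Y M : retract (dsum X Y) M -> retract X M.
Proof. exact/retract_trans/retract_inl. Qed.

Lemma retract_isol X Y M : iso X Y -> retract Y M -> retract X M.
Proof. by move=> XY; apply/retract_trans/iso_retract. Qed.
Lemma retract_isor X Y M : iso X Y -> retract M X -> retract M Y.
Proof. by move=> XY MX; apply: retract_trans MX _; apply: iso_retract. Qed.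

(** Fitting: once the rank of the powers of h is stationary, the image of a power
meets its kernel trivially, and h acts bijectively on it. *)
Lemma fitting M h : ishom M M h -> exists k X i p u,
  [/\ ishom X M i, ishom M X p, i *m p = 1%:M, u \in unitmx & h ^+ k.+1 = p *m u *m i].
Proof.
move=> hh; pose r k := \rank (h ^+ k.+1).
have [k _ rk] : exists2 k, True & forall j, (r k <= r j)%N.
  have ex0 : exists n, `[< exists k, r k = n >] by exists (r 0%N); apply/asboolP; exists 0%N.
  case: (ex_minnP ex0) => n /asboolP[k rk] minn; exists k => // j.
  by rewrite rk; apply: minn; apply/asboolP; exists j.
have hhk := ishomX k.+1 hh; set g := h ^+ k.+1 in hhk *.
have rgg : \rank (g *m g) = \rank g.
  apply/eqP; rewrite eqn_leq mxrankM_maxl /=.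
  have -> : g *m g = h ^+ (k + k.+1).+1 by rewrite -addSn exprD.
  exact: rk.
have [X [p [i [hp hi fp fi gE]]]] := im_ex hhk.
have rX : \rank g = rdim X.
  by rewrite gE mxrankMfree //; apply/eqP.
have uip : i *m p \in unitmx.
  rewrite -row_full_unit -col_leq_rank -{1}rX -rgg gE mulmxA -(mulmxA p i).
  exact: leq_trans (mxrankM_maxl _ _) (mxrankM_maxr _ _).
pose u := i *m p; have hu : ishom X X u by apply: ishomM hi hp.
have hu' : ishom X X (invmx u).
  by apply: (ishom_unit hu); [apply: mulmxV|apply: mulVmx].
exists k, X, i, (p *m invmx u), u; split=> //.
- exact: ishomM hp hu'.
- by rewrite mulmxA mulmxV.
- by rewrite mulmxKV.
Qed.

Lemma retract_unit m n (i : 'M[K]_(m, n)) p u : i *m p = 1%:M -> (n <= m)%N ->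
  u \in unitmx -> p *m u *m i \in unitmx.
Proof.
move=> ip le uu; rewrite -row_full_unit -col_leq_rank.
apply: leq_trans le _; rewrite -{1}(mxrank_unit uu).
have {1}-> : u = i *m (p *m u *m i) *m p by rewrite !mulmxA ip mul1mx -mulmxA ip mulmx1.
exact: leq_trans (mxrankM_maxl _ _) (mxrankM_maxr _ _).
Qed.

Lemma indec_retract X M : indecomposable M -> retract X M ->
  rdim X = 0%N \/ iso X M.
Proof.
move=> [_ indM] rXM; have /summandP[Y iMY] := rXM.
have [->|Y0] := indM _ _ iMY; [by left|right].
by apply: retract_dim_iso => //; rewrite (iso_dim iMY) /= Y0 addn0.
Qed.

Lemma indec_fitting M h : indecomposable M -> ishom M M h ->
  h \in unitmx \/ exists k, h ^+ k = 0.
Proof.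
move=> indM hh; have [k [X [i [p [u [hi hp ip uu hk]]]]]] := fitting hh.
have [X0|iXM] : rdim X = 0%N \/ iso X M.
  by apply: indec_retract => //; exists i, p.
  right; exists k.+1; rewrite hk; suff -> : i = 0 by rewrite mulmx0.
  by apply/matrixP => a; move: (ltn_ord a); rewrite {2}X0.
left; suff : h ^+ k.+1 \in unitmx by rewrite exprS unitmx_mul => /andP[].
by rewrite hk (retract_unit ip) // (iso_dim iXM).
Qed.

(** The form in which the locality of an endomorphism ring is used most: an
endomorphism of an indecomposable module which fixes some nonzero map cannot be
nilpotent. *)
Lemma indec_fixr M h n (m : 'M_(rdim M, n)) : indecomposable M -> ishom M M h ->
  h *m m = m -> m != 0 -> h \in unitmx.
Proof.
move=> indM hh hm m0; have [//|[k hk]] := indec_fitting indM hh.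
case/negP: m0; have : h ^+ k *m m = m.
  by elim: k {hk} => [|k IH]; [rewrite mul1mx|rewrite exprSr -mulmxA hm].
by rewrite hk mul0mx => <-.
Qed.

Lemma indec_fixl M h n (m : 'M_(n, rdim M)) : indecomposable M -> ishom M M h ->
  m *m h = m -> m != 0 -> h \in unitmx.
Proof.
move=> indM hh hm m0; have [//|[k hk]] := indec_fitting indM hh.
case/negP: m0; have : m *m h ^+ k = m.
  by elim: k {hk} => [|k IH]; [rewrite mulmx1|rewrite exprS mulmxA hm].
by rewrite hk mulmx0 => <-.
Qed.

Lemma ishom_inv M h : ishom M M h -> h \in unitmx -> ishom M M (invmx h).
Proof. by move=> hh u; apply: (ishom_unit hh); [apply: mulmxV|apply: mulVmx]. Qed.

(** If f is not invertible, a nonzero kernel vector of g = 1 - f would be fixed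
by f. *)
Lemma indec_local1 M f g : indecomposable M -> ishom M M f -> ishom M M g ->
  f + g = 1%:M -> f \in unitmx \/ g \in unitmx.
Proof.
move=> indM hf hg fg; case: (boolP (f \in unitmx)) => [|nf]; [by left|right].
rewrite -row_free_unit -kermx_eq0; apply/contraT => k0; case/negP: nf.
apply: (indec_fixl indM hf _ k0).
have -> : f = 1%:M - g by rewrite -fg addrK.
by rewrite mulmxBr mulmx1 mulmx_ker subr0.
Qed.

Lemma indec_local M f g : indecomposable M -> ishom M M f -> ishom M M g ->
  f + g \in unitmx -> f \in unitmx \/ g \in unitmx.
Proof.
move=> indM hf hg u; have hu := ishom_inv (ishomD hf hg) u.
have [||||] := @indec_local1 M (f *m invmx (f + g)) (g *m invmx (f + g)) indM.
- exact: ishomM hf hu.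
- exact: ishomM hg hu.
- by rewrite -mulmxDl mulmxV.
- by rewrite unitmx_mul => /andP[]; left.
- by rewrite unitmx_mul => /andP[]; right.
Qed.

Lemma unit_retract X Y f g : ishom X Y f -> ishom Y X g -> f *m g \in unitmx ->
  retract X Y.
Proof.
move=> hf hg u; exists f, (g *m invmx (f *m g)); split=> //.
  exact: ishomM hg (ishom_inv (ishomM hf hg) u).
by rewrite mulmxA mulmxV.
Qed.

Lemma indec_prime X Y Z f g f' g' : indecomposable X ->
  ishom X Y f -> ishom Y X g -> ishom X Z f' -> ishom Z X g' ->
  f *m g + f' *m g' = 1%:M -> retract X Y \/ retract X Z.
Proof.
move=> indX hf hg hf' hg' e.
have [|] := indec_local1 indX (ishomM hf hg) (ishomM hf' hg') e.
  by left; apply: unit_retract hf hg _.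
by right; apply: unit_retract hf' hg' _.
Qed.

Lemma indec_dsum X Y Z : indecomposable X -> retract X (dsum Y Z) ->
  retract X Y \/ retract X Z.
Proof.
move=> indX [i [p [hi hp ip]]].
apply: (@indec_prime X Y Z (i *m fst_mx Y Z) (inl_mx Y Z *m p)
          (i *m snd_mx Y Z) (inr_mx Y Z *m p)) => //.
- exact: ishomM hi (fst_hom _ _).
- exact: ishomM (inl_hom _ _) hp.
- exact: ishomM hi (snd_hom _ _).
- exact: ishomM (inr_hom _ _) hp.
by rewrite !mulmxA -mulmxDl -!(mulmxA i) -mulmxDr fst_inl_snd_inr mulmx1.
Qed.

Lemma retract_indec X Y : indecomposable X -> indecomposable Y -> retract X Y -> iso X Y.
Proof.
move=> [X0 _] indY rXY; have [X0'|//] := indec_retract indY rXY.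
by rewrite X0' in X0.
Qed.

Lemma indec_iso X Y : iso X Y -> indecomposable X -> indecomposable Y.
Proof.
move=> XY [X0 indX]; split=> [|U V YUV]; first by rewrite -(iso_dim XY).
by apply: indX; apply: iso_trans XY YUV.
Qed.

Lemma indec_not_retract0 X Y : indecomposable X -> rdim Y = 0%N -> ~ retract X Y.
Proof. by move=> [X0 _] Y0 /retract_dim; rewrite Y0 leqNgt X0. Qed.

(** Gaussian elimination: when the entry X -> X of an isomorphism from X + Y to
X + Z is invertible, its Schur complement is inverse to the entry Z -> Y of the
inverse. *)
Lemma cancel_unit X Y Z f g : ishom (dsum X Y) (dsum X Z) f ->
  ishom (dsum X Z) (dsum X Y) g -> f *m g = 1%:M ->
  inl_mx X Y *m f *m fst_mx X Z \in unitmx -> retract Y Z.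
Proof.
move=> hf hg fg; set a := _ *m _ => ua.
pose c := inr_mx X Y *m f *m fst_mx X Z; pose b := inl_mx X Y *m f *m snd_mx X Z.
pose d := inr_mx X Y *m f *m snd_mx X Z.
have ha : ishom X X a by apply: ishomM (fst_hom _ _); apply: ishomM hf; apply: inl_hom.
have hc : ishom Y X c by apply: ishomM (fst_hom _ _); apply: ishomM hf; apply: inr_hom.
have hb : ishom X Z b by apply: ishomM (snd_hom _ _); apply: ishomM hf; apply: inl_hom.
have hd : ishom Y Z d by apply: ishomM (snd_hom _ _); apply: ishomM hf; apply: inr_hom.
have ha' := ishom_inv ha ua.
pose d' := inr_mx X Z *m g *m snd_mx X Y; pose b' := inl_mx X Z *m g *m snd_mx X Y.
have sR : snd_mx X Z *m inr_mx X Z = 1%:M - fst_mx X Z *m inl_mx X Z.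
  by rewrite -(fst_inl_snd_inr X Z) addrAC subrr add0r.
have dd : d *m d' = 1%:M - c *m b'.
  rewrite /d /d' !mulmxA -(mulmxA _ (snd_mx X Z)) sR mulmxBr mulmx1 2!mulmxBl.
  by rewrite -(mulmxA _ f g) fg mulmx1 inr_snd /c /b' !mulmxA.
have bd : b *m d' = - (a *m b').
  rewrite /b /d' !mulmxA -(mulmxA _ (snd_mx X Z)) sR mulmxBr mulmx1 2!mulmxBl.
  by rewrite -(mulmxA _ f g) fg mulmx1 inl_snd sub0r /a /b' !mulmxA.
exists (d - c *m invmx a *m b), d'; split.
- by apply: ishomB hd _; apply: ishomM hb; apply: ishomM hc ha'.
- by apply: ishomM (snd_hom _ _); apply: ishomM hg; apply: inr_hom.
- by rewrite mulmxBl dd -(mulmxA _ b) bd mulmxN opprK -(mulmxA c) mulKmx // subrK.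
Qed.

(** If the entry X -> X of the isomorphism is not invertible, then locality
makes it so after composing with a transvection of X + Z. *)
Lemma dsum_cancel X Y Z : indecomposable X -> iso (dsum X Y) (dsum X Z) -> iso Y Z.
Proof.
move=> indX i; have /isoP[f [g [hf hg fg gf]]] := i.
apply: retract_dim_iso; last by move/iso_dim: i => /= /addnI ->.
pose a := inl_mx X Y *m f *m fst_mx X Z; pose b := inl_mx X Y *m f *m snd_mx X Z.
pose a' := inl_mx X Z *m g *m fst_mx X Y; pose c' := inr_mx X Z *m g *m fst_mx X Y.
have ha : ishom X X a by apply: ishomM (fst_hom _ _); apply: ishomM hf; apply: inl_hom.
have ha' : ishom X X a' by apply: ishomM (fst_hom _ _); apply: ishomM hg; apply: inl_hom.
have hb : ishom X Z b by apply: ishomM (snd_hom _ _); apply: ishomM hf; apply: inl_hom.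
have hc' : ishom Z X c' by apply: ishomM (fst_hom _ _); apply: ishomM hg; apply: inr_hom.
have e1 : a *m a' + b *m c' = 1%:M.
  rewrite /a /a' /b /c' !mulmxA -(mulmxA _ (fst_mx X Z)) -(mulmxA _ (snd_mx X Z)).
  rewrite -!mulmxDl -mulmxDr fst_inl_snd_inr mulmx1 -(mulmxA _ f) fg mulmx1.
  exact: inl_fst.
case: (boolP (a \in unitmx)) => [ua|na]; first exact: (cancel_unit hf hg fg ua).
have ubc : b *m c' \in unitmx.
  have [|//] := indec_local1 indX (ishomM ha ha') (ishomM hb hc') e1.
  by rewrite unitmx_mul (negPf na).
have uabc : a + b *m c' \in unitmx.
  have [|||//|] := @indec_local X (a + b *m c') (- a) indX.
  - by apply: ishomD ha _; apply: ishomM hb hc'.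
  - exact: ishomN.
  - by rewrite addrAC subrr add0r.
  - by rewrite -scaleN1r unitmxZ ?unitrN1 // (negPf na).
(* 1 + n is a transvection, with inverse 1 - n. *)
pose n := snd_mx X Z *m c' *m inl_mx X Z.
have hn : ishom (dsum X Z) (dsum X Z) n.
  by apply: ishomM (inl_hom _ _); apply: ishomM hc'; apply: snd_hom.
have nn : n *m n = 0.
  by rewrite /n -!mulmxA (mulmxA (inl_mx X Z)) inl_snd mul0mx !mulmx0.
apply: (@cancel_unit X Y Z (f *m (1%:M + n)) ((1%:M - n) *m g)).
- by apply: ishomM hf _; apply: ishomD (@ishom1 _ _ _) hn.
- by apply: ishomM _ hg; apply: ishomB (@ishom1 _ _ _) hn.
- rewrite mulmxA -(mulmxA f) mulmxDl mul1mx mulmxBr mulmx1 nn subr0 subrK.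
  by rewrite mulmx1.
- rewrite mulmxDr mulmx1 mulmxDr mulmxDl /n !mulmxA -(mulmxA _ (inl_mx X Z)).
  by rewrite inl_fst mulmx1; move: uabc; rewrite /a /b /c' !mulmxA.
Qed.

Lemma indec_decomp M : exists s : seq (rmod A),
  (forall X, X \in s -> indecomposable X) /\ iso M (bigdsum s).
Proof.
have [n] := ubnP (rdim M); elim: n M => // n IH M.
rewrite ltnS => leMn; case: (posnP (rdim M)) => [M0|M_gt0].
  by exists [::]; split=> //; apply: iso_dim0.
case: (pselect (indecomposable M)) => [indM|nindM].
  exists [:: M]; split=> [X|/=]; first by rewrite inE => /eqP ->.
  by apply: iso_sym; apply: dsum0.
have [X [Y [iM X0 Y0]]] : exists X Y, [/\ iso M (dsum X Y), (0 < rdim X)%N & (0 < rdim Y)%N].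
  apply: contra_notP nindM => nM; split=> // X Y iM.
  case: (posnP (rdim X)) => [|X0]; first by left.
  case: (posnP (rdim Y)) => [|Y0]; first by right.
  by case: nM; exists X, Y.
have dM : rdim M = (rdim X + rdim Y)%N by apply: iso_dim iM.
have [|s [inds iX]] := IH X; first by rewrite (leq_trans _ leMn) // dM -addn1 leq_add2l.
have [|t [indt iY]] := IH Y; first by rewrite (leq_trans _ leMn) // dM -add1n leq_add2r.
exists (s ++ t); split=> [Z|].
  by rewrite mem_cat => /orP[/inds|/indt].
apply: iso_trans iM _; apply: iso_trans (iso_dsum iX iY) _.
exact/iso_sym/bigdsum_cat.
Qed.

Lemma indec_bigdsum X (s : seq (rmod A)) : indecomposable X ->
  retract X (bigdsum s) -> exists2 Y, Y \in s & retract X Y.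
Proof.
move=> indX; elim: s => [/(indec_not_retract0 indX)[]//|Y s IH] /=.
case/(indec_dsum indX)=> [XY|/IH[Z sZ XZ]].
  by exists Y; rewrite ?inE ?eqxx.
by exists Z; rewrite // inE sZ orbT.
Qed.

Lemma mem_bigdsum X (s : seq (rmod A)) : X \in s -> retract X (bigdsum s).
Proof.
elim: s => // Y s IH; rewrite inE => /orP[/eqP ->|/IH XS] /=.
  exact: retract_inl.
by apply: retract_trans XS (retract_inr _ _).
Qed.

End DirectSums.

(** * The class Fac M and the vanishing of extensions *)

Notation pw n M := (bigdsum (nseq n M)).

Section HomSpace.
Variables (K : fieldType) (A : fdalg K).
Implicit Types M N P X Y Z : rmod A.

(** The space of homomorphisms, cut out by the equations for a basis of A. *)
Definition homsp M N : {vspace 'M[K]_(rdim M, rdim N)} :=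
  (\bigcap_(j < dim A) lker (linfun (fun f : 'M[K]_(rdim M, rdim N) =>
     (M (r2v (delta_mx 0 j)) *m f - f *m N (r2v (delta_mx 0 j)))%R)))%VS.

Lemma act_delta M (a : A) :
  M a = \sum_j (v2r a) 0 j *: M (r2v (delta_mx 0 j)).
Proof.
have lM : linear (ract M) by move=> k x y; apply: ract_lin.
pose fL := GRing.isSemilinear.Build _ _ _ _ _ (GRing.semilinear_linear lM).
pose g : {linear A -> 'M[K]_(rdim M)} := HB.pack (ract M) fL.
transitivity (g (r2v (\sum_j (v2r a) 0 j *: delta_mx 0 j))).
  by rewrite -row_sum_delta v2rK.
by rewrite !linear_sum; apply: eq_bigr => j _; rewrite !linearZ.
Qed.

Lemma mem_homsp M N f : (f \in homsp M N) <-> ishom M N f.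
Proof.
have lE b : linear (fun f : 'M[K]_(rdim M, rdim N) => (M b *m f - f *m N b)%R).
  move=> k x y; rewrite mulmxDr mulmxDl -scalemxAr -scalemxAl opprD addrACA.
  by rewrite -scalerBr.
have eE b g : linfun (fun f : 'M[K]_(rdim M, rdim N) => (M b *m f - f *m N b)%R) g
    = M b *m g - g *m N b.
  pose fL := GRing.isSemilinear.Build _ _ _ _ _ (GRing.semilinear_linear (lE b)).
  pose h : {linear 'M[K]_(rdim M, rdim N) -> 'M[K]_(rdim M, rdim N)} :=
    HB.pack (fun f : 'M[K]_(rdim M, rdim N) => (M b *m f - f *m N b)%R) fL.
  by rewrite (lfunE h).
rewrite memvE; split=> [/subv_bigcapP Hf a|hf].
  rewrite (act_delta M a) (act_delta N a) mulmx_suml mulmx_sumr.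
  apply: eq_bigr => j _; rewrite -scalemxAl -scalemxAr; congr (_ *: _).
  have := Hf j isT; rewrite -memvE memv_ker eE subr_eq0 => /eqP; exact.
by apply/subv_bigcapP => j _; rewrite -memvE memv_ker eE hf subrr.
Qed.

End HomSpace.

Section Powers.
Variables (K : fieldType) (A : fdalg K).
Implicit Types M N P X Y Z C E G : rmod A.

Lemma in_addP X M : in_add X M <-> exists n, retract X (pw n M).
Proof. by split=> -[n /summandP XM]; exists n. Qed.

Lemma pw_add m n M : iso (pw (m + n) M) (dsum (pw m M) (pw n M)).
Proof. by rewrite nseqD; apply: bigdsum_cat. Qed.

Lemma in_add_retract X Y M : retract X Y -> in_add Y M -> in_add X M.
Proof.
by move=> XY /in_addP[n YM]; apply/in_addP; exists n; apply: retract_trans YM.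
Qed.
Lemma in_add_dsum X Y M : in_add X M -> in_add Y M -> in_add (dsum X Y) M.
Proof.
move=> /in_addP[m XM] /in_addP[n YM]; apply/in_addP; exists (m + n)%N.
exact: retract_isor (iso_sym (pw_add _ _ _)) (retract_dsum XM YM).
Qed.
Lemma retract_in_add X M : retract X M -> in_add X M.
Proof.
by move=> XM; apply/in_addP; exists 1%N; apply: retract_trans XM (retract_inl _ _).
Qed.
Lemma in_add_pw n X M : in_add X M -> in_add (pw n X) M.
Proof.
move=> XM; elim: n => [|n IH] /=; last exact: in_add_dsum.
by apply/in_addP; exists 0%N; apply: retract_refl.
Qed.
Lemma in_add_trans X Y M : in_add X Y -> in_add Y M -> in_add X M.
Proof.
by move=> /in_addP[n XY] YM; apply: in_add_retract XY _; apply: in_add_pw.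
Qed.
Lemma in_add_indec X M : indecomposable X -> in_add X M <-> retract X M.
Proof.
move=> indX; split=> [/in_addP[n /(indec_bigdsum indX)[Y]]|/retract_in_add//].
by rewrite mem_nseq => /andP[_ /eqP ->].
Qed.

(** Right approximations by direct sums of copies of U exist because Hom(U, V)
has finite dimension. *)
Lemma approx (U V : rmod A) : exists n p, ishom (pw n U) V p /\
  forall f, ishom U V f -> exists2 j, ishom U (pw n U) j & j *m p = f.
Proof.
have [n [p [hp Hp]]] : exists n (p : 'M_(rdim (pw n U), rdim V)), ishom (pw n U) V p /\
    forall f, f \in (vbasis (homsp U V) : seq _) ->
      exists2 j, ishom U (pw n U) j & j *m p = f.
  have : {in (vbasis (homsp U V) : seq _), forall f, ishom U V f}.
    by move=> f /vbasis_mem /mem_homsp.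
  elim: (vbasis _ : seq _) => [_|f s IH Hs].
    by exists 0%N, 0; split; [apply: ishom0|].
  have [|n [p [hp Hp]]] := IH.
    by move=> g sg; apply: Hs; rewrite inE sg orbT.
  exists n.+1, (col_mx f p); split=> [|g].
    by apply: ishom_col => //; apply: Hs; rewrite inE eqxx.
  rewrite inE => /orP[/eqP ->|/Hp[j hj jp]].
    by exists (inl_mx _ _); [apply: inl_hom|apply: inl_col].
  exists (j *m inr_mx U (pw n U)); first exact: ishomM hj (inr_hom _ _).
  by rewrite -mulmxA inr_col.
exists n, p; split=> // f /mem_homsp/coord_vbasis ->.
have : forall i, exists j, ishom U (pw n U) j /\ j *m p = (vbasis (homsp U V))`_i.
  move=> i; have [le|lt] := leqP (size (vbasis (homsp U V))) i.
    by exists 0; split; [apply: ishom0|rewrite mul0mx nth_default].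
  by have [j hj jp] := Hp _ (mem_nth 0 lt); exists j.
case/choice=> j Hj; exists (\sum_(i < \dim (homsp U V)) coord (vbasis (homsp U V)) i f *: j i).
  elim/big_ind: _ => [|x y|i _]; [exact: ishom0|exact: ishomD|].
  by apply: ishomZ; have [] := Hj i.
rewrite mulmx_suml; apply: eq_bigr => i _; rewrite -scalemxAl.
by have [_ ->] := Hj i.
Qed.

(** The class Fac M of modules generated by M, stated with arbitrary subspaces U
so that no finite sum of copies of M has to be chosen; fac_pw recovers the
surjection from such a sum. *)
Definition fac M Y := forall k (U : 'M[K]_(k, rdim Y)),
  (forall f, ishom M Y f -> (f <= U)%MS) -> row_full U.

Lemma fac_trans M X Y : fac M X -> fac X Y -> fac M Y.
Proof.
move=> MX XY k U HU; apply: XY => g hg.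
have /row_fullP[B B1] : row_full (premx g U).
  by apply: MX => f hf; rewrite premxP; apply: HU; apply: ishomM hf hg.
rewrite -[g]mul1mx -premxP -B1; exact: submxMl.
Qed.
Lemma surj_fac X Y q : ishom X Y q -> row_full q -> fac X Y.
Proof.
move=> hq fq k U HU; rewrite -sub1mx; apply: submx_trans (HU _ hq).
by rewrite sub1mx.
Qed.
Lemma fac_surj M X Y q : ishom X Y q -> row_full q -> fac M X -> fac M Y.
Proof. by move=> hq fq MX; apply: fac_trans MX _; apply: surj_fac hq fq. Qed.
Lemma fac_refl M : fac M M.
Proof. by apply: (surj_fac (@ishom1 _ _ _)); rewrite row_full_unit unitmx1. Qed.
Lemma fac_retract X M : retract X M -> fac M X.
Proof. by case=> i [p [hi hp ip]]; apply: (surj_fac hp); apply/row_fullP; exists i. Qed.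
Lemma fac_dsum M X Y : fac M X -> fac M Y -> fac M (dsum X Y).
Proof.
move=> MX MY k U HU; rewrite -sub1mx -(fst_inl_snd_inr X Y).
have full Z (g : 'M_(rdim Z, _)) : fac M Z -> ishom Z (dsum X Y) g -> (g <= U)%MS.
  move=> MZ hg; have /row_fullP[B B1] : row_full (premx g U).
    by apply: MZ => f hf; rewrite premxP; apply: HU; apply: ishomM hf hg.
  by rewrite -[g]mul1mx -premxP -B1; apply: submxMl.
apply: addmx_sub; apply: mulmx_sub; apply: full => //; [exact: inl_hom|exact: inr_hom].
Qed.
Lemma fac_pwr n M X : fac M X -> fac M (pw n X).
Proof.
move=> MX; elim: n => [|n IH] /=; last exact: fac_dsum.
by move=> k U _; rewrite -col_leq_rank.
Qed.
Lemma fac_sub M M' Y : (forall f, ishom M Y f -> exists2 f', ishom M' Y f' & (f <= f')%MS) ->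
  fac M Y -> fac M' Y.
Proof.
move=> H MY k U HU; apply: MY => f /H[f' /HU f'U ff']; exact: submx_trans f'U.
Qed.
Lemma fac_pw M Y : fac M Y -> exists n p, ishom (pw n M) Y p /\ row_full p.
Proof.
move=> MY; have [n [p [hp Hp]]] := approx M Y; exists n, p; split=> //.
by apply: MY => f /Hp[j _ <-]; apply: submxMl.
Qed.
Lemma fac_nohom M X Y : fac M X -> hom_zero M Y -> hom_zero X Y.
Proof.
move=> MX zMY f; have : row_full (kermx f).
  apply: MX => g hg; apply/sub_kermxP.
  exact: zMY (Defs.Hom (ishomM hg (homP f))).
by case/row_fullP=> B B1; rewrite -[LHS]mul1mx -B1 -mulmxA mulmx_ker mulmx0.
Qed.

(** The vanishing of Ext^1(C, Fac M) on extensions whose middle term lies in cl,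
as a lifting property: the kernel of E -> X is the image of a module G of Fac M.
In this form it passes to summands and sums in C at once. *)
Definition ext0 (cl : rmod A -> Prop) C M := forall E X G p q w,
  cl E -> ishom G E p -> ishom E X q -> row_full q -> (p :=: kermx q)%MS ->
  fac M G -> ishom C X w -> exists2 l, ishom C E l & l *m q = w.

Lemma ext0_retract (cl : rmod A -> Prop) C C' M : retract C C' -> ext0 cl C' M -> ext0 cl C M.
Proof.
case=> i [r [hi hr ir]] H E X G p q w cE hp hq fq pq MG hw.
have [l hl lq] := H _ _ _ _ _ _ cE hp hq fq pq MG (ishomM hr hw).
by exists (i *m l); [apply: ishomM|rewrite -mulmxA lq mulmxA ir mul1mx].
Qed.
Lemma ext0_dsum (cl : rmod A -> Prop) C C' M : ext0 cl C M -> ext0 cl C' M -> ext0 cl (dsum C C') M.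
Proof.
move=> H H' E X G p q w cE hp hq fq pq MG hw.
have [l hl lq] := H _ _ _ _ _ _ cE hp hq fq pq MG (ishomM (inl_hom _ _) hw).
have [l' hl' lq'] := H' _ _ _ _ _ _ cE hp hq fq pq MG (ishomM (inr_hom _ _) hw).
exists (col_mx l l'); first exact: ishom_col.
by rewrite mul_col_mx lq lq' -dsum_colE.
Qed.
Lemma ext0_fac (cl : rmod A -> Prop) C M M' : fac M M' -> ext0 cl C M -> ext0 cl C M'.
Proof.
move=> MM' H E X G p q w cE hp hq fq pq M'G hw.
exact: H cE hp hq fq pq (fac_trans MM' M'G) hw.
Qed.
Lemma ext0_proj (cl : rmod A -> Prop) P M : projective_mod P -> ext0 cl P M.
Proof.
move=> prP E X G p q w _ _ hq fq _ _ hw.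
by have [l hl lq] := projP prP hq fq hw; exists l.
Qed.
Lemma ext0_cl (cl cl' : rmod A -> Prop) C M : (forall E, cl' E -> cl E) -> ext0 cl C M -> ext0 cl' C M.
Proof. move=> s H E X G p q w /s; exact: H. Qed.

(** The lifting property follows from the splitting of extensions of C, applied
to the pullback of E -> X along C -> X. *)
Lemma ext0_section (cl : rmod A -> Prop) C M :
  (forall X Y i, ishom X Y i -> row_free i -> cl Y -> cl X) ->
  (forall X Y, cl X -> cl Y -> cl (dsum X Y)) -> cl C ->
  (forall E G p q, cl E -> ishom G E p -> ishom E C q -> row_full q ->
     (p :=: kermx q)%MS -> fac M G -> exists2 s, ishom C E s & s *m q = 1%:M) ->
  ext0 cl C M.
Proof.
move=> clS clD clC H E X G p q w cE hp hq fq pq MG hw.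
pose d : 'M_(rdim (dsum E C), rdim X) := col_mx q (- w).
have hd : ishom (dsum E C) X d by apply: ishom_col => //; apply: ishomN.
have [B [j [hj fj jE]]] := ker_ex hd.
have dE m (e : 'M_(m, rdim E)) (c : 'M_(m, rdim C)) :
    (row_mx e c : 'M_(m, rdim (dsum E C))) *m d = e *m q - c *m w.
  by rewrite /d mul_row_col mulmxN.
have jd : j *m fst_mx E C *m q = j *m snd_mx E C *m w.
  apply/eqP; rewrite -subr_eq0 -dE -dsum_rowE; apply/eqP/sub_kermxP; by rewrite jE.
have pq0 : p *m q = 0 by apply/sub_kermxP; rewrite pq.
have [|p' hp' pj] := factor_inj (ishomM hp (inl_hom E C)) hj fj.
  by rewrite jE; apply/sub_kermxP; rewrite -mulmxA inl_col.
have [||||s hs sq] := H B G p' (j *m snd_mx E C) (clS _ _ _ hj fj (clD _ _ cE clC)) hp'.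
- exact: ishomM hj (snd_hom _ _).
- have /row_fullP[e eq1] := fq.
  have : ((row_mx (w *m e) 1%:M : 'M_(_, rdim (dsum E C))) <= j)%MS.
    by rewrite jE; apply/sub_kermxP; rewrite dE -mulmxA eq1 mulmx1 mul1mx subrr.
  case/submxP=> t tj; apply/row_fullP; exists t.
  by rewrite mulmxA -tj row_snd.
- apply/eqmxP/andP; split.
    by apply/sub_kermxP; rewrite mulmxA pj -mulmxA inl_snd mulmx0.
  have Wj : kermx (j *m snd_mx E C) *m j *m snd_mx E C = 0 by rewrite -mulmxA mulmx_ker.
  have : (kermx (j *m snd_mx E C) *m (j *m fst_mx E C) <= p)%MS.
    by rewrite pq; apply/sub_kermxP; rewrite -mulmxA jd -mulmxA (mulmxA j) mulmxA mulmx_ker mul0mx.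
  case/submxP=> t tp; apply/submxP; exists t.
  apply: (row_free_canr fj); rewrite -mulmxA pj mulmxA -tp.
  by rewrite [LHS]dsum_rowE Wj /inl_mx mul_mx_row mulmx1 mulmx0 mulmxA.
- by [].
exists (s *m j *m fst_mx E C).
  by apply: ishomM (fst_hom _ _); apply: ishomM hs hj.
by rewrite -!mulmxA (mulmxA j) jd mulmxA sq mul1mx.
Qed.

End Powers.

(** * Projective covers and minimal presentations *)

Notation allmod := (fun _ => True).

Section Projectives.
Variables (K : fieldType) (A : fdalg K).
Implicit Types M N P X Y Z C E G : rmod A.

Definition regmap M (v : 'rV[K]_(rdim M)) : 'M[K]_(rdim (reg A), rdim M) :=
  lin1_mx (fun u : 'rV_(dim A) => v *m M (r2v u)).

Lemma mul_regmap M (v : 'rV[K]_(rdim M)) (u : 'rV_(dim A)) :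
  u *m regmap v = v *m M (r2v u).
Proof.
have lf : linear (fun u : 'rV_(dim A) => v *m M (r2v u)).
  by move=> k x y; rewrite linearP ract_lin mulmxDr scalemxAr.
pose fL := GRing.isLinear.Build _ _ _ _ _ lf.
pose f : {linear 'rV_(dim A) -> 'rV_(rdim M)} := HB.pack (fun u : 'rV_(dim A) => v *m M (r2v u)) fL.
exact: (mul_rV_lin1 f).
Qed.

Lemma regmap_hom M (v : 'rV[K]_(rdim M)) : ishom (reg A) M (regmap v).
Proof.
move=> a; apply/row_matrixP => i; rewrite !rowE !mulmxA [in LHS]mul_rmul_mx.
by rewrite !mul_regmap v2rK ractM mulmxA.
Qed.

Lemma regmap1 M (v : 'rV[K]_(rdim M)) : v2r (fdone A) *m regmap v = v.
Proof. by rewrite mul_regmap v2rK ract1 mulmx1. Qed.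

Lemma regmapP M (f : 'M_(rdim (reg A), rdim M)) : ishom (reg A) M f ->
  f = regmap (v2r (fdone A) *m f).
Proof.
move=> hf; apply/row_matrixP => i; rewrite !rowE mul_regmap -mulmxA -hf mulmxA.
by rewrite [v2r _ *m _]mul_rmul_mx v2rK fdmul1l r2vK.
Qed.

Lemma proj_reg : projective_mod (reg A).
Proof.
move=> M N p f fp; have hf := regmapP (homP f).
have /row_fullP[B B1] := fp.
exists (Defs.Hom (regmap_hom (v2r (fdone A) *m f *m B))) => /=.
rewrite [RHS]hf; apply/row_matrixP => i; rewrite !rowE mulmxA !mul_regmap.
by rewrite -mulmxA homP mulmxA -(mulmxA _ B) B1 mulmx1.
Qed.

Lemma proj_retract P P' : retract P P' -> projective_mod P' -> projective_mod P.
Proof.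
move=> [i [r [hi hr ir]]] prP' M N p f fp.
have [g hg gp] := projP prP' (homP p) fp (ishomM hr (homP f)).
by exists (Defs.Hom (ishomM hi hg)); rewrite /= -mulmxA gp mulmxA ir mul1mx.
Qed.

Lemma proj_dsum P P' : projective_mod P -> projective_mod P' -> projective_mod (dsum P P').
Proof.
move=> prP prP' M N p f fp.
have [g hg gp] := projP prP (homP p) fp (ishomM (inl_hom _ _) (homP f)).
have [g' hg' gp'] := projP prP' (homP p) fp (ishomM (inr_hom _ _) (homP f)).
exists (Defs.Hom (ishom_col hg hg')); by rewrite /= mul_col_mx gp gp' -dsum_colE.
Qed.

Lemma proj_dim0 P : rdim P = 0%N -> projective_mod P.
Proof. by move=> P0; apply: proj_retract proj_reg; apply: retract0. Qed.

Lemma proj_pw n P : projective_mod P -> projective_mod (pw n P).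
Proof.
by move=> prP; elim: n => [|n IH] /=; [apply: proj_dim0|apply: proj_dsum].
Qed.

Lemma fac_reg M : fac (reg A) M.
Proof.
move=> k U HU; rewrite -sub1mx; apply/row_subP => i.
by rewrite -(regmap1 (row i 1%:M)); apply: mulmx_sub; apply: HU; apply: regmap_hom.
Qed.

Lemma proj_in_add P : projective_mod P -> in_add P (reg A).
Proof.
move=> prP; have [n [p [hp fp]]] := fac_pw (@fac_reg P).
have [s hs sp] := projP prP hp fp (@ishom1 _ _ P).
by apply/in_addP; exists n, s, p.
Qed.

(** Among the projectives with a surjection to M, one of minimal dimension is a
projective cover: a proper submodule which still surjects to M gives an
endomorphism over M, and by Fitting a proper summand would do. *)
Lemma proj_cover M : exists P p, [/\ projective_mod P, ishom P M p, row_full p &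
  forall k (V : 'M[K]_(k, rdim P)), (forall a, (V *m P a <= V)%MS) ->
    row_full (V + kermx p)%MS -> row_full V].
Proof.
pose good n := `[< exists P p, [/\ projective_mod P, ishom P M p, row_full p & rdim P = n] >].
have ex : exists n, good n.
  have [n [p [hp fp]]] := fac_pw (@fac_reg M).
  exists (rdim (pw n (reg A))); apply/asboolP; exists (pw n (reg A)), p; split=> //.
  exact/proj_pw/proj_reg.
case: (ex_minnP ex) => n /asboolP[P [p [prP hp fp dP]]] minP.
exists P, p; split=> // k V stV fVk.
have [W [j [hj fj jV]]] := sub_ex stV.
have fjp : row_full (j *m p).
  rewrite -sub1mx; have /row_fullP[B B1] := fp.
  have : (B <= V + kermx p)%MS by apply: submx_full.
  case/sub_addsmxP=> -[u v] /= BE.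
  rewrite -B1 BE mulmxDl mul_kermxK addr0 -(mulmxA u) mulmx_sub //.
  by apply: submxMr; rewrite jV.
have [h hh hjp] := projP prP (ishomM hj hp) fjp hp.
have ht := ishomM hh hj; set t := h *m j in ht.
have tp : t *m p = p by rewrite /t -mulmxA.
have tkp l : t ^+ l *m p = p.
  by elim: l => [|l IH]; [rewrite mul1mx|rewrite exprSr -mulmxA tp].
have [l [X [i [r [u [hi hr ir uu tE]]]]]] := fitting ht.
have fip : row_full (i *m p).
  rewrite -sub1mx; have /row_fullP[B B1] := fp.
  by rewrite -B1 -{1}(tkp l.+1) tE -!mulmxA; do 3!apply: mulmx_sub.
have leX : (rdim P <= rdim X)%N.
  rewrite dP; apply: minP; apply/asboolP; exists X, (i *m p); split=> //.
    by apply: proj_retract prP; exists i, r.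
  exact: ishomM.
have : t ^+ l.+1 \in unitmx by rewrite tE (retract_unit ir).
rewrite exprSr -row_full_unit -!sub1mx => /submx_trans; apply.
by rewrite -[_ * t]/(_ *m (h *m j)) mulmxA; apply: mulmx_sub; rewrite jV.
Qed.

Lemma min_pres M : exists P1 P0 (f : Defs.hom P1 P0) (g : Defs.hom P0 M), min_proj_pres f g.
Proof.
have [P0 [g [pr0 hg fg sg]]] := proj_cover M.
have [N [j [hj fj jE]]] := ker_ex hg.
have [P1 [f [pr1 hf ff sf]]] := proj_cover N.
exists P1, P0, (Defs.Hom (ishomM hf hj)), (Defs.Hom hg); split=> //=.
  by apply: eqmx_trans jE; apply: eqmxMfull.
split=> V; rewrite addsmxC => fV; [apply: sg => //|apply: sf => //]; try exact: submoduleP.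
rewrite -sub1mx; rewrite -sub1mx in fV; apply: submx_trans fV _.
apply: addsmxS => //; apply/sub_kermxP/(row_free_canr fj).
by rewrite mul0mx -mulmxA mulmx_ker.
Qed.

(** The quotients of an indecomposable projective P are local: a map w which is
surjective modulo a proper submodule is surjective. Lifting P -> Y through w
yields an endomorphism of P which is not nilpotent. *)
Lemma indec_proj_local P Z Y C p k w : indecomposable P -> projective_mod P ->
  ishom P Z p -> row_full p -> ishom Z Y k -> row_full k -> (0 < rdim Y)%N ->
  ishom C Z w -> row_full (w *m k) -> row_full w.
Proof.
move=> indP prP hp fp hk fk Y0 hw fwk.
have [l hl lE] := projP prP (ishomM hw hk) fwk (ishomM hp hk).
have [h hh hE] := projP prP hp fp (ishomM hl hw).
have uh : h \in unitmx.
  apply: (@indec_fixr _ _ _ _ _ (p *m k)) => //.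
    by rewrite mulmxA hE -mulmxA lE.
  have fpk : row_full (p *m k) by apply: row_fullM.
  by apply/eqP => pk0; move: fpk; rewrite pk0 /row_full mxrank0 => /eqP Yd; rewrite -Yd in Y0.
by apply: (@row_full_mull _ _ _ _ l); rewrite -hE row_fullM // row_full_unit.
Qed.

Lemma pres_fac P1 P0 M X f : projective_mod P1 ->
  ishom P1 P0 f ->
  (forall h, ishom P1 M h -> exists2 h', ishom P0 M h' & f *m h' = h) ->
  fac M X -> forall h, ishom P1 X h -> exists2 h', ishom P0 X h' & f *m h' = h.
Proof.
move=> pr1 hf H MX h hh; have [n [p [hp fp]]] := fac_pw MX.
have [t ht tp] := projP pr1 hp fp hh.
have [t' ht' t'E] : exists2 t', ishom P0 (pw n M) t' & f *m t' = t.
  elim: n {p hp fp tp} t ht => [|n IH] t ht.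
    exists 0; first exact: ishom0.
    by apply/matrixP => a [].
  have [u hu uE] := H _ (ishomM ht (fst_hom _ _)).
  have [v hv vE] := IH _ (ishomM ht (snd_hom _ _)).
  exists (row_mx u v); first exact: ishom_row.
  by rewrite mul_mx_row uE vE -dsum_rowE.
exists (t' *m p); first exact: ishomM.
by rewrite mulmxA t'E.
Qed.

(** Extending maps from P1 to P0 is what is needed to correct a lift of P0 -> X
so that it factors through C. *)
Lemma pres_ext0 P1 P0 C M f g : projective_mod P1 -> projective_mod P0 ->
  ishom P1 P0 f -> ishom P0 C g -> row_full g -> (f :=: kermx g)%MS ->
  (forall h, ishom P1 M h -> exists2 h', ishom P0 M h' & f *m h' = h) ->
  ext0 allmod C M.
Proof.
move=> pr1 pr0 hf hg fg fE H E X G p q w _ hp hq fq pq MG hw.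
have fg0 : f *m g = 0 by apply/sub_kermxP; rewrite fE.
have pq0 : p *m q = 0 by apply/sub_kermxP; rewrite pq.
have [l0 hl0 l0E] := projP pr0 hq fq (ishomM hg hw).
have [Y [r [i [hr hi fr fi pE]]]] := im_ex hp.
have iq : (i :=: kermx q)%MS.
  by apply: eqmx_trans pq; rewrite pE; apply/eqmx_sym/eqmxMfull.
have [|t ht ti] := factor_inj (ishomM hf hl0) hi fi.
  by rewrite iq; apply/sub_kermxP; rewrite -mulmxA l0E mulmxA fg0 mul0mx.
have [t' ht' t'E] := projP pr1 hr fr ht.
have [u hu uE] := pres_fac pr1 hf H MG ht'.
have hd : ishom P0 E (l0 - u *m p) by apply: ishomB => //; apply: ishomM.
have [|l hl lE] := factor_surj hd hg fg.
  rewrite -fE; apply/sub_kermxP; rewrite mulmxBr mulmxA uE -ti pE mulmxA t'E.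
  by rewrite subrr.
exists l => //; apply: (row_full_canl fg).
by rewrite mulmxA lE mulmxBl l0E -mulmxA pq0 mulmx0 subr0.
Qed.

(** For a minimal presentation the converse holds as well. Let N be the kernel of
f. A map h from P1 to X becomes, modulo h N, a map on the image of f; the
extension of C which it pushes out splits by hypothesis, so h agrees up to h N
with a map extended from P0. The difference t has image inside t N, hence N and
the kernel of t span P1, and N is superfluous. *)
Lemma min_pres_factor P1 P0 C M (f : Defs.hom P1 P0) (g : Defs.hom P0 C) :
  min_proj_pres f g -> ext0 allmod C M -> forall X, fac M X ->
  forall h, ishom P1 X h -> exists2 h', ishom P0 X h' & f *m h' = h.
Proof.
move=> [pr1 pr0 fg fE [_ sf]] H X MX h hh.
have fE' : (f :=: kermx g)%MS by [].
have [O [pi [io [hpi hio fpi fio fpio]]]] := im_ex (homP f).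
have [N [k [hk fk kE]]] := ker_ex (homP f).
have [Y [y [hy fy yE]]] := coker_ex (ishomM hk hh).
have kpi : (kermx pi :=: kermx f)%MS.
  apply/eqmxP/andP; split; apply/sub_kermxP; first by rewrite fpio mulmxA mulmx_ker mul0mx.
  by apply: (row_free_canr fio); rewrite mul0mx -mulmxA -fpio mulmx_ker.
have [|hb hhb hbE] := factor_surj (ishomM hh hy) hpi fpi.
  rewrite kpi -kE; apply/sub_kermxP; rewrite mulmxA; apply/sub_kermxP; by rewrite yE.
pose d : 'M_(rdim O, rdim (dsum P0 Y)) := row_mx io (- hb).
have hd : ishom O (dsum P0 Y) d by apply: ishom_row => //; apply: ishomN.
have [E [e [he fe eE]]] := coker_ex hd.
have iog : io *m g = 0.
  apply: (row_full_canl fpi); rewrite mulmxA -fpio mulmx0; apply/sub_kermxP.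
  by rewrite fE'.
pose g0 : 'M_(rdim (dsum P0 Y), rdim C) := col_mx g 0.
have hg0 : ishom (dsum P0 Y) C g0 by apply: ishom_col; [apply: homP|apply: ishom0].
have [|q hq qE] := factor_surj hg0 he fe.
  by rewrite eE; apply/sub_kermxP; rewrite /d /g0 mul_row_col iog mulmx0 addr0.
have e0q : inl_mx P0 Y *m e *m q = g by rewrite -mulmxA qE inl_col.
have e1q : inr_mx P0 Y *m e *m q = 0 by rewrite -mulmxA qE inr_col.
have dinl : io *m (inl_mx P0 Y *m e) = hb *m (inr_mx P0 Y *m e).
  apply/eqP; rewrite -subr_eq0 !mulmxA -mulmxBl.
  apply/eqP/sub_kermxP; rewrite eE /inl_mx /inr_mx !mul_mx_row !mulmx1 !mulmx0.
  by rewrite opp_row_mx oppr0 add_row_mx add0r addr0.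
have fq : row_full q.
  rewrite -sub1mx (submx_trans _ (_ : (g <= _)%MS)) ?sub1mx //.
  by rewrite -e0q submxMl.
have keq : (inr_mx P0 Y *m e :=: kermx q)%MS.
  apply/eqmxP/andP; split; first exact/sub_kermxP.
  have /row_fullP[B B1] := fe.
  set W := kermx q; have WE : W = W *m B *m e by rewrite -mulmxA B1 mulmx1.
  set V := W *m B in WE.
  have VE := dsum_rowE V.
  have : V *m g0 = 0 by rewrite -qE mulmxA -WE mulmx_ker.
  rewrite {1}VE mul_row_col mulmx0 addr0 => /sub_kermxP; rewrite -fE' fpio => /submxP[c cE].
  rewrite WE VE -[V *m snd_mx P0 Y]addr0 -[V *m fst_mx P0 Y]add0r -add_row_mx mulmxDl.
  apply: addmx_sub.
    rewrite (_ : row_mx 0 _ = V *m snd_mx P0 Y *m inr_mx P0 Y); last first.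
      by rewrite /inr_mx mul_mx_row mulmx0 mulmx1.
    by rewrite -mulmxA submxMl.
  rewrite (_ : row_mx _ 0 = V *m fst_mx P0 Y *m inl_mx P0 Y); last first.
    by rewrite /inl_mx mul_mx_row mulmx0 mulmx1.
  by rewrite cE -!mulmxA dinl; do 2!apply: mulmx_sub; apply: submxMl.
have MY : fac M Y by apply: fac_surj hy fy MX.
have [s hs sq] := H E C Y _ q 1%:M I (ishomM (inr_hom _ _) he) hq fq keq MY (@ishom1 _ _ _).
(* The push-out of a monomorphism is a monomorphism. *)
have e1inj m (W : 'M_(m, rdim Y)) : W *m (inr_mx P0 Y *m e) = 0 -> W = 0.
  rewrite mulmxA => /sub_kermxP; rewrite eE => /submxP[c].
  rewrite /inr_mx /d !mul_mx_row mulmx0 mulmx1 => /eq_row_mx[c0 ->].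
  have -> : c = 0 by apply: (row_free_canr fio); rewrite mul0mx.
  by rewrite mul0mx.
have ht0 : ishom P0 E (inl_mx P0 Y *m e - g *m s).
  by apply: ishomB; [apply: ishomM (inl_hom _ _) he|apply: ishomM (homP g) hs].
have fi1 : row_free (inr_mx P0 Y *m e).
  by rewrite -kermx_eq0; apply/eqP/e1inj; rewrite mulmx_ker.
have [|l hl lE] := factor_inj ht0 (ishomM (inr_hom P0 Y) he) fi1.
  by rewrite keq; apply/sub_kermxP; rewrite mulmxBl -[g *m s *m q]mulmxA sq mulmx1 e0q subrr.
have iol : io *m l = hb.
  apply/eqP; rewrite -subr_eq0; apply/eqP/e1inj.
  by rewrite mulmxBl -[X in X - _]mulmxA lE mulmxBr [io *m (g *m s)]mulmxA iog mul0mx subr0 dinl subrr.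
have [h' hh' h'E] := projP pr0 hy fy hl.
exists h' => //; apply/eqP; rewrite eq_sym -subr_eq0; apply/eqP.
set t := h - f *m h'.
have ht : ishom P1 X t by apply: ishomB => //; apply: ishomM (homP f) hh'.
have ty : t *m y = 0.
  by rewrite /t mulmxBl -hbE -[f *m h' *m y]mulmxA h'E fpio -mulmxA iol subrr.
have kt : k *m t = k *m h.
  have kf : k *m f = 0 by apply/sub_kermxP; rewrite kE.
  by rewrite /t mulmxBr mulmxA kf mul0mx subr0.
have : row_full (kermx t).
  apply: (sf (Submodule (ker_stable (Defs.Hom ht)))) => /=.
  rewrite -sub1mx; move/sub_kermxP: ty; rewrite yE -kt => /submxP[c cE].
  rewrite -[X in (X <= _)%MS](subrK (c *m k)) addrC; apply: addmx_sub_adds.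
    by apply: mulmx_sub; rewrite kE.
  by apply/sub_kermxP; rewrite mulmxBl mul1mx -mulmxA -cE subrr.
by case/row_fullP=> B B1; rewrite -[LHS]mul1mx -B1 -mulmxA mulmx_ker mulmx0.
Qed.

End Projectives.

(** * Maps to the Auslander-Reiten translate *)

Section TauPairing.
Variables (K : fieldType) (A : fdalg K).
Implicit Types M N P X Y : rmod A.

Lemma regmapD M (v w : 'rV[K]_(rdim M)) : regmap (v + w) = regmap v + regmap w.
Proof. by apply/row_matrixP => i; rewrite !rowE mulmxDr !mul_regmap mulmxDl. Qed.
Lemma regmapZ M k (v : 'rV[K]_(rdim M)) : regmap (k *: v) = k *: regmap v.
Proof. by apply/row_matrixP => i; rewrite !rowE -scalemxAr !mul_regmap scalemxAl. Qed.
Lemma regmap_comp M N (v : 'rV[K]_(rdim M)) f : ishom M N f ->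
  regmap v *m f = regmap (v *m f).
Proof.
move=> hf; apply/row_matrixP => i; rewrite !rowE mulmxA !mul_regmap.
by rewrite -!mulmxA hf.
Qed.
Lemma lmul_regmap M (v : 'rV[K]_(rdim M)) a :
  lmul_mx a *m regmap v = regmap (v *m M a).
Proof.
apply/row_matrixP => i; rewrite !rowE mulmxA mul_lmul_mx !mul_regmap v2rK.
by rewrite ractM mulmxA.
Qed.

(** Dual bases are the only way in which the projectivity of P1 and P0 enters the
comparison with the translate. *)
Lemma dual_basis P : projective_mod P ->
  exists s : seq ('rV[K]_(rdim P) * 'M[K]_(rdim P, rdim (reg A))),
    (forall y, y \in s -> ishom P (reg A) y.2) /\
    \sum_(y <- s) y.2 *m regmap y.1 = 1%:M.
Proof.
move=> /proj_in_add/in_addP[n [i [r [hi hr <-]]]].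
elim: n i r hi hr => [|n IH] i r hi hr.
  exists [::]; split=> //; rewrite big_nil.
  by apply/matrixP => a b; rewrite !mxE big_ord0.
have [s [hs sE]] := IH _ _ (ishomM hi (snd_hom _ _)) (ishomM (inr_hom _ _) hr).
have h1 : ishom (reg A) P (inl_mx _ _ *m r) by apply: ishomM (inl_hom _ _) hr.
exists ((v2r (fdone A) *m (inl_mx (reg A) (pw n (reg A)) *m r),
         i *m fst_mx (reg A) (pw n (reg A))) :: s); split=> [y|].
  rewrite inE => /orP[/eqP -> /=|/hs //]; exact: ishomM hi (fst_hom _ _).
rewrite big_cons sE /= -(regmapP h1) !mulmxA -mulmxDl -!(mulmxA i) -mulmxDr.
by rewrite fst_inl_snd_inr mulmx1.
Qed.

Lemma dual_basis_lmul P s (g : 'M_(rdim P, rdim (reg A))) : ishom P (reg A) g ->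
  \sum_(y <- s) y.2 *m regmap y.1 = 1%:M ->
  \sum_(y <- s) y.2 *m lmul_mx (r2v (y.1 *m g : 'rV_(dim A))) = g.
Proof.
move=> hg e1; rewrite -[RHS]mul1mx -e1 mulmx_suml; apply: eq_bigr => y _.
rewrite -mulmxA (regmap_comp _ hg); congr (_ *m _).
apply/row_matrixP => i; rewrite !rowE mul_lmul_mx.
apply: etrans (esym (mul_regmap (M := reg A) _ _)); exact/esym/mul_rmul_mx.
Qed.

Section Presentation.
Variables (P1 P0 : rmod A) (f : Defs.hom P1 P0).
Hypotheses (pr1 : projective_mod P1) (pr0 : projective_mod P0).

Let C := coker (star_hom f).

(** The class in the transpose Coker(P0^* -> P1^* ) of a homomorphism from P1 to
the algebra. *)
Definition trcls (phi : 'M[K]_(rdim P1, dim A)) : 'rV[K]_(rdim C) :=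
  in_factmod (im (star_hom f)) (in_submod (homs P1) (mxvec phi)).

Lemma trcls_lin : linear trcls.
Proof. by move=> k x y; rewrite /trcls !linearP. Qed.
Lemma trcls_sum (I : Type) (s : seq I) (F : I -> 'M_(_, _)) :
  trcls (\sum_(i <- s) F i) = \sum_(i <- s) trcls (F i).
Proof. by rewrite /trcls !linear_sum. Qed.

Lemma in_homsK phi : ishom P1 (reg A) phi ->
  val_submod (in_submod (homs P1) (mxvec phi)) = mxvec phi.
Proof. by move=> /hom_mxsP hphi; rewrite in_submodK. Qed.

Lemma trcls_act phi (a : A) : ishom P1 (reg A) phi ->
  trcls phi *m C a = trcls (phi *m @lmul_mx K A a).
Proof.
move=> hphi; rewrite /trcls (factmod_in (im (star_hom f))); congr in_factmod.
apply: (can_inj val_submodK); rewrite (submod_val (U := homs P1)) in_homsK //.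
rewrite [LHS]lin_actE in_homsK // => b.
by rewrite mulmxA hphi -!mulmxA lmul_rmul_mxC.
Qed.

Lemma trcls_eq0 phi : ishom P1 (reg A) phi ->
  (trcls phi = 0 <-> exists2 psi, ishom P0 (reg A) psi & phi = f *m psi).
Proof.
move=> hphi; have -> : trcls phi = 0 <-> (in_submod (homs P1) (mxvec phi) <= star_mx f)%MS.
  by rewrite -[X in (_ <= X)%MS]/(hom_mx (star_hom f)) -(genmxE (star_hom f)) -in_factmod_eq0; split=> /eqP.
split=> [/submxP[t tE]|[psi hpsi phiE]].
  exists (vec_mx (val_submod t)).
    by apply/hom_mxsP; rewrite vec_mxK; apply: val_submodP.
  apply: (can_inj mxvecK); rewrite -(in_homsK hphi) tE val_star_mx.
  by rewrite -{1}[val_submod t]vec_mxK mul_vec_lin.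
apply/submxP; exists (in_submod (homs P0) (mxvec psi)).
apply: (can_inj val_submodK); rewrite val_star_mx in_homsK // phiE.
by rewrite in_submodK ?mul_vec_lin //; apply/hom_mxsP.
Qed.

Definition trrep (c : 'rV[K]_(rdim C)) : 'M[K]_(rdim P1, dim A) :=
  vec_mx (val_submod (val_factmod c)).
Lemma trrep_hom c : ishom P1 (reg A) (trrep c).
Proof. by apply/hom_mxsP; rewrite vec_mxK; apply: val_submodP. Qed.
Lemma trrepK c : trcls (trrep c) = c.
Proof. by rewrite /trcls /trrep vec_mxK val_submodK val_factmodK. Qed.
Lemma trrep_lin : linear trrep.
Proof.
by move=> k x y; rewrite /trrep ![val_factmod (_ + _)]linearP ![val_submod (_ + _)]linearP linearP.
Qed.

(** A map H from X to the dual of the transpose is a balanced pairing of X with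
P1^* which vanishes on maps that extend to P0. By the dual basis of P1 it comes
from a linear form lam on Hom(P1, X), and lam vanishes on restrictions of maps
from P0. *)
Lemma tau_nohom X : (forall h, ishom P1 X h -> exists2 h', ishom P0 X h' & f *m h' = h) ->
  hom_zero X (dual C).
Proof.
move=> fac1 H; pose b (x : 'rV_(rdim X)) phi := x *m H *m (trcls phi)^T.
have bal x a phi : ishom P1 (reg A) phi -> b (x *m X a) phi = b x (phi *m lmul_mx a).
  move=> hphi; rewrite /b -(mulmxA x) (homP H) -trcls_act // (trmx_mul (trcls phi)).
  by rewrite (mulmxA x H) -[LHS]mulmxA.
have [s1 [hs1 s1E]] := dual_basis pr1; have [s0 [hs0 s0E]] := dual_basis pr0.
have b_suml I (s : seq I) F phi : b (\sum_(i <- s) F i) phi = \sum_(i <- s) b (F i) phi.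
  by rewrite /b !mulmx_suml.
have b_sumr I (s : seq I) x F : b x (\sum_(i <- s) F i) = \sum_(i <- s) b x (F i).
  by rewrite /b trcls_sum linear_sum mulmx_sumr.
pose lam h := \sum_(y <- s1) b (y.1 *m h) y.2.
have lam0 h' : ishom P0 X h' -> lam (f *m h') = 0.
  move=> hh'; rewrite /lam.
  have step y : y \in s1 -> b (y.1 *m (f *m h')) y.2 =
      \sum_(z <- s0) b (z.1 *m h') (y.2 *m lmul_mx (r2v (y.1 *m f *m z.2 : 'rV_(dim A)))).
    move=> sy; rewrite mulmxA -{1}[y.1 *m f]mulmx1 -s0E mulmx_sumr mulmx_suml b_suml.
    apply: eq_bigr => z _; rewrite -bal; last exact: hs1.
    congr (b _ _); rewrite -[RHS]mulmxA -hh' [RHS]mulmxA; congr (_ *m _).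
    rewrite mulmxA; exact: (mul_regmap (M := P0)).
  rewrite big_seq (eq_bigr _ step) -big_seq exchange_big /= big1_seq // => z /andP[_ sz].
  rewrite -b_sumr.
  have -> : \sum_(y <- s1) y.2 *m lmul_mx (r2v (y.1 *m f *m z.2 : 'rV_(dim A))) = f *m z.2.
    rewrite -[RHS](dual_basis_lmul (ishomM (homP f) (hs0 _ sz)) s1E).
    by apply: eq_bigr => y _; rewrite (mulmxA y.1).
  rewrite /b; have -> : trcls (f *m z.2) = 0.
    apply/trcls_eq0; first exact: ishomM (homP f) (hs0 _ sz).
    by exists z.2 => //; apply: hs0.
  by rewrite trmx0 mulmx0.
have lamE x phi : ishom P1 (reg A) phi -> lam (phi *m regmap x) = b x phi.
  move=> hphi; rewrite -[in RHS](dual_basis_lmul hphi s1E) b_sumr /lam.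
  rewrite big_seq [RHS]big_seq; apply: eq_bigr => y sy.
  rewrite (mulmxA y.1) -bal; last exact: hs1.
  by congr (b _ _); apply: (mul_regmap (M := X)).
apply/matrixP => i j; rewrite [RHS]mxE.
have hphi := trrep_hom (delta_mx 0 j).
have [h' hh' hE] := fac1 _ (ishomM hphi (regmap_hom (M := X) (delta_mx 0 i))).
have : b (delta_mx 0 i) (trrep (delta_mx 0 j)) = 0 by rewrite -lamE // -hE lam0.
rewrite /b trrepK trmx_delta -rowE -colE => /matrixP/(_ 0 0).
by rewrite !mxE.
Qed.

Lemma hom_basis M N : exists B : 'M[K]_(\dim (homsp M N), rdim M * rdim N),
  forall h, ishom M N h <-> (mxvec h <= B)%MS.
Proof.
pose B : 'M[K]_(\dim (homsp M N), _) := \matrix_i mxvec (vbasis (homsp M N))`_i.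
exists B => h; split.
  move=> /mem_homsp/coord_vbasis ->; rewrite linear_sum; apply: summx_sub => i _.
  by rewrite linearZ scalemx_sub //; have := row_sub i B; rewrite rowK.
case/submxP=> t tE; rewrite -[h]mxvecK tE mulmx_sum_row linear_sum.
elim/big_ind: _ => [|x y|i _]; [exact: ishom0|exact: ishomD|].
rewrite linearZ /= /B rowK mxvecK; apply: ishomZ; apply/mem_homsp/vbasis_mem/mem_nth.
by rewrite size_tuple.
Qed.

(** Conversely, a linear form on Hom(P1, X) which vanishes on the maps that
extend to P0, but not at h0, defines a nonzero balanced pairing. *)
Lemma nohom_tau X : hom_zero X (dual C) ->
  forall h, ishom P1 X h -> exists2 h', ishom P0 X h' & f *m h' = h.
Proof.
move=> zero h0 hh0; have [B HB] := hom_basis P0 X.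
pose U := B *m lin_mulmx (f : 'M_(_, _)) : 'M_(_, rdim P1 * rdim X).
have [/submxP[t tE]|] := boolP (mxvec h0 <= U)%MS.
  exists (vec_mx (t *m B)); first by apply/HB; rewrite vec_mxK submxMl.
  apply: (can_inj mxvecK); rewrite tE /U mulmxA -[t *m B in RHS]vec_mxK.
  by rewrite mul_vec_lin.
rewrite submxE => /rV0Pn[k0 nz]; case/negP: nz.
pose lam (h : 'M_(rdim P1, rdim X)) : 'M[K]_1 := mxvec h *m col k0 (cokermx U).
have lamD x y : lam (x + y) = lam x + lam y by rewrite /lam linearD mulmxDl.
have lamZ k x : lam (k *: x) = k *: lam x by rewrite /lam linearZ -scalemxAl.
have lam_sum I (s : seq I) F : lam (\sum_(i <- s) F i) = \sum_(i <- s) lam (F i).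
  by rewrite /lam linear_sum mulmx_suml.
have lam0 h' : ishom P0 X h' -> lam (f *m h') = 0.
  move=> hh'; have : (mxvec (f *m h') <= U)%MS.
    by move/HB: hh' => /submxP[t tE]; rewrite -[mxvec _]mul_vec_lin tE -mulmxA submxMl.
  by rewrite submxE => /eqP e; rewrite /lam colE mulmxA e mul0mx.
have lam_tr phi psi x : ishom P1 (reg A) phi -> ishom P1 (reg A) psi ->
    trcls phi = trcls psi -> lam (phi *m regmap (M := X) x) = lam (psi *m regmap x).
  move=> hphi hpsi e; have hd := ishomB hphi hpsi.
  have [g hg gE] : exists2 g, ishom P0 (reg A) g & phi - psi = f *m g.
    by apply/trcls_eq0 => //; rewrite -scaleN1r addrC trcls_lin e scaleN1r addNr.
  have -> : phi *m regmap x = (phi - psi) *m regmap x + psi *m regmap x.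
    by rewrite -mulmxDl subrK.
  by rewrite lamD gE -mulmxA lam0 ?add0r //; apply: ishomM hg (regmap_hom _).
pose H : 'M[K]_(rdim X, rdim C) :=
  \matrix_(i, j) lam (trrep (delta_mx 0 j) *m regmap (M := X) (delta_mx 0 i)) 0 0.
have trrepD x y : trrep (x + y) = trrep x + trrep y.
  by rewrite -[x]scale1r trrep_lin !scale1r.
have trrep0 : trrep 0 = 0.
  by apply: (addrI (trrep 0)); rewrite -trrepD !addr0.
have trrepZ k x : trrep (k *: x) = k *: trrep x.
  by rewrite -[k *: x]addr0 trrep_lin trrep0 addr0.
have regmap0 : regmap (M := X) 0 = 0.
  by apply: (addrI (regmap 0)); rewrite -regmapD !addr0.
have HE x c : x *m H *m c^T = lam (trrep c *m regmap x).
  rewrite [in RHS](row_sum_delta c) (big_morph _ trrepD trrep0) mulmx_suml lam_sum.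
  rewrite [in RHS](row_sum_delta x).
  apply/matrixP => a b; rewrite !ord1 {a b} mxE summxE.
  apply: eq_bigr => j _; rewrite trrepZ -scalemxAl lamZ [RHS]mxE [c^T _ _]mxE mulrC; congr (_ * _).
  rewrite (big_morph _ (@regmapD X) regmap0) mulmx_sumr lam_sum summxE mxE.
  by apply: eq_bigr => i _; rewrite regmapZ -scalemxAr lamZ [RHS]mxE [H i j]mxE.
have hH : ishom X (dual C) H.
  have ent p q (Z : 'M[K]_(p, q)) i j :
      Z i j = (delta_mx 0 i *m Z *m (delta_mx 0 j)^T : 'M_1) 0 0.
    by rewrite trmx_delta -rowE -colE !mxE.
  move=> a; apply/matrixP => i j; rewrite [LHS]ent [RHS]ent.
  rewrite (mulmxA (delta_mx 0 i)) HE.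
  pose di : 'rV[K]_(rdim X) := delta_mx 0 i; pose dj : 'rV[K]_(rdim C) := delta_mx 0 j.
  have -> : di *m (H *m dual C a) *m dj^T = di *m H *m (dj *m C a)^T.
    by rewrite [in RHS]trmx_mul (mulmxA _ H) -[LHS]mulmxA.
  rewrite HE -lmul_regmap mulmxA; congr (fun_of_matrix _ 0 0).
  apply: lam_tr; [|exact: trrep_hom|].
    move=> b; rewrite mulmxA trrep_hom -!mulmxA.
    by congr (_ *m _); apply/esym/lmul_rmul_mxC.
  by rewrite -trcls_act ?trrepK //; apply: trrep_hom.
have H0 : H = 0 by apply: (zero (Defs.Hom hH)).
have [s1 [hs1 s1E]] := dual_basis pr1.
have : lam h0 = 0.
  rewrite -[h0]mul1mx -s1E mulmx_suml lam_sum big1_seq // => y /andP[_ sy].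
  rewrite -mulmxA (regmap_comp _ hh0).
  rewrite (lam_tr _ (trrep (trcls y.2))) ?trrepK //; [|exact: hs1|exact: trrep_hom].
  by rewrite -HE H0 mulmx0 mul0mx.
rewrite /lam colE mulmxA -colE => /matrixP/(_ 0 0).
by rewrite [col _ _ _ _]mxE [RHS]mxE => ->.
Qed.

End Presentation.

Lemma hom_zeroP X M : hom_zero X M <-> forall f, ishom X M f -> f = 0.
Proof. by split=> [z f hf|z f]; [apply: (z (Defs.Hom hf))|apply/z/homP]. Qed.

Lemma hom_zero_iso X M N : iso M N -> hom_zero X M -> hom_zero X N.
Proof.
case/isoP=> i [j [hi hj _ ji]] /hom_zeroP z; apply/hom_zeroP => f hf.
by rewrite -[f]mulmx1 -ji mulmxA (z _ (ishomM hf hj)) mul0mx.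
Qed.

Lemma hom_zero_isol X Y M : iso X Y -> hom_zero X M -> hom_zero Y M.
Proof.
case/isoP=> [a [b [ha hb ab ba]]] /hom_zeroP z; apply/hom_zeroP => f hf.
by rewrite -[f]mul1mx -ba -mulmxA (z _ (ishomM ha hf)) mulmx0.
Qed.

Lemma tau_rigidP M : tau_rigid M <-> ext0 allmod M M.
Proof.
have [P1 [P0 [f [g [mp it]]]]] : is_tau M (tau M).
  apply: (@xgetPex _ _ [set T | is_tau M T]); have [P1 [P0 [f [g mp]]]] := min_pres M.
  exists (dual (coker (star_hom f))), P1, P0, f, g; split=> //; exact: iso_refl.
have [pr1 pr0 fg fE _] := mp; split=> [z|e].
  apply: (pres_ext0 pr1 pr0 (homP f) (homP g) fg fE); apply: nohom_tau => //.
  exact: hom_zero_iso it z.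
apply: hom_zero_iso (iso_sym it) _; apply: tau_nohom => //.
by apply: (min_pres_factor mp e); apply: fac_refl.
Qed.

End TauPairing.

(** * Dimensions of spaces of homomorphisms *)

Notation hdim M N := (\dim (homsp M N)).

Section HomDimensions.
Variables (K : fieldType) (A : fdalg K).
Implicit Types M N P X Y Z C E G U V W : rmod A.

Lemma hdim_pres P1 P0 C X f p : ishom P1 P0 f -> ishom P0 C p -> row_full p ->
  (f :=: kermx p)%MS ->
  (forall h, ishom P1 X h -> exists2 h', ishom P0 X h' & f *m h' = h) ->
  (hdim C X + hdim P1 X = hdim P0 X)%N.
Proof.
move=> hf hp fp fE H.
pose F : 'Hom('M[K]_(rdim P0, rdim X), 'M[K]_(rdim P1, rdim X)) := linfun (mulmx f).
pose G : 'Hom('M[K]_(rdim C, rdim X), 'M[K]_(rdim P0, rdim X)) := linfun (mulmx p).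
rewrite -(limg_ker_dim F (homsp P0 X)); congr (_ + _)%N; last first.
  congr (\dim _); apply/esym/eqP; rewrite eqEsubv; apply/andP; split; apply/subvP => h.
    by case/memv_imgP=> h' /mem_homsp hh' ->; rewrite lfunE; apply/mem_homsp/ishomM.
  move/mem_homsp/H=> [h' /mem_homsp hh' <-].
  by rewrite -[f *m h'](lfunE (mulmx f)) memv_img.
have <- : \dim (G @: homsp C X) = hdim C X.
  apply: limg_dim_eq; apply/eqP; rewrite -subv0; apply/subvP => h.
  rewrite memv_cap memv_ker lfunE memv0 => /andP[_ /eqP ph0]; apply/eqP.
  by apply: (row_full_canl fp); rewrite mulmx0.
have pE : f *m p = 0 by apply/sub_kermxP; rewrite fE.
congr (\dim _); apply/eqP; rewrite eqEsubv; apply/andP; split; apply/subvP => h.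
  case/memv_imgP=> h' /mem_homsp hh' ->; rewrite memv_cap memv_ker !lfunE /=.
  rewrite mulmxA pE mul0mx eqxx andbT; apply/mem_homsp/ishomM => //.
rewrite memv_cap memv_ker lfunE => /andP[/mem_homsp hh /eqP fh].
have [|g hg <-] := factor_surj hh hp fp.
  by rewrite -fE; apply/sub_kermxP.
by rewrite -[p *m g](lfunE (mulmx p)) memv_img //; apply/mem_homsp.
Qed.

Lemma hdim_dsum U V X : hdim (dsum U V) X = (hdim U X + hdim V X)%N.
Proof.
rewrite addnC; apply/esym/(hdim_pres (inl_hom U V) (snd_hom U V)).
- by apply/row_fullP; exists (inr_mx U V); apply: inr_snd.
- apply/eqmxP/andP; split; first by apply/sub_kermxP; apply: inl_snd.
  have e : kermx (snd_mx U V) *m snd_mx U V = 0 by apply: mulmx_ker.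
  rewrite [X in (X <= _)%MS]dsum_rowE e; apply/submxP.
  exists (kermx (snd_mx U V) *m fst_mx U V).
  by rewrite /inl_mx mul_mx_row mulmx1 mulmx0.
- move=> h hh; exists (col_mx h 0); first by apply: ishom_col => //; apply: ishom0.
  exact: inl_col.
Qed.

Lemma hdim_iso U V X : iso U V -> hdim U X = hdim V X.
Proof.
case/isoP=> f [g [hf hg fg gf]].
have ff : row_full f by apply/row_fullP; exists g.
rewrite -(hdim_pres (P1 := rmod0 A) (P0 := U) (f := 0) _ hf ff).
- suff -> : hdim (rmod0 A) X = 0%N by rewrite addn0.
  apply/eqP; rewrite dimv_eq0 -subv0; apply/subvP => h _; rewrite memv0.
  by apply/eqP/matrixP => -[].
- exact: ishom0.
- apply/eqmxP; rewrite sub0mx /=; apply/row_subP => i.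
  rewrite -[kermx f]mulmx1 -fg mulmxA mulmx_ker mul0mx row0; exact: sub0mx.
- by move=> h hh; exists 0; [apply: ishom0|apply/matrixP => -[]].
Qed.

Lemma hdim_pw n U X : hdim (pw n U) X = (n * hdim U X)%N.
Proof.
elim: n => [|n IH] /=; last by rewrite hdim_dsum IH mulSn.
apply/eqP; rewrite dimv_eq0 -subv0; apply/subvP => h _; rewrite memv0.
by apply/eqP/matrixP => -[].
Qed.

Lemma hdim_bigdsum (s : seq (rmod A)) X :
  hdim (bigdsum s) X = (\sum_(Y <- s) hdim Y X)%N.
Proof.
elim: s => [|Y s IH]; last by rewrite big_cons -IH -hdim_dsum.
rewrite big_nil; exact: (hdim_pw 0 (rmod0 A)).
Qed.

Lemma hdim_nohom U X : hom_zero U X -> hdim U X = 0%N.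
Proof.
move/hom_zeroP=> z; apply/eqP; rewrite dimv_eq0 -subv0; apply/subvP => h.
by move/mem_homsp/z=> ->; rewrite mem0v.
Qed.

Lemma dim_mulmxr l m n (i : 'M[K]_(m, n)) (H : {vspace 'M[K]_(l, m)}) :
  row_free i -> \dim (linfun (mulmxr i : 'M_(l, m) -> 'M_(l, n)) @: H) = \dim H.
Proof.
move=> fi; apply: limg_dim_eq; apply/eqP; rewrite -subv0; apply/subvP => h.
rewrite memv_cap memv_ker lfunE memv0 => /andP[_ /eqP ih0]; apply/eqP.
by apply: (row_free_canr fi); rewrite mul0mx.
Qed.

Lemma hdim_ker W Z G V i p : ishom Z G i -> row_free i -> ishom G V p ->
  (i :=: kermx p)%MS ->
  (hdim W Z + \dim (linfun (mulmxr p : 'M_(rdim W, _) -> 'M_(rdim W, rdim V)) @: homsp W G) = hdim W G)%N.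
Proof.
move=> hi fi hp iE; set F := linfun _.
rewrite -(limg_ker_dim F (homsp W G)); congr (_ + _)%N.
pose I := linfun (mulmxr i : 'M_(rdim W, _) -> 'M_(rdim W, rdim G)).
have <- : \dim (I @: homsp W Z) = hdim W Z := dim_mulmxr _ fi.
have ip : i *m p = 0 by apply/sub_kermxP; rewrite iE.
congr (\dim _); apply/eqP; rewrite eqEsubv; apply/andP; split; apply/subvP => h.
  case/memv_imgP=> h' /mem_homsp hh' ->; rewrite memv_cap memv_ker !lfunE /=.
  rewrite -mulmxA ip mulmx0 eqxx andbT; apply/mem_homsp/ishomM => //.
rewrite memv_cap memv_ker lfunE => /andP[/mem_homsp hh /eqP ph].
have [|g hg <-] := factor_inj hh hi fi.
  by rewrite iE; apply/sub_kermxP.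
by rewrite -[g *m i](lfunE (mulmxr i)) memv_img //; apply/mem_homsp.
Qed.

Lemma hdim_inj W Z G i : ishom Z G i -> row_free i ->
  (hdim W Z = hdim W G <->
   forall f, ishom W G f -> exists2 t, ishom W Z t & t *m i = f).
Proof.
move=> hi fi; pose I := linfun (mulmxr i : 'M_(rdim W, _) -> 'M_(rdim W, rdim G)).
have dI : \dim (I @: homsp W Z) = hdim W Z := dim_mulmxr _ fi.
have sI : (I @: homsp W Z <= homsp W G)%VS.
  apply/subvP => h /memv_imgP[h' /mem_homsp hh' ->]; rewrite lfunE.
  exact/mem_homsp/ishomM.
rewrite -dI; split=> [e f /mem_homsp hf|H].
  have /eqP eI : (I @: homsp W Z == homsp W G)%VS by rewrite eqEdim sI e leqnn.
  by move: hf; rewrite -eI => /memv_imgP[t /mem_homsp ht ->]; exists t; rewrite ?lfunE.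
apply/eqP; rewrite eqn_leq dimvS //=; apply/dimvS/subvP => f /mem_homsp/H[t ht <-].
by rewrite -[t *m i](lfunE (mulmxr i)) memv_img //; apply/mem_homsp.
Qed.

(** The trace V0 of U in V lies in Fac M and receives all maps from U to V, so by
the hypothesis it also receives all endomorphisms of V. *)
Lemma hdim_eq_fac M U V : fac M U ->
  (forall X, fac M X -> hdim U X = hdim V X) -> fac M V -> fac U V.
Proof.
move=> MU H MV; have [n [p [hp Hp]]] := approx U V.
have [V0 [q [i [hq hi fq fi pE]]]] := im_ex hp.
have UV0 : fac U V0 by apply: fac_surj hq fq _; apply/fac_pwr/fac_refl.
have MV0 := fac_trans MU UV0.
have eU : hdim U V0 = hdim U V.
  apply/(hdim_inj U hi fi) => f /Hp[j hj <-]; exists (j *m q); first exact: ishomM.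
  by rewrite -mulmxA -pE.
have eV : hdim V V0 = hdim V V by rewrite -H // eU H.
have [t ht ti] := (hdim_inj V hi fi).1 eV _ (@ishom1 _ _ V).
apply: fac_trans UV0 _; apply: surj_fac hi _; apply/row_fullP; by exists t.
Qed.

(** Let Z be the kernel of a right approximation U^n -> V. As U and V generate
each other, maps from either of them to Z land in the trace of U in Z, which is
in Fac M, whence dim Hom(U, Z) = dim Hom(V, Z). Comparing the exact sequences
Hom(-, Z) -> Hom(-, U^n) -> Hom(-, V) for U and V, the second one ends in a
surjection, so the identity of V lifts. *)
Lemma hdim_eq_retract M U V : fac M U -> fac M V ->
  (forall X, fac M X -> hdim U X = hdim V X) -> exists r, retract V (pw r U).
Proof.
move=> MU MV H; have UV := hdim_eq_fac MU H MV.
have VU : fac V U by apply: (hdim_eq_fac MV) => // X MX; rewrite H.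
have [n [p [hp Hp]]] := approx U V; exists n.
have [Z [i [hi fi iE]]] := ker_ex hp.
(* Both sides only see the trace T of U in Z. *)
have HZ : hdim U Z = hdim V Z.
  have [m [r [hr Hr]]] := approx U Z.
  have [T [q [j [hq hj fq fj rE]]]] := im_ex hr.
  have UT : fac U T by apply: fac_surj hq fq _; apply/fac_pwr/fac_refl.
  have sj f : ishom U Z f -> (f <= j)%MS.
    by move=> /Hr[k _ <-]; rewrite rE mulmxA submxMl.
  have -> : hdim U Z = hdim U T.
    apply/esym/(hdim_inj U hj fj) => f hf.
    by have [t ht tE] := factor_inj hf hj fj (sj _ hf); exists t.
  have -> : hdim V Z = hdim V T.
    apply/esym/(hdim_inj V hj fj) => f hf.
    have [|t ht tE] := factor_inj hf hj fj; last by exists t.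
    have /row_fullP[B B1] : row_full (premx f j).
      by apply: UV => g hg; rewrite premxP; apply: sj; apply: ishomM hg hf.
    by rewrite -[f]mul1mx -premxP -B1 submxMl.
  apply: H; exact: fac_trans MU UT.
have MUn : fac M (pw n U) by apply: fac_pwr.
have dU := hdim_ker U hi fi hp iE; have dV := hdim_ker V hi fi hp iE.
have full : (linfun (mulmxr p : 'M_(rdim U, _) -> 'M_(rdim U, rdim V)) @: homsp U (pw n U) = homsp U V)%VS.
  apply/eqP; rewrite eqEsubv; apply/andP; split; apply/subvP => h.
    by case/memv_imgP=> h' /mem_homsp hh' ->; rewrite lfunE; apply/mem_homsp/ishomM.
  move/mem_homsp/Hp=> [j /mem_homsp hj <-].
  by rewrite -[j *m p](lfunE (mulmxr p)) memv_img.
have /eqP eV : (linfun (mulmxr p : 'M_(rdim V, _) -> 'M_(rdim V, rdim V)) @: homsp V (pw n U) == homsp V V)%VS.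
  rewrite eqEdim; apply/andP; split.
    apply/subvP => h /memv_imgP[h' /mem_homsp hh' ->]; rewrite lfunE.
    exact/mem_homsp/ishomM.
  move: dU; rewrite full HZ H // -dV => /addnI <-.
  by rewrite H.
have : 1%:M \in homsp V V by apply/mem_homsp/ishom1.
rewrite -eV => /memv_imgP[s /mem_homsp hs]; rewrite lfunE /= => sE.
by exists s, p; split.
Qed.

End HomDimensions.

(** * The number of summands of a tau-rigid module *)

Section Relations.
Import Num.Theory Order.TTheory.

(** The vectors g - h, one for each element of c, are too many to be independent.
An integral relation among them is split by sign, so that a and b can serve as
multiplicities of direct summands. *)
Lemma nat_relation (T D : eqType) (c : seq T) (d : seq D) (g h : T -> D -> nat) :
  uniq c -> (size d < size c)%N -> exists a b : T -> nat,
    [/\ forall y, a y = 0%N \/ b y = 0%N,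
        exists2 y, y \in c & (0 < a y + b y)%N &
        forall j, j \in d ->
          (\sum_(y <- c) (a y * g y j + b y * h y j) =
           \sum_(y <- c) (b y * g y j + a y * h y j))%N].
Proof.
move=> uc ltdc.
have [y0 cy0] : exists y0, y0 \in c.
  by case: c {uc} ltdc => // y0 c _; exists y0; rewrite inE eqxx.
case: d ltdc => [|j0 d0] ltdc.
  exists (fun _ => 1%N), (fun _ => 0%N); split=> // [y|]; [by right|by exists y0].
set d := j0 :: d0 in ltdc *.
pose G : 'M[rat]_(size c, size d) :=
  \matrix_(i, j) ((g (nth y0 c i) (nth j0 d j))%:R - (h (nth y0 c i) (nth j0 d j))%:R).
have : kermx G != 0.
  rewrite kermx_eq0 /row_free; apply: contraTneq ltdc => rG.
  by rewrite -leqNgt -rG rank_leq_col.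
case/rowV0Pn=> v /sub_kermxP vG v0.
pose dn := \prod_i denq (v 0 i).
have [z zE] : exists z : 'I_(size c) -> int, forall i, v 0 i * dn%:~R = (z i)%:~R.
  apply: (@fin_all_exists _ (fun _ => int) (fun i z => v 0 i * dn%:~R = z%:~R)) => i.
  exists (numq (v 0 i) * \prod_(j | j != i) denq (v 0 j)).
  rewrite /dn (bigD1 i) //= !rmorphM /= mulrA; congr (_ * _).
  by rewrite -{1}(divq_num_den (v 0 i)) divfK // intr_eq0 denq_neq0.
have dn0 : dn%:~R != 0 :> rat.
  by rewrite intr_eq0; apply/prodf_neq0 => i _; rewrite denq_neq0.
have zG (j : 'I_(size d)) : \sum_i z i * ((g (nth y0 c i) (nth j0 d j))%:Z
    - (h (nth y0 c i) (nth j0 d j))%:Z) = 0.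
  apply/eqP; rewrite -(intr_eq0 rat) rmorph_sum /=; apply/eqP.
  have := congr1 (fun w : 'rV_(size d) => w 0 j * dn%:~R) vG; rewrite /= !mxE mul0r mulr_suml => e; rewrite -[RHS]e.
  by apply: eq_bigr => i _; rewrite rmorphM rmorphB /= -zE mxE mulrAC.
(* z as a function on T; elements outside of c get 0. *)
pose zz y := if insub (index y c) is Some i then z i else 0.
have zzE (i : 'I_(size c)) : zz (nth y0 c i) = z i.
  rewrite /zz index_uniq //; case: insubP => [u _ uE|]; last by rewrite ltn_ord.
  by congr z; apply: val_inj.
pose a y := if 0 <= zz y then `|zz y|%N else 0%N.
pose b y := if 0 <= zz y then 0%N else `|zz y|%N.
have abE y : (a y)%:Z - (b y)%:Z = zz y.
  rewrite /a /b; case: ifPn => [p|]; first by rewrite gez0_abs ?subr0.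
  by rewrite -ltNge => n; rewrite ltz0_abs // sub0r opprK.
exists a, b; split.
- by move=> y; rewrite /a /b; case: ifP; [right|left].
- have /rV0Pn[i vi] := v0; exists (nth y0 c i); first exact: mem_nth.
  rewrite lt0n addn_eq0; apply: contra vi => /andP[/eqP a0 /eqP b0].
  have := abE (nth y0 c i); rewrite a0 b0 subrr zzE => z0.
  by have := zE i; rewrite -z0 => /eqP; rewrite mulf_eq0 (negPf dn0) orbF.
- move=> j dj; have lt : (index j d < size d)%N by rewrite index_mem.
  have := zG (Ordinal lt); rewrite /= nth_index // => zj.
  apply/eqP; rewrite -eqz_nat -subr_eq0 !rmorph_sum /= -sumrB.
  rewrite (big_nth y0) big_mkord; apply/eqP; rewrite -[RHS]zj; apply: eq_bigr => i _.
  rewrite -zzE -abE !PoszD !PoszM.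
  set aa := (a _)%:Z; set bb := (b _)%:Z; set gg := (g _ _)%:Z; set hh := (h _ _)%:Z.
  rewrite [RHS]mulrBl !mulrBr opprB [RHS]addrACA opprD; congr (_ + _).
  exact: addrC.
Qed.

End Relations.

Section Counting.
Variables (K : fieldType) (A : fdalg K).
Implicit Types M N P X Y Z C E G U V W : rmod A.

Definition indset M : set (isoclass A) :=
  [set cls X | X in [set X | indecomposable X /\ retract X M]].
(** The support of M, with each simple module replaced by its projective cover. *)
Definition suppset M : set (isoclass A) :=
  [set cls P | P in [set P | [/\ indecomposable P, retract P (reg A) & ~ hom_zero P M]]].
Definition ncard (T : choiceType) (X : set T) : nat := #|` fset_set X|.

Lemma clsK (c : isoclass A) : cls (repr c) = c.
Proof. exact: reprK. Qed.
Lemma repr_cls X : iso (repr (cls X)) X.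
Proof. by apply/clsP; rewrite clsK. Qed.

Lemma nsummandsE M : nsummands M = ncard (indset M).
Proof.
rewrite /nsummands /ncard; congr #|` fset_set _|; apply/seteqP.
by split=> _ [X [indX /summandP rX] <-]; exists X.
Qed.

Lemma indsetP X M : indset M (cls X) <-> indecomposable X /\ retract X M.
Proof.
split=> [[Y [indY rY] /clsP YX]|]; last by exists X.
by split; [apply: indec_iso indY|apply: retract_isol rY; apply: iso_sym].
Qed.
Lemma indset_repr c M : indset M c <-> indecomposable (repr c) /\ retract (repr c) M.
Proof. by rewrite -indsetP clsK. Qed.

Lemma suppsetP P M : suppset M (cls P) <->
  [/\ indecomposable P, retract P (reg A) & ~ hom_zero P M].
Proof.
split=> [[Y [indY rY nz] /clsP YP]|]; last by exists P.
split; [exact: indec_iso indY|exact: retract_isol (iso_sym YP) rY|].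
by apply: contra_not nz; apply: hom_zero_isol (iso_sym YP).
Qed.
Lemma suppset_repr c M : suppset M c <->
  [/\ indecomposable (repr c), retract (repr c) (reg A) & ~ hom_zero (repr c) M].
Proof. by rewrite -suppsetP clsK. Qed.

Lemma indset_dsum X M : indecomposable X -> indset (dsum X M) = cls X |` indset M.
Proof.
move=> indX; apply/seteqP; split=> c; rewrite -[c]clsK.
  move/indsetP=> [indc /(indec_dsum indc)[rX|rM]].
    by left; apply/clsP/retract_indec.
  by right; apply/indsetP.
case=> [->|/indsetP[indc rc]]; apply/indsetP; split=> //; first exact: retract_inl.
exact: retract_trans rc (retract_inr _ _).
Qed.

Lemma indset_sub M N : (forall X, indecomposable X -> retract X M -> retract X N) ->
  indset M `<=` indset N.
Proof.
by move=> H c; rewrite -[c]clsK => /indsetP[indc rc]; apply/indsetP; split=> //; apply: H.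
Qed.

Lemma finite_indset M : finite_set (indset M).
Proof.
have [s [inds iM]] := indec_decomp M.
have : indset M `<=` indset (bigdsum s).
  by apply: indset_sub => X _; apply: retract_isor.
move/sub_finite_set; apply; elim: s inds {iM} => [_|Y s IH inds].
  apply: (@sub_finite_set _ _ set0) => // c; rewrite -[c]clsK => /indsetP[].
  by move/indec_not_retract0 => /(_ (rmod0 A) erefl).
rewrite /= indset_dsum; last by apply: inds; rewrite inE eqxx.
by rewrite finite_setU; split; [exact: finite_set1|]; apply: IH => X sX; apply: inds; rewrite inE sX orbT.
Qed.

Lemma suppset_reg M : suppset M `<=` indset (reg A).
Proof. by move=> c; rewrite -[c]clsK => /suppsetP[indc rc _]; apply/indsetP. Qed.

Lemma finite_suppset M : finite_set (suppset M).
Proof. exact: sub_finite_set (@suppset_reg M) (finite_indset _). Qed.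

Lemma nsummands_dsum X M : indecomposable X -> ~ retract X M ->
  nsummands (dsum X M) = (nsummands M).+1.
Proof.
move=> indX nX; rewrite !nsummandsE indset_dsum // /ncard.
rewrite fset_setU1; last exact: finite_indset.
rewrite cardfsU1 in_fset_set; last exact: finite_indset.
have -> // : (cls X \in indset M) = false.
by apply/negP; rewrite inE => /indsetP[_].
Qed.

Lemma ncard_le (T : choiceType) (X Y : set T) : finite_set Y -> X `<=` Y ->
  (ncard X <= ncard Y)%N.
Proof.
move=> fY XY; apply: fsubset_leq_card; apply/fsubsetP => x.
rewrite !in_fset_set //; last exact: sub_finite_set fY.
by rewrite !inE; apply: XY.
Qed.

Lemma ncard_sub_eq (T : choiceType) (X Y : set T) : finite_set Y -> X `<=` Y ->
  (ncard Y <= ncard X)%N -> X = Y.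
Proof.
move=> fY XY le; have fX := sub_finite_set XY fY.
have : fset_set X = fset_set Y.
  apply/eqP; rewrite eqEfcard; apply/andP; split => //.
  by apply/fsubsetP => x; rewrite !in_fset_set // !inE; apply: XY.
by move/(congr1 (fun s => [set` s])); rewrite !fset_setK.
Qed.

Lemma ncardU1 (T : choiceType) (x : T) (X : set T) : finite_set X -> ~ X x ->
  ncard (x |` X) = (ncard X).+1.
Proof.
move=> fX nx; rewrite /ncard fset_setU1 // cardfsU1 in_fset_set //.
have -> // : (x \in X) = false.
by apply/negP; rewrite inE.
Qed.

Lemma ncard_bij (T T' : choiceType) (X : set T) (Y : set T') (f : T -> T') :
  finite_set X -> set_bij X Y f -> ncard X = ncard Y.
Proof.
move=> fX [ff fi fs]; rewrite /ncard -(surj_image_eq _ fs); last by move=> _ [x Xx <-]; apply: ff.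
rewrite fset_set_image // card_in_imfset //= => x y.
by rewrite !in_fset_set // => xX yX; apply: fi.
Qed.

Lemma proj_nohom P M X : projective_mod P -> fac M X -> hom_zero P M -> hom_zero P X.
Proof.
move=> prP MX /hom_zeroP z; apply/hom_zeroP => f hf.
have [n [p [hp fp]]] := fac_pw MX; have [t ht <-] := projP prP hp fp hf.
suff -> : t = 0 by rewrite mul0mx.
elim: n {p hp fp} t ht => [|n IH] t ht; first by apply/matrixP => a [].
rewrite [t]dsum_rowE (z _ (ishomM ht (fst_hom _ _))).
by rewrite (IH _ (ishomM ht (snd_hom _ _))) row_mx0.
Qed.

(** On Fac M the indecomposable projectives outside of the support of M do not
contribute. *)
Lemma hdim_proj M P (d := fset_set (suppset M) : seq _) : projective_mod P ->
  exists k : isoclass A -> nat, forall X, fac M X ->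
    hdim P X = (\sum_(c <- d) k c * hdim (repr c) X)%N.
Proof.
move=> prP; have [s [inds iP]] := indec_decomp P.
have regs Y : Y \in s -> retract Y (reg A).
  move=> sY; apply/in_add_indec; first exact: inds.
  apply: in_add_retract (proj_in_add prP).
  by apply: retract_isor (iso_sym iP) (mem_bigdsum sY).
suff [k H] : exists k : isoclass A -> nat, forall X, fac M X ->
    hdim (bigdsum s) X = (\sum_(c <- d) k c * hdim (repr c) X)%N.
  by exists k => X /H <-; apply: hdim_iso.
elim: s inds regs {iP} => [_ _|Y s IH inds regs].
  exists (fun _ => 0%N) => X _; rewrite hdim_bigdsum big_nil big1 //.
have [||k H] := IH.
- by move=> Z sZ; apply: inds; rewrite inE sZ orbT.
- by move=> Z sZ; apply: regs; rewrite inE sZ orbT.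
have Ys : Y \in Y :: s by rewrite inE eqxx.
case: (pselect (suppset M (cls Y))) => sY; last first.
  exists k => X MX; rewrite /= hdim_dsum H // hdim_nohom //.
  apply: (@proj_nohom _ M) => //; first exact: proj_retract (regs _ Ys) (@proj_reg _ _).
  by apply: contrapT => nz; apply: sY; apply/suppsetP; split; [apply: inds|apply: regs|].
exists (fun c => (c == cls Y) + k c)%N => X MX; rewrite /= hdim_dsum H //.
under [RHS]eq_bigr do rewrite mulnDl.
rewrite big_split /=; congr (_ + _)%N.
have dY : cls Y \in d by rewrite /d in_fset_set ?inE //; apply: finite_suppset.
rewrite (big_rem (cls Y)) //= eqxx mul1n big1_seq ?addn0.
  exact/hdim_iso/iso_sym/repr_cls.
move=> c /andP[_]; rewrite mem_rem_uniq ?fset_uniq // inE => /andP[/negPf -> _].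
exact: mul0n.
Qed.

(** If M_y runs over the summands of M, with minimal presentations P1 -> P0 ->
M_y, then dim Hom(M_y, X) = dim Hom(P0, X) - dim Hom(P1, X) on Fac M is linear in
the g-vector of M_y, which has only as many coordinates as the support of M has
elements. A relation between g-vectors would give two sums of different summands
with the same dimensions of Hom, contrary to hdim_eq_retract. *)
Theorem nsummands_le_supp M : ext0 allmod M M -> (nsummands M <= ncard (suppset M))%N.
Proof.
move=> eM; rewrite nsummandsE leqNgt; apply/negP.
set c : seq (isoclass A) := fset_set (indset M).
set d : seq (isoclass A) := fset_set (suppset M).
rewrite /ncard -/c -/d => ltdc.
have cP y : y \in c -> indecomposable (repr y) /\ retract (repr y) M.
  by rewrite /c in_fset_set ?inE; [move/indset_repr|apply: finite_indset].
have /choice[gh ghE] : forall y, exists gh : (isoclass A -> nat) * (isoclass A -> nat),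
    y \in c -> forall X, fac M X ->
    (hdim (repr y) X + \sum_(j <- d) gh.2 j * hdim (repr j) X =
     \sum_(j <- d) gh.1 j * hdim (repr j) X)%N.
  move=> y; have [/cP[indy ry]|_] := boolP (y \in c); last by exists (fun=> 0%N, fun=> 0%N).
  have [P1 [P0 [f [g mp]]]] := min_pres (repr y); have [pr1 pr0 fg fE _] := mp.
  have [k1 H1] := hdim_proj M pr1; have [k0 H0] := hdim_proj M pr0.
  exists (k0, k1) => _ X MX; rewrite -H1 // -H0 //.
  apply: (hdim_pres (homP f) (homP g) fg fE) => h hh.
  exact: (min_pres_factor mp (ext0_retract ry eM) MX).
have [a [b [ab0 [y0 cy0 aby0] abE]]] :=
  nat_relation (fun y => (gh y).1) (fun y => (gh y).2) (fset_uniq _) ltdc.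
pose U := bigdsum [seq pw (a y) (repr y) | y <- c].
pose V := bigdsum [seq pw (b y) (repr y) | y <- c].
have sumE (e : isoclass A -> nat) X :
    hdim (bigdsum [seq pw (e y) (repr y) | y <- c]) X = (\sum_(y <- c) e y * hdim (repr y) X)%N.
  by rewrite hdim_bigdsum big_map; apply: eq_bigr => y _; rewrite hdim_pw.
have facU (e : isoclass A -> nat) : fac M (bigdsum [seq pw (e y) (repr y) | y <- c]).
  have : {in c, forall y, fac M (repr y)} by move=> y /cP[_]; apply: fac_retract.
  elim: (c) => [_|y s IH Hs] /=; first exact: (@fac_pwr _ _ 0%N M M (@fac_refl _ _ M)).
  apply: fac_dsum; first by apply/fac_pwr/Hs; rewrite inE eqxx.
  by apply: IH => z sz; apply: Hs; rewrite inE sz orbT.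
have eqUV X : fac M X -> hdim U X = hdim V X.
  move=> MX; rewrite !sumE.
  have key (e : isoclass A -> nat) : (\sum_(y <- c) e y * hdim (repr y) X +
      \sum_(y <- c) e y * (\sum_(j <- d) (gh y).2 j * hdim (repr j) X) =
      \sum_(y <- c) e y * (\sum_(j <- d) (gh y).1 j * hdim (repr j) X))%N.
    rewrite -big_split /= big_seq [RHS]big_seq; apply: eq_bigr => y cy.
    by rewrite -mulnDr ghE.
  have := key a; have := key b.
  set Sb2 := (X in (_ + X)%N = _ -> _); set Sb1 := (X in _ = X -> _) => eb.
  set Sa2 := (X in (_ + X)%N = _ -> _); set Sa1 := (X in _ = X -> _) => ea.
  have e1 : (Sa1 + Sb2 = Sb1 + Sa2)%N.
    have swap (u v : isoclass A -> nat) (p q : isoclass A -> isoclass A -> nat) :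
      (\sum_(y <- c) u y * (\sum_(j <- d) p y j * hdim (repr j) X) +
       \sum_(y <- c) v y * (\sum_(j <- d) q y j * hdim (repr j) X) =
       \sum_(j <- d) (\sum_(y <- c) (u y * p y j + v y * q y j)) * hdim (repr j) X)%N.
      rewrite -big_split /=.
      under eq_bigr do rewrite !big_distrr -big_split /=.
      rewrite exchange_big /=; apply: eq_bigr => j _.
      by rewrite big_distrl /=; apply: eq_bigr => y _; rewrite mulnDl !mulnA.
    rewrite [LHS]swap [RHS]swap big_seq [RHS]big_seq; apply: eq_bigr => j dj.
    by rewrite abE.
  by apply: (@addIn (Sa2 + Sb2)%N); rewrite addnA ea e1 -eb -addnA (addnC Sb2).
have share (e e' : isoclass A -> nat) y : y \in c -> (0 < e y)%N ->
    (exists r, retract (bigdsum [seq pw (e z) (repr z) | z <- c])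
       (pw r (bigdsum [seq pw (e' z) (repr z) | z <- c]))) -> (0 < e' y)%N.
  move=> cy ey [r rUV]; have [indy _] := cP _ cy.
  have : retract (repr y) (pw r (bigdsum [seq pw (e' z) (repr z) | z <- c])).
    apply: retract_trans rUV; apply: retract_trans (mem_bigdsum (map_f _ cy)).
    by apply: mem_bigdsum; rewrite mem_nseq ey eqxx.
  case/(indec_bigdsum indy)=> W; rewrite mem_nseq => /andP[_ /eqP ->].
  case/(indec_bigdsum indy)=> W' /mapP[z cz ->].
  case/(indec_bigdsum indy)=> W''; rewrite mem_nseq => /andP[e'z /eqP ->] yz.
  have [indz _] := cP _ cz.
  by have /clsP := retract_indec indy indz yz; rewrite !clsK => ->.
have UV : exists r, retract U (pw r V).
  apply: (@hdim_eq_retract _ _ M); [exact: facU|exact: facU|].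
  by move=> X MX; rewrite eqUV.
have VU : exists r, retract V (pw r U).
  by apply: (@hdim_eq_retract _ _ M); [exact: facU|exact: facU|exact: eqUV].
move: aby0; rewrite addn_gt0 => /orP[ay|by'].
  by have := share _ _ _ cy0 ay UV; have [a0|->//] := ab0 y0; rewrite a0 in ay.
by have := share _ _ _ cy0 by' VU; have [->//|b0] := ab0 y0; rewrite b0 in by'.
Qed.

End Counting.

(** * Basic modules *)

Section BasicModules.
Variables (K : fieldType) (A : fdalg K).
Implicit Types M N P X Y Z C E G U V W : rmod A.

(** Lists of pairwise nonisomorphic indecomposable modules, with the condition on
the head expressed by direct summands to suit inductions. *)
Fixpoint basics (s : seq (rmod A)) : Prop :=
  if s is X :: s' then [/\ indecomposable X, ~ retract X (bigdsum s') & basics s']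
  else True.

Lemma basics_indec s X : basics s -> X \in s -> indecomposable X.
Proof.
elim: s => // Y s IH [indY _ bs]; rewrite inE => /orP[/eqP ->//|]; exact: IH.
Qed.

Lemma basic_modP M : basic_mod M <-> exists s, basics s /\ iso M (bigdsum s).
Proof.
split=> [[s [iM inds dist]]|[s [bs iM]]].
  exists s; split=> //; elim: s inds dist {iM} => // X s IH inds dist; split.
  - exact: (inds 0%N).
  - move/(indec_bigdsum (inds 0%N isT))=> [Y sY rXY].
    have lt : (index Y s < size s)%N by rewrite index_mem.
    have := dist 0%N (index Y s).+1 isT lt; rewrite /= nth_index //.
    move=> H; suff // : 0%N = (index Y s).+1 by [].
    apply: H; apply: retract_indec => //; first exact: (inds 0%N).
    by have := inds (index Y s).+1 lt; rewrite /= nth_index.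
  - by apply: IH => [i lt|i j li lj ij]; [apply: (inds i.+1)|apply/succn_inj/(dist i.+1 j.+1)].
exists s; split=> // [i lt|i j li lj].
  exact: (basics_indec bs (mem_nth _ lt)).
elim: s i j bs {iM} li lj => // X s IH [|i] [|j] [indX nX bs] li lj //=.
- move=> i0; case: nX; apply: retract_isol i0 _; exact/mem_bigdsum/mem_nth.
- move=> i0; case: nX; apply: retract_isol (iso_sym i0) _; exact/mem_bigdsum/mem_nth.
- by move/(IH _ _ bs li lj) ->.
Qed.

Lemma basics_pull X t : indecomposable X -> basics t -> retract X (bigdsum t) ->
  exists t', [/\ basics t', ~ retract X (bigdsum t') & iso (bigdsum t) (dsum X (bigdsum t'))].
Proof.
move=> indX; elim: t => [_ /(indec_not_retract0 indX)[]//|Y t IH] /= [indY nY bt].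
case: (pselect (retract X (bigdsum t))) => [rXt _|nXt].
  have [t' [bt' nX' it]] := IH bt rXt.
  have nXY : ~ retract X Y.
    move=> rXY; apply: nY; apply: retract_isol rXt.
    exact/iso_sym/retract_indec.
  exists (Y :: t') => /=; split.
  - split=> // rY; apply: nY; apply: retract_isor (iso_sym it) _.
    exact: retract_trans rY (retract_inr _ _).
  - by case/(indec_dsum indX).
  - exact: iso_trans (iso_dsum (iso_refl Y) it) (dsumCA _ _ _).
case/(indec_dsum indX)=> // rXY; exists t; split=> //.
apply: iso_dsum (iso_refl _); exact/iso_sym/retract_indec.
Qed.

Lemma basics_unique s t : basics s -> basics t ->
  (forall X, indecomposable X -> retract X (bigdsum s) <-> retract X (bigdsum t)) ->
  iso (bigdsum s) (bigdsum t).
Proof.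
elim: s t => [|X s IH] t bs bt H.
  case: t bt H => [|Y t] /= bt H; first exact: iso_refl.
  have [indY _ _] := bt.
  by have [] := indec_not_retract0 indY _ ((H Y indY).2 (retract_inl _ _)).
have [indX nX bs'] := bs.
have [t' [bt' nX' it]] := basics_pull indX bt ((H X indX).1 (retract_inl _ _)).
apply: iso_trans _ (iso_sym it) => /=; apply: iso_dsum (iso_refl _) _.
apply: IH => // Y indY; split=> rY.
  have rYt : retract Y (dsum X (bigdsum t')).
    by apply: (retract_isor it); apply/H => //; apply: retract_trans rY (retract_inr _ _).
  case/(indec_dsum indY): rYt => // rYX; case: nX; apply: retract_isol rY.
  exact/iso_sym/retract_indec.
have rYs : retract Y (dsum X (bigdsum s)).
  by apply/H => //; apply: (retract_isor (iso_sym it)); apply: retract_trans rY (retract_inr _ _).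
case/(indec_dsum indY): rYs => // rYX; case: nX'; apply: retract_isol rY.
exact/iso_sym/retract_indec.
Qed.

Lemma basic_unique M N : basic_mod M -> basic_mod N ->
  (forall X, indecomposable X -> retract X M <-> retract X N) -> iso M N.
Proof.
move=> /basic_modP[s [bs iM]] /basic_modP[t [bt iN]] H.
apply: (iso_trans iM); apply: iso_trans _ (iso_sym iN); apply: basics_unique => // X indX.
split=> rX; [apply: (retract_isor iN)|apply: (retract_isor iM)]; apply/H => //.
  exact: retract_isor (iso_sym iM) rX.
exact: retract_isor (iso_sym iN) rX.
Qed.

(** By cancellation, a basic module contains no indecomposable summand twice. This
form passes to direct summands and through changes of rings without any choice
of a decomposition. *)
Lemma basicP M : basic_mod M <->
  forall X, indecomposable X -> ~ retract (dsum X X) M.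
Proof.
split=> [/basic_modP[s [bs iM]] X indX rXX|H].
  have rXs := retract_isor iM rXX.
  have [t [bt nX it]] := basics_pull indX bs (retract_dsum_l rXs).
  have /summandP[Y iY] := retract_isor it rXs.
  have : iso (bigdsum t) (dsum X Y).
    apply: (dsum_cancel indX); apply: iso_trans iY _; exact/iso_sym/dsumA.
  by move=> i; apply: nX; apply: retract_isor (iso_sym i) (retract_inl _ _).
have [s [inds iM]] := indec_decomp M; apply/basic_modP; exists s; split=> //.
have {H} : forall X, indecomposable X -> ~ retract (dsum X X) (bigdsum s).
  by move=> X indX r; apply: (H X indX); apply: retract_isor (iso_sym iM) r.
elim: s inds {iM} => //= X s IH inds H; have indX : indecomposable X by apply: inds; rewrite inE eqxx.
split=> //.
  move=> rX; apply: (H X indX); apply: retract_dsum rX; exact: retract_refl.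
apply: IH => [Y sY|Y indY rY]; first by apply: inds; rewrite inE sY orbT.
by apply: (H Y indY); apply: retract_trans rY (retract_inr _ _).
Qed.

Lemma basic_retract M N : basic_mod N -> retract M N -> basic_mod M.
Proof.
move=> /basicP bN rMN; apply/basicP => X indX r; apply: (bN X indX).
exact: retract_trans r rMN.
Qed.
Lemma basic_iso M N : iso M N -> basic_mod M -> basic_mod N.
Proof. by move=> /iso_sym/iso_retract r b; apply: basic_retract b r. Qed.

Lemma basic_dsum X M : indecomposable X -> ~ retract X M -> basic_mod M ->
  basic_mod (dsum X M).
Proof.
move=> indX nX /basic_modP[s [bs iM]]; apply/basic_modP; exists (X :: s); split.
  by split=> // rX; apply: nX; apply: retract_isor (iso_sym iM) rX.
exact: iso_dsum (iso_refl _) iM.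
Qed.

Lemma basic_not_retract X M : indecomposable X -> basic_mod (dsum X M) -> ~ retract X M.
Proof.
move=> indX /basicP bXM rXM; apply: (bXM X indX).
by apply: retract_dsum rXM; apply: retract_refl.
Qed.

Lemma ract_sub (X : rmod A) (a b : A) : X (a - b) = X a - X b.
Proof. by rewrite addrC -scaleN1r ract_lin scaleN1r addrC. Qed.

End BasicModules.

(** * Modules over a quotient algebra *)

Section ChangeRings.
Variables (K : fieldType) (A : fdalg K) (I : ideal A).
Local Notation B := (quoalg I).
Local Notation phi := (quo_mor I).
Local Notation rs N := (res phi N).

Definition killed (X : rmod A) := forall a, a \in I -> X a = 0.

Lemma killed_res (N : rmod B) : killed (rs N).
Proof.
move=> a /quo_mor_ker /= ->; have := ract_sub N 0 0; rewrite subrr => ->.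
by rewrite subrr.
Qed.

Lemma rmod_eq n (f g : A -> 'M[K]_n) fl f1 fM gl g1 gM :
  f = g -> @Rmod K A n f fl f1 fM = @Rmod K A n g gl g1 gM.
Proof. by move=> fg; subst g; congr Rmod; apply: Prop_irrelevance. Qed.

(** The equality of modules, rather than an isomorphism, allows one to replace a
module killed by I by one over the quotient in any statement. *)
Lemma killedE (X : rmod A) : killed X -> exists N : rmod B, X = rs N.
Proof.
move=> kX; pose s (b : B) : A := projT1 (cid (quo_mor_surj b)).
have sK b : phi (s b) = b by rewrite /s; case: cid.
have eX (a b : A) : phi a = phi b -> X a = X b.
  move=> /quo_proj_eq/kX; rewrite ract_sub => /eqP; rewrite subr_eq0 => /eqP //.
have act_lin : linear (fun b => X (s b)).
  move=> k b c; rewrite -ract_lin; apply: eX.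
  by rewrite sK (algmor_lin phi) !sK.
have act1 : X (s (fdone B)) = 1%:M.
  by rewrite -(ract1 X); apply: eX; rewrite sK algmor1.
have actM b c : X (s (fdmul b c)) = X (s b) *m X (s c).
  by rewrite -ractM; apply: eX; rewrite sK (algmorM phi) !sK.
exists (Rmod act_lin act1 actM).
have : (ract X) = (fun a => X (s (phi a))) by apply: funext => a; apply: eX; rewrite sK.
case: X kX @s sK eX act_lin act1 actM => n f fl f1 fM /= kX sK eX al a1 aM e.
exact: rmod_eq.
Qed.

Lemma killed_inj X Y i : ishom X Y i -> row_free i -> killed Y -> killed X.
Proof.
by move=> hi fi kY a Ia; apply: (row_free_canr fi); rewrite hi kY // mulmx0 mul0mx.
Qed.
Lemma killed_surj X Y q : ishom X Y q -> row_full q -> killed X -> killed Y.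
Proof.
by move=> hq fq kX a Ia; apply: (row_full_canl fq); rewrite -hq kX // mulmx0 mul0mx.
Qed.
Lemma killed_dsum X Y : killed X -> killed Y -> killed (dsum X Y).
Proof.
by move=> kX kY a Ia; rewrite /= /dsum_act kX // kY // /block_mx !row_mx0 col_mx0.
Qed.
Lemma killed_retract X Y : retract X Y -> killed Y -> killed X.
Proof. by case=> i [p [hi hp ip]]; apply: killed_inj hi _; apply/row_freeP; exists p. Qed.
Lemma killed_fac X Y : fac X Y -> killed X -> killed Y.
Proof.
move=> XY kX; have [n [p [hp fp]]] := fac_pw XY; apply: (killed_surj hp fp).
elim: n {p hp fp} => [|n IH] /=; last exact: killed_dsum.
by move=> a _; apply/matrixP => -[].
Qed.

Lemma res_hom (M N : rmod B) f : ishom (rs M) (rs N) f <-> ishom M N f.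
Proof.
split=> hf a; last exact: hf.
by have [b <-] := quo_mor_surj a; apply: hf.
Qed.

Lemma res_retract (M N : rmod B) : retract (rs M) (rs N) <-> retract M N.
Proof.
split=> -[i [p [hi hp ip]]]; exists i, p; split=> //; exact/res_hom.
Qed.
Lemma res_iso (M N : rmod B) : iso (rs M) (rs N) <-> iso M N.
Proof.
split=> i; apply: retract_dim_iso; try (by apply/res_retract/iso_retract);
  by move/iso_dim: i => /= ->.
Qed.
Lemma res_dsum (M N : rmod B) : rs (dsum M N) = dsum (rs M) (rs N).
Proof. exact: rmod_eq. Qed.
Lemma res_indec (M : rmod B) : indecomposable (rs M) <-> indecomposable M.
Proof.
split=> -[M0 indM]; split=> // X Y iM.
  by apply: (indM (rs X) (rs Y)); rewrite -res_dsum; apply/res_iso.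
have kM := @killed_res M.
have kXY : killed (dsum X Y) := killed_retract (iso_retract (iso_sym iM)) kM.
have [X' XE] := killedE (killed_retract (retract_inl _ _) kXY).
have [Y' YE] := killedE (killed_retract (retract_inr _ _) kXY).
rewrite XE YE; apply: (indM X' Y'); apply/res_iso.
by rewrite res_dsum -XE -YE.
Qed.
Lemma res_basic (M : rmod B) : basic_mod (rs M) <-> basic_mod M.
Proof.
split=> /basicP b; apply/basicP => X indX rX.
  by apply: (b (rs X)); [apply/res_indec|rewrite -res_dsum; apply/res_retract].
have [X' XE] := killedE (killed_retract (retract_dsum_l rX) (@killed_res M)).
rewrite XE in indX rX; apply: (b X'); first exact/res_indec.
by apply/res_retract; rewrite res_dsum.
Qed.
Lemma res_fac (M N : rmod B) : fac (rs M) (rs N) <-> fac M N.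
Proof.
split=> MN k U HU; apply: MN => f hf; apply: HU; exact/res_hom.
Qed.
(** All modules that occur in the lifting property are killed by I as soon as
its middle term E is. *)
Lemma res_ext0 (C M : rmod B) : ext0 killed (rs C) (rs M) <-> ext0 allmod C M.
Proof.
split=> H.
  move=> E X G p q w _ hp hq fq pq MG hw.
  have [l hl lq] := H (rs E) (rs X) (rs G) p q w (@killed_res E)
    ((res_hom _).2 hp) ((res_hom _).2 hq) fq pq ((res_fac _ _).2 MG)
    ((res_hom _).2 hw).
  by exists l => //; apply/res_hom.
move=> E X G p q w kE hp hq fq pq MG hw.
have kX := killed_surj hq fq kE.
have kG := killed_fac MG (@killed_res M).
have [E' EE] := killedE kE; have [X' XE] := killedE kX; have [G' GE] := killedE kG.
subst E X G; have [l hl lq] := H E' X' G' p q w Logic.I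
  ((res_hom _).1 hp) ((res_hom _).1 hq) fq pq ((res_fac _ _).1 MG)
  ((res_hom _).1 hw).
by exists l => //; apply/res_hom.
Qed.

Lemma res_nsummands (N : rmod B) : nsummands (rs N) = nsummands N.
Proof.
rewrite !nsummandsE; apply/esym.
apply: (@ncard_bij _ _ _ _ (fun c : isoclass B => cls (rs (repr c : rmod B)))); first exact: finite_indset.
split.
- move=> c; rewrite -[c]clsK => /indsetP[indc rc] /=; rewrite clsK.
  by apply/indsetP; split; [apply/res_indec|apply/res_retract].
- move=> c d _ _ /clsP/res_iso/clsP; by rewrite !clsK.
- move=> c; rewrite -[c]clsK => /indsetP[indc rc].
  have [X XE] := killedE (killed_retract rc (@killed_res N)).
  rewrite XE in indc rc *; exists (cls X).
    by apply/indsetP; split; [apply/res_indec|apply/res_retract].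
  by apply/clsP/res_iso/repr_cls.
Qed.

End ChangeRings.

(** * Tensor products with a quotient algebra *)

Section Tensor.
Variables (K : fieldType) (A : fdalg K) (I : ideal A).
Local Notation B := (quoalg I).
Local Notation phi := (quo_mor I).
Local Notation rs N := (res phi N).
Local Notation tens M := (tensor phi M).

Lemma ptens_lin (M : rmod A) (b : B) : linear (fun v : 'rV[K]_(rdim M) => ptens v b).
Proof. by move=> k x y; rewrite /ptens linearP mulmxDl -scalemxAl linearP. Qed.

Lemma ptens_delta (M : rmod A) i j :
  ptens (delta_mx 0 i : 'rV[K]_(rdim M)) (r2v (delta_mx 0 j) : B)
  = delta_mx 0 (mxvec_index i j).
Proof.
by rewrite /ptens r2vK trmx_delta mul_delta_mx mxvec_delta.
Qed.

Lemma tensor_mul (M : rmod A) : exists q : 'M[K]_(rdim (tensK B M), rdim (tens M)),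
  [/\ ishom (tensK B M) (tens M) q, row_full q &
      (kermx q :=: tens_rel phi M)%MS].
Proof.
pose W : submodule (tensK B M) := Submodule (@tens_rel_stable K A B phi M).
have kE m (U : 'M_(m, rdim (tensK B M))) : (U *m in_factmod W 1%:M == 0) = (U <= W)%MS.
  by rewrite -in_factmodE in_factmod_eq0.
exists (in_factmod W 1%:M); split.
- move=> a; rewrite -in_factmodE -[in LHS](mul1mx (tensK B M a)).
  by rewrite -(factmod_in W).
- by apply/row_fullP; exists (val_factmod 1%:M); rewrite -in_factmodE val_factmodK.
- apply/eqmxP/andP; split; first by rewrite -[tens_rel _ _]/(W : 'M_(_, _)) -kE mulmx_ker.
  by apply/sub_kermxP/eqP; rewrite kE.
Qed.

(** The canonical map M -> M (x) A/I is the universal map from M to a module over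
A/I. Everything below about the tensor product follows from this. *)
Lemma tensor_univ (M : rmod A) : exists eta : 'M[K]_(rdim M, rdim (tens M)),
  [/\ ishom M (rs (tens M)) eta, row_full eta &
   forall (N : rmod B) h, ishom M (rs N) h ->
     exists2 g, ishom (tens M) N g & eta *m g = h].
Proof.
have [q [hq fq qE]] := tensor_mul M.
have rel (v : 'rV_(rdim M)) a (b : B) : ptens (v *m M a) b *m q = ptens v (fdmul (phi a) b) *m q.
  apply/eqP; rewrite -subr_eq0 -mulmxBl; apply/eqP/sub_kermxP; rewrite qE.
  by apply: mxspan_in; exists v, a, b.
have act (v : 'rV_(rdim M)) (b c : B) : ptens v b *m q *m tens M c = ptens v (fdmul b c) *m q.
  rewrite -mulmxA -hq mulmxA; congr (_ *m _).
  by rewrite /ptens [LHS]tensK_actE -mulmxA mul_rmul_mx v2rK.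
pose T : 'M[K]_(rdim M, rdim M * dim B) := lin1_mx (fun v => ptens v (fdone B)).
have TE (v : 'rV_(rdim M)) : v *m T = ptens v (fdone B).
  pose fL := GRing.isLinear.Build _ _ _ _ _ (@ptens_lin M (fdone B)).
  pose f : {linear 'rV[K]_(rdim M) -> 'rV[K]_(rdim M * dim B)} :=
    HB.pack (fun v : 'rV[K]_(rdim M) => ptens v (fdone B)) fL.
  exact: (mul_rV_lin1 f).
pose eta := T *m q.
have etaE (v : 'rV_(rdim M)) : v *m eta = ptens v (fdone B) *m q by rewrite mulmxA TE.
have etaA (v : 'rV_(rdim M)) b : v *m eta *m tens M b = ptens v b *m q.
  by rewrite etaE act fdmul1l.
have heta : ishom M (rs (tens M)) eta.
  move=> a; apply/row_matrixP => i; rewrite !rowE mulmxA etaE rel fdmul1r.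
  by rewrite mulmxA etaA.
exists eta; split=> //.
  rewrite -sub1mx; have /row_fullP[C C1] := fq; rewrite -C1.
  apply: mulmx_sub; apply/row_subP => k; case/mxvec_indexP: k => i j.
  rewrite rowE -ptens_delta; have [a <-] := quo_mor_surj (r2v (delta_mx 0 j) : B).
  by rewrite -[phi a]fdmul1r -rel -etaE submxMl.
move=> N h hh.
(* v (x) b |-> h(v) b, written on all of M (x) A/I over K *)
pose g0 (w : 'rV[K]_(rdim M * dim B)) : 'rV[K]_(rdim N) :=
  \sum_j (col j (vec_mx w))^T *m h *m N (r2v (delta_mx 0 j)).
have g0_lin : linear g0.
  move=> k x y; rewrite /g0 scaler_sumr -big_split /=; apply: eq_bigr => j _.
  by rewrite !linearP !mulmxDl -!scalemxAl.
pose G : 'M_(rdim (tensK B M), rdim N) := lin1_mx g0.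
have GE w : w *m G = g0 w.
  pose fL := GRing.isLinear.Build _ _ _ _ _ g0_lin.
  pose f : {linear 'rV[K]_(rdim M * dim B) -> 'rV[K]_(rdim N)} := HB.pack g0 fL.
  exact: (mul_rV_lin1 f).
have GT (v : 'rV_(rdim M)) (b : B) : ptens v b *m G = v *m h *m N b.
  rewrite GE /g0 (act_delta N b) mulmx_sumr; apply: eq_bigr => j _.
  have cE : col j (v^T *m v2r b) = v^T *m col j (v2r b) by rewrite !colE mulmxA.
  rewrite /ptens mxvecK cE trmx_mul trmxK -scalemxAr scalemxAl; congr (_ *m _).
  rewrite -!mulmxA; have -> : (col j (v2r b))^T = ((v2r b) 0 j)%:M :> 'M_1.
    by apply/matrixP => x y; rewrite !ord1 !mxE eqxx mulr1n.
  by rewrite mul_scalar_mx.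
have hG : ishom (tensK B M) N G.
  move=> c; apply/row_matrixP => k; case/mxvec_indexP: k => i j.
  rewrite !rowE !mulmxA -ptens_delta GT {1}/ptens [X in X *m G]tensK_actE -mulmxA mul_rmul_mx.
  by rewrite v2rK -[mxvec _]/(ptens _ _) GT ractM mulmxA.
have [|g hg gE] := factor_surj hG hq fq.
  rewrite qE; apply: mxspan_min => _ [v [a [b ->]]]; apply/sub_kermxP.
  rewrite mulmxBl !GT ractM !mulmxA; apply/eqP; rewrite subr_eq0; apply/eqP.
  by rewrite -(mulmxA v) hh mulmxA.
exists g => //; apply/row_matrixP => i; rewrite !rowE mulmxA etaE.
by rewrite -mulmxA gE GT ract1 mulmx1.
Qed.

Lemma tensor_eq (M : rmod A) (N : rmod B) h : ishom M (rs N) h -> row_full h ->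
  (forall (N' : rmod B) h', ishom M (rs N') h' -> (kermx h <= kermx h')%MS) ->
  iso (tens M) N.
Proof.
move=> hh fh uh; have [eta [he fe ue]] := tensor_univ M.
have [g hg gE] := ue _ _ hh.
have [g' hg' gE'] := factor_surj he hh fh (uh _ _ he).
apply/isoP; exists g, g'; split=> //; first exact/res_hom.
  by apply: (row_full_canl fe); rewrite mulmxA gE gE' mulmx1.
by apply: (row_full_canl fh); rewrite mulmxA gE' gE mulmx1.
Qed.

Lemma tensor_res (N : rmod B) : iso (tens (rs N)) N.
Proof.
apply: (@tensor_eq _ _ 1%:M); first exact: ishom1.
  by rewrite row_full_unit unitmx1.
move=> N' h' _; have : kermx (1%:M : 'M[K]_(rdim (rs N))) *m 1%:M = 0 by apply: mulmx_ker.
by rewrite mulmx1 => ->; apply: sub0mx.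
Qed.

Definition teta (M : rmod A) := projT1 (cid (tensor_univ M)).
Lemma teta_hom M : ishom M (rs (tens M)) (teta M).
Proof. by rewrite /teta; case: cid => /= ? []. Qed.
Lemma teta_full M : row_full (teta M).
Proof. by rewrite /teta; case: cid => /= ? []. Qed.
Lemma tetaP M (N : rmod B) h : ishom M (rs N) h ->
  exists2 g, ishom (tens M) N g & teta M *m g = h.
Proof. by rewrite /teta; case: cid => /= ? [_ _]; apply. Qed.

Lemma tmapP M M' f : ishom M M' f ->
  exists2 g, ishom (tens M) (tens M') g & teta M *m g = f *m teta M'.
Proof. by move=> hf; apply: tetaP; apply: ishomM hf (teta_hom M'). Qed.

Lemma tensor_retract M M' : retract M M' -> retract (tens M) (tens M').
Proof.
case=> i [p [hi hp ip]]; have [i' hi' iE] := tmapP hi; have [p' hp' pE] := tmapP hp.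
exists i', p'; split=> //; apply: (row_full_canl (@teta_full M)).
by rewrite mulmxA iE -mulmxA pE mulmxA ip mul1mx mulmx1.
Qed.

Lemma tensor_dim M : (rdim (tens M) <= rdim M)%N.
Proof. by have /eqP {1}<- := @teta_full M; apply: rank_leq_row. Qed.

Lemma tensor_iso M M' : iso M M' -> iso (tens M) (tens M').
Proof.
move=> i; apply: retract_dim_iso; first exact/tensor_retract/iso_retract.
exact/retract_dim/tensor_retract/iso_retract/iso_sym.
Qed.

Lemma tensor_dsum M M' : iso (tens (dsum M M')) (dsum (tens M) (tens M')).
Proof.
have [i hi iE] := tmapP (inl_hom M M'); have [j hj jE] := tmapP (inr_hom M M').
have [p hp pE] := tmapP (fst_hom M M'); have [q hq qE] := tmapP (snd_hom M M').
apply: (biprod_iso hi hp hj hq).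
- by apply: (row_full_canl (@teta_full M)); rewrite mulmxA iE -mulmxA pE mulmxA inl_fst mul1mx mulmx1.
- by apply: (row_full_canl (@teta_full M')); rewrite mulmxA jE -mulmxA qE mulmxA inr_snd mul1mx mulmx1.
- by apply: (row_full_canl (@teta_full M)); rewrite mulmxA iE -mulmxA qE mulmxA inl_snd mul0mx mulmx0.
- by apply: (row_full_canl (@teta_full M')); rewrite mulmxA jE -mulmxA pE mulmxA inr_fst mul0mx mulmx0.
apply: (row_full_canl (@teta_full _)); rewrite mulmxDr !mulmxA pE qE -!mulmxA iE jE !mulmxA.
by rewrite -mulmxDl fst_inl_snd_inr mul1mx mulmx1.
Qed.

Lemma tensor_proj P : projective_mod P -> projective_mod (tens P).
Proof.
move=> prP M N p f fp; have hp := homP p; have hf := homP f.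
have [g hg gE] := projP prP ((res_hom _).2 hp : ishom (rs M) (rs N) p) fp
  (ishomM (teta_hom P) ((res_hom _).2 hf)).
have [g' hg' gE'] := tetaP hg.
exists (Defs.Hom hg') => /=; apply: (row_full_canl (@teta_full P)).
by rewrite mulmxA gE'.
Qed.

Lemma tensor_hom_zero M (N : rmod B) : hom_zero (tens M) N <-> hom_zero M (rs N).
Proof.
split=> /hom_zeroP z; apply/hom_zeroP => f hf.
  by have [g hg <-] := tetaP hf; rewrite (z _ hg) mulmx0.
apply: (row_full_canl (@teta_full M)); rewrite mulmx0; apply: z.
exact: ishomM (teta_hom M) ((res_hom _).2 hf).
Qed.

Lemma hom_zero_dim0 (R : fdalg K) (X Y : rmod R) : rdim X = 0%N -> hom_zero X Y.
Proof. by move=> X0 f; apply/matrixP => i; move: (ltn_ord i); rewrite {2}X0. Qed.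

(** An idempotent of P (x) A/I lifts to an endomorphism of P, which is invertible
or nilpotent. *)
Lemma tensor_indec P : indecomposable P -> projective_mod P -> (0 < rdim (tens P))%N ->
  indecomposable (tens P).
Proof.
move=> indP prP T0; split=> // X Y /isoP[f [g [hf hg fg gf]]].
pose e := f *m fst_mx X Y *m inl_mx X Y *m g.
have he : ishom (tens P) (tens P) e.
  apply: ishomM hg; apply: ishomM (inl_hom _ _); exact: ishomM hf (fst_hom _ _).
have ee : e *m e = e.
  rewrite /e !mulmxA -(mulmxA _ g f) gf mulmx1 -(mulmxA _ (inl_mx X Y) (fst_mx X Y)).
  by rewrite inl_fst mulmx1.
have [h hh hE] := projP prP (teta_hom P) (@teta_full P)
  (ishomM (teta_hom P) ((res_hom _).2 he)).
have [uh|[k hk]] := indec_fitting indP hh.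
  right; have fe : row_full e.
    apply: (@row_full_mull _ _ _ _ (teta P)); rewrite -hE row_fullM ?teta_full //.
    by rewrite row_full_unit.
  have e1 : e = 1%:M.
    by apply: (row_full_canl fe); rewrite mulmx1.
  have : inr_mx X Y *m g *m e *m f = inr_mx X Y by rewrite e1 mulmx1 -mulmxA gf mulmx1.
  rewrite /e !mulmxA -(mulmxA _ g f) gf mulmx1 -(mulmxA _ g f) gf mulmx1 inr_fst !mul0mx => e0.
  apply/eqP; rewrite -leqn0 -(mxrank1 K (rdim Y)) -(inr_snd X Y) -e0 mul0mx mxrank0.
  by [].
left; have ek n : h ^+ n.+1 *m teta P = teta P *m e.
  elim: n => [|n IH]; first by rewrite expr1.
  by rewrite exprS -mulmxA IH mulmxA hE -mulmxA ee.
have e0 : e = 0.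
  apply: (row_full_canl (@teta_full P)); rewrite mulmx0 -(ek k) exprS hk.
  by rewrite mulr0 mul0mx.
have : inl_mx X Y *m g *m e *m f = inl_mx X Y.
  rewrite /e !mulmxA -(mulmxA _ g f) gf mulmx1 -(mulmxA _ g f) gf mulmx1.
  by rewrite inl_fst mul1mx.
rewrite e0 mulmx0 mul0mx => i0.
by apply/eqP; rewrite -leqn0 -(mxrank1 K (rdim X)) -(inl_fst X Y) -i0 mul0mx mxrank0.
Qed.

Lemma proj_ind_reg (R : fdalg K) (P : rmod R) :
  indecomposable P -> projective_mod P -> retract P (reg R).
Proof. by move=> indP /proj_in_add/(in_add_indec _ indP). Qed.

(** P |-> P (x) A/I maps the indecomposable projectives P of A with
P (x) A/I <> 0 bijectively to those of A/I, and Hom(P, N) = Hom(P (x) A/I, N) for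
a module N over A/I. *)
Lemma res_ncard_supp (N : rmod B) : ncard (suppset (rs N)) = ncard (suppset N).
Proof.
apply: (@ncard_bij _ _ _ _ (fun c : isoclass A => cls (tens (repr c)))).
  exact: finite_suppset.
have tdim P (X : rmod B) : ~ hom_zero P (rs X) -> (0 < rdim (tens P))%N.
  move=> nz; rewrite lt0n; apply/eqP => T0; apply: nz.
  by apply/tensor_hom_zero/hom_zero_dim0.
split.
- move=> c; rewrite -[c]clsK => /suppsetP[indc rc nz] /=; rewrite clsK.
  have prc := proj_retract rc (@proj_reg _ _).
  have indt : indecomposable (tens (repr c)) by apply: tensor_indec (tdim _ _ nz).
  apply/suppsetP; split=> //; last by move/tensor_hom_zero.
  by apply: proj_ind_reg indt _; apply: tensor_proj.
- move=> c d; rewrite !inE => /suppset_repr[indc rc nzc] /suppset_repr[indd rd nzd].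
  move=> /clsP/isoP[f [g [hf hg fg gf]]].
  have prc := proj_retract rc (@proj_reg _ _); have prd := proj_retract rd (@proj_reg _ _).
  set P := repr c in indc rc nzc f g hf hg fg gf prc *.
  set P' := repr d in indd rd nzd f g hf hg fg gf prd *.
  have [u hu uE] := projP prc (teta_hom P') (@teta_full P') (ishomM (teta_hom P) ((res_hom _).2 hf)).
  have [v hv vE] := projP prd (teta_hom P) (@teta_full P) (ishomM (teta_hom P') ((res_hom _).2 hg)).
  have uv : u *m v \in unitmx.
    apply: (indec_fixr indc (ishomM hu hv) (m := teta P)).
      by rewrite -mulmxA vE mulmxA uE -mulmxA fg mulmx1.
    apply/eqP => t0; have := tdim _ _ nzc; have /eqP := @teta_full P.
    by rewrite t0 mxrank0 => <-.
  rewrite -[c]clsK -[d]clsK; apply/clsP; apply: retract_indec => //.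
  exact: unit_retract hu hv uv.
- move=> c; rewrite -[c]clsK => /suppsetP[]; set T := repr c => indT rT nzT.
  have prT := proj_retract rT (@proj_reg _ _).
  have [P [p [prP hp fp _]]] := proj_cover (rs T).
  have rTP : retract T (tens P).
    have [g hg gE] := tetaP hp.
    have fg : row_full g by apply: (@row_full_mull _ _ _ _ (teta P)); rewrite gE.
    by have [s hs sg] := projP prT hg fg (@ishom1 _ _ T); exists s, g.
  have [s [inds iP]] := indec_decomp P.
  have [Y sY rTY] : exists2 Y, Y \in s & retract T (tens Y).
    have {rTP} : retract T (tens (bigdsum s)) := retract_trans rTP (iso_retract (tensor_iso iP)).
    elim: s {inds iP} => [|Y s IH] rs.
      have : rdim (tens (bigdsum [::])) = 0%N.
        by apply/eqP; rewrite -leqn0; apply: leq_trans (tensor_dim _) _.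
      by move/(indec_not_retract0 indT) => /(_ rs).
    case/(indec_dsum indT): (retract_isor (tensor_dsum _ _) rs) => [rY|/IH[Z sZ rZ]].
      by exists Y; rewrite // inE eqxx.
    by exists Z; rewrite // inE sZ orbT.
  have indY := inds _ sY.
  have prY : projective_mod Y.
    by apply: proj_retract prP; apply: retract_isor (iso_sym iP) (mem_bigdsum sY).
  have T0 : (0 < rdim (tens Y))%N.
    by have [T0 _] := indT; apply: leq_trans T0 (retract_dim rTY).
  have iTY : iso T (tens Y) by apply: retract_indec rTY => //; apply: tensor_indec.
  exists (cls Y).
    apply/suppsetP; split=> //; first exact: proj_ind_reg.
    by move=> /tensor_hom_zero z; apply: nzT; apply: hom_zero_isol (iso_sym iTY) z.
  apply/clsP; apply: iso_trans _ (iso_sym iTY); exact/tensor_iso/repr_cls.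
Qed.

End Tensor.

(** * Support tau-tilting modules without the translate *)

Section Criterion.
Variables (K : fieldType).

Section Generalities.
Variables (A : fdalg K).
Implicit Types M N P X Y Z C E G U V W : rmod A.

Lemma nsummands_iso M N : iso M N -> nsummands M = nsummands N.
Proof.
move=> i; rewrite !nsummandsE; congr ncard; apply/seteqP; split; apply: indset_sub => X _.
  exact: retract_isor i.
exact/retract_isor/iso_sym.
Qed.

Lemma suppset_sub M N : (forall P, projective_mod P -> hom_zero P N -> hom_zero P M) ->
  suppset M `<=` suppset N.
Proof.
move=> H c; rewrite -[c]clsK => /suppsetP[indc rc nz]; apply/suppsetP; split=> //.
by apply: contra_not nz; apply: H; apply: proj_retract rc (@proj_reg _ _).
Qed.

Lemma suppset_fac M N : fac N M -> suppset M `<=` suppset N.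
Proof. by move=> NM; apply: suppset_sub => P prP; apply: proj_nohom. Qed.

Lemma suppset_iso M N : iso M N -> suppset M = suppset N.
Proof.
by move=> i; apply/seteqP; split; apply/suppset_fac/fac_retract/iso_retract => //; apply: iso_sym.
Qed.

Lemma ext0_iso (cl : rmod A -> Prop) M N : iso M N -> ext0 cl M M -> ext0 cl N N.
Proof.
move=> i H; apply: (@ext0_retract _ _ _ _ M); first exact/iso_retract/iso_sym.
by apply: ext0_fac H; apply/fac_retract/iso_retract/iso_sym.
Qed.

Lemma nsummands_reg : nsummands (reg A) = ncard (suppset (reg A)).
Proof.
rewrite nsummandsE; congr ncard; apply/seteqP; split; last exact: suppset_reg.
move=> c; rewrite -[c]clsK => /indsetP[indc rc]; apply/suppsetP; split=> //.
case: rc => i [p [hi hp ip]] /hom_zeroP/(_ _ hi) i0.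
have [d0 _] := indc; move: d0; rewrite lt0n => /eqP; apply.
by apply/eqP; rewrite -leqn0 -(mxrank1 K (rdim _)) -ip i0 mul0mx mxrank0.
Qed.

Lemma killed_gen (S : set A) M : (forall s, S s -> M s = 0) -> killed (genideal S) M.
Proof.
move=> S0; have lM : linear (ract M) by move=> k x y; apply: ract_lin.
pose fL := GRing.isSemilinear.Build _ _ _ _ _ (GRing.semilinear_linear lM).
pose g : {linear A -> 'M[K]_(rdim M)} := HB.pack (ract M) fL.
have sub : (genideal S <= lker (linfun g))%VS.
  apply: vspan_min => _ [a [x [b [Sx ->]]]]; rewrite memv_ker lfunE /=.
  by rewrite !ractM (S0 x) // mulmx0 mul0mx.
by move=> a /(subvP sub); rewrite memv_ker lfunE => /eqP.
Qed.

Lemma killed_mem (S : set A) M s : killed (genideal S) M -> S s -> M s = 0.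
Proof. by move=> kM Ss; apply: kM; apply: genideal_in. Qed.

(** For an idempotent e, an extension of two modules killed by e is killed by
e = e ** e. *)
Lemma ext0_idem (e : A) M : fdmul e e = e -> killed (genideal [set e]) M ->
  ext0 (killed (genideal [set e])) M M -> ext0 allmod M M.
Proof.
move=> ee kM H; apply: ext0_section => // E G p q _ hp hq fq pq MG.
have kG := killed_fac MG kM.
have Me : M e = 0 by apply: killed_mem kM _.
have Ge : G e = 0 by apply: killed_mem kG _.
apply: (H E M G p q 1%:M) => //; last exact: ishom1.
apply: killed_gen => _ ->.
have : (E e <= p)%MS by rewrite pq; apply/sub_kermxP; rewrite hq Me mulmx0.
case/submxP=> t tE; rewrite -ee ractM {1}tE -mulmxA -hp Ge mul0mx mulmx0.
by [].
Qed.

(** The projection of A onto X is the idempotent which cuts out the quotient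
algebra over which M is tau-tilting. *)
Lemma reg_split M : exists X Y, [/\ iso (reg A) (dsum X Y), hom_zero X M &
  forall P, indecomposable P -> retract P Y -> suppset M (cls P)].
Proof.
have [s [inds iA]] := indec_decomp (reg A).
have regs P : P \in s -> retract P (reg A).
  by move=> sP; apply: retract_isor (iso_sym iA) (mem_bigdsum sP).
suff [X [Y [i z HY]]] : exists X Y, [/\ iso (bigdsum s) (dsum X Y), hom_zero X M &
    forall P, indecomposable P -> retract P Y -> suppset M (cls P)].
  by exists X, Y; split=> //; apply: iso_trans i.
elim: s inds regs {iA} => [_ _|P s IH inds regs].
  exists (rmod0 A), (rmod0 A); split.
  - exact/iso_sym/dsum0.
  - exact: hom_zero_dim0.
  - by move=> P indP /(indec_not_retract0 indP)[].
have [||X [Y [i z HY]]] := IH.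
- by move=> Q sQ; apply: inds; rewrite inE sQ orbT.
- by move=> Q sQ; apply: regs; rewrite inE sQ orbT.
have Ps : P \in P :: s by rewrite inE eqxx.
case: (pselect (suppset M (cls P))) => sP.
  exists X, (dsum P Y); split=> //=.
    apply: iso_trans (iso_dsum (iso_refl P) i) _; exact: dsumCA.
  move=> R indR /(indec_dsum indR)[rP|]; last exact: HY.
  have /clsP -> // : iso R P by apply: retract_indec rP => //; apply: inds.
exists (dsum P X), Y; split=> //=.
  apply: iso_trans (iso_dsum (iso_refl P) i) _; exact: dsumA.
have /hom_zeroP zP : hom_zero P M.
  apply: contrapT => nz; apply: sP; apply/suppsetP; split=> //; first exact: inds.
  exact: regs.
move/hom_zeroP: z => z; apply/hom_zeroP => f hf.
rewrite [f]dsum_colE (zP _ (ishomM (inl_hom _ _) hf)) (z _ (ishomM (inr_hom _ _) hf)).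
exact: col_mx0.
Qed.

End Generalities.

Variables (A : fdalg K).

(** If M is tau-tilting over A modulo the ideal of e, the number of its summands
is the number of indecomposable projectives over that quotient; all of the
support of M is among them, and nsummands_le_supp leaves no room for more.
Conversely, the projection of A onto its summand without maps to M is the left
multiplication by an idempotent e, and the indecomposable projectives over the
quotient are exactly those in the support. *)
Theorem support_tau_tiltingP (M : rmod A) : support_tau_tilting M <->
  ext0 allmod M M /\ nsummands M = ncard (suppset M).
Proof.
split=> [[e [N [ee [rig cnt] iM]]]|[eM cM]].
  have eM : ext0 allmod M M.
    apply: (ext0_iso (iso_sym iM)); apply: (ext0_idem ee); first exact: killed_res.
    by apply/res_ext0; apply/tau_rigidP.
  split=> //; apply/eqP; rewrite eqn_leq nsummands_le_supp //=.
  rewrite (nsummands_iso iM) res_nsummands cnt nsummands_reg -res_ncard_supp.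
  apply: ncard_le; first exact: finite_suppset.
  rewrite (suppset_iso iM); apply: suppset_fac; apply/res_fac; exact: fac_reg.
have [X [Y [iA zX HY]]] := reg_split M.
have /isoP[f [g [hf hg fg gf]]] := iA.
pose eps := f *m fst_mx X Y *m inl_mx X Y *m g.
have heps : ishom (reg A) (reg A) eps.
  by apply: ishomM hg; apply: ishomM (inl_hom _ _); apply: ishomM hf (fst_hom _ _).
have eps2 : eps *m eps = eps.
  rewrite /eps !mulmxA -(mulmxA _ g f) gf mulmx1 -(mulmxA _ (inl_mx X Y) (fst_mx X Y)).
  by rewrite inl_fst mulmx1.
(* Endomorphisms of A are left multiplications by the image of 1. *)
pose v : 'rV[K]_(dim A) := v2r (fdone A) *m eps.
pose e : A := r2v v.
have epsE : eps = regmap (M := reg A) v := regmapP heps.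
have ve : v *m eps = v by rewrite /v -mulmxA eps2.
have ee : fdmul e e = e.
  apply: (can_inj v2rK); rewrite [RHS]r2vK; apply: etrans _ ve; rewrite epsE.
  by apply/esym; apply: etrans (mul_regmap (M := reg A) _ _) _; apply: mul_rmul_mx.
have epsM (N : rmod A) (x : 'rV_(rdim N)) : N e = 0 -> eps *m regmap x = 0.
  move=> Ne; rewrite epsE (regmap_comp _ (regmap_hom x)) [v *m _]mul_regmap -/e Ne.
  rewrite mulmx0; apply/row_matrixP => i.
  by rewrite rowE mul_regmap mul0mx row0.
have Me : M e = 0.
  apply/row_matrixP => i; rewrite rowE row0 -mul_regmap /v -mulmxA.
  move/hom_zeroP: zX => zX; rewrite /eps -!mulmxA.
  rewrite (mulmxA (inl_mx X Y)) (zX (inl_mx X Y *m g *m _)).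
    by rewrite !mulmx0.
  apply: ishomM (regmap_hom _); exact: ishomM (inl_hom _ _) hg.
have kM : killed (genideal [set e]) M by apply: killed_gen => _ ->.
have [N NE] := killedE kM; exists e, N; split=> //; last by rewrite NE; apply: iso_refl.
split.
  by apply/tau_rigidP/res_ext0; rewrite -NE; apply: ext0_cl eM.
rewrite -res_nsummands -NE cM nsummands_reg -res_ncard_supp; congr ncard.
apply/seteqP; split.
  by rewrite NE; apply: suppset_fac; apply/res_fac; apply: fac_reg.
set R := res _ _; move=> c; rewrite -[c]clsK => /suppsetP[indc rc nz].
have Re : R e = 0 by apply: killed_mem (@killed_res _ _ _ _) _.
case/(indec_dsum indc): (retract_isor iA rc) => [[i [p [hi hp ip]]]|rY]; last exact: HY.
case: nz; apply/hom_zeroP => h hh.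
have hph : ishom (reg A) R (f *m fst_mx X Y *m p *m h).
  by apply: ishomM hh; apply: ishomM hp; apply: ishomM hf (fst_hom _ _).
have hE : h = i *m inl_mx X Y *m g *m (f *m fst_mx X Y *m p *m h).
  by rewrite !mulmxA -(mulmxA _ g f) gf mulmx1 -(mulmxA i) inl_fst mulmx1 ip mul1mx.
rewrite hE (regmapP hph); set w := _ *m (f *m _ *m _ *m _).
have -> : i *m inl_mx X Y *m g = i *m inl_mx X Y *m g *m eps.
  rewrite /eps !mulmxA -(mulmxA _ g f) gf mulmx1 -(mulmxA i (inl_mx X Y) (fst_mx X Y)).
  by rewrite inl_fst mulmx1.
by rewrite -mulmxA epsM // mulmx0.
Qed.

End Criterion.

(** * The socle of an indecomposable injective module *)

Section Socle.
Variables (K : fieldType) (A : fdalg K) (X : rmod A).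
Hypotheses (indX : indecomposable X) (injX : injective_mod X).

(** The projection of U + V to U extends to an endomorphism of X, which fixes U
and kills V. *)
Lemma inj_uniform k l (U : 'M[K]_(k, rdim X)) (V : 'M_(l, rdim X)) :
  (forall a, (U *m X a <= U)%MS) -> (forall a, (V *m X a <= V)%MS) ->
  U != 0 -> V != 0 -> (U :&: V)%MS != 0.
Proof.
move=> stU stV U0 V0; apply/eqP => UV0.
have [Y [i [hi fi iE]]] := sub_ex stU; have [Z [j [hj fj jE]]] := sub_ex stV.
have fij : row_free (col_mx i j : 'M_(rdim (dsum Y Z), _)).
  rewrite -kermx_eq0; apply/eqP; set W := kermx _.
  have : W *m col_mx i j = 0 by apply: mulmx_ker.
  rewrite [W](@dsum_rowE _ _ Y Z); set a := W *m fst_mx _ _; set b := W *m snd_mx _ _.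
  rewrite mul_row_col => /eqP; rewrite addr_eq0 => /eqP ab.
  have : (a *m i <= U :&: V)%MS.
    by rewrite sub_capmx -iE submxMl ab -jE eqmx_opp submxMl.
  rewrite UV0 submx0 => /eqP ai.
  have a0 : a = 0 by apply: (row_free_canr fi); rewrite mul0mx.
  have b0 : b = 0.
    apply: (row_free_canr fj); rewrite mul0mx.
    by apply/eqP; rewrite -oppr_eq0 -ab ai.
  by rewrite a0 b0 row_mx0.
have [h hh hE] := injP injX (ishom_col hi hj) fij (ishom_col hi (@ishom0 _ _ Z X)).
have [ih jh] : i *m h = i /\ j *m h = 0.
  by move: hE; rewrite mul_col_mx => /eq_col_mx.
have nz m1 m2 (r : 'M[K]_(m1, rdim X)) (T : 'M_(m2, rdim X)) :
    (r :=: T)%MS -> T != 0 -> r != 0.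
  by move=> rT; apply: contra_neq => r0; apply/eqP; rewrite -submx0 -rT r0 sub0mx.
have uh : h \in unitmx by apply: (indec_fixl indX hh ih); apply: nz iE U0.
case/negP: (nz _ _ _ _ jE V0); apply/eqP.
by rewrite -[j]mulmx1 -(mulmxV uh) mulmxA jh mul0mx.
Qed.

(** By uniformity, a nonzero submodule of minimal rank is contained in all
nonzero submodules, and it is the only simple one. *)
Lemma soc_least : soc_mx X != 0 /\ forall k (U : 'M[K]_(k, rdim X)),
  (forall a, (U *m X a <= U)%MS) -> U != 0 -> (soc_mx X <= U)%MS.
Proof.
pose good n := `[< exists U : 'M[K]_(rdim X),
  [/\ forall a, (U *m X a <= U)%MS, U != 0 & \rank U = n] >].
have ex : exists n, good n.
  exists (\rank (1%:M : 'M[K]_(rdim X))); apply/asboolP; exists 1%:M; split=> // [a|].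
    exact: submx1.
  by have [X0 _] := indX; rewrite -mxrank_eq0 mxrank1 -lt0n.
case: (ex_minnP ex) => n /asboolP[U0 [stU0 nzU0 rU0]] minU.
have least k (U : 'M[K]_(k, rdim X)) : (forall a, (U *m X a <= U)%MS) -> U != 0 -> (U0 <= U)%MS.
  move=> stU nzU; have nz := inj_uniform stU0 stU nzU0 nzU.
  have : (n <= \rank (U0 :&: U)%MS)%N.
    apply: minU; apply/asboolP; exists (U0 :&: U)%MS; split=> // a.
    rewrite sub_capmx (submx_trans _ (stU0 a)) ?(submx_trans _ (stU a)) //.
      by apply: submxMr; apply: capmxSr.
    by apply: submxMr; apply: capmxSl.
  rewrite -rU0 => le; have : (U0 <= U0 :&: U)%MS.
    by rewrite -(geq_leqif (mxrank_leqif_sup (capmxSl U0 U))).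
  by rewrite sub_capmx => /andP[].
have socU0 : (soc_mx X <= U0)%MS.
  apply: mxspan_min => v [U [[U_gt0 simU] vU]]; apply: submx_trans vU _.
  have U0U : (U0 <= U)%MS.
    by apply: least; [exact: submoduleP|rewrite -mxrank_eq0 -lt0n].
  have inK : val_submod (in_submod U U0) = U0 by apply: in_submodK.
  have stW a : (<<in_submod U U0>>%MS *m submod U a <= <<in_submod U U0>>%MS)%MS.
    rewrite (eqmxMr _ (genmxE _)) genmxE.
    have -> : in_submod U U0 *m submod U a = in_submod U (U0 *m X a).
      apply: (can_inj val_submodK); rewrite (submod_val (U := U)) inK in_submodK //.
      exact: submx_trans (stU0 a) U0U.
    by case/submxP: (stU0 a) => D ->; rewrite in_submodE -mulmxA -in_submodE submxMl.
  case: (simU (@Submodule K A (submod U) _ stW)) => /= [g0|].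
    have in0 : in_submod U U0 = 0 by apply/eqP; rewrite -submx0 -g0 genmxE.
    case/negP: nzU0.
    by rewrite -inK in0; apply/eqP; rewrite val_submodE mul0mx.
  rewrite /row_full genmxE -/(row_full _) -sub1mx => /submxP[D DE].
  rewrite -(val_submod1 U) DE val_submodE -mulmxA -val_submodE inK; exact: submxMl.
have U0soc : (U0 <= soc_mx X)%MS.
  apply/row_subP => i; apply: mxspan_in; exists (Submodule stU0); split; last exact: row_sub.
  split=> /= [|W]; first by rewrite lt0n mxrank_eq0.
  case: (eqVneq (W : 'M_(_, _)) 0) => [->|nzW]; [by left|right].
  have stW a : (val_submod W *m X a <= val_submod W)%MS.
    rewrite -(submod_val (U := Submodule stU0)).
    by case/submxP: (submoduleP W a) => D DE; rewrite [W *m _]DE val_submodE -mulmxA -val_submodE submxMl.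
  have rW : \rank (val_submod W) = \rank W by rewrite val_submodE mxrankMfree // /row_free val_submod1.
  have nzvW : val_submod W != 0 by rewrite -mxrank_eq0 rW mxrank_eq0.
  by have /mxrankS := least _ _ stW nzvW; rewrite rW col_leq_rank.
split.
  by apply: contra_neq nzU0 => s0; apply/eqP; rewrite -submx0 -s0.
by move=> k U stU nzU; apply: submx_trans socU0 (least _ _ stU nzU).
Qed.

End Socle.

(** * An indecomposable projective-injective module *)

Section ProjectiveInjective.
Variables (K : fieldType) (A : fdalg K) (Q : submodule (reg A)).
Hypotheses (indQ : indecomposable (Qmod Q)) (prQ : projective_mod (Qmod Q))
  (inQ : injective_mod (Qmod Q)).
Implicit Types M N P X Y Z C E G U V W : rmod A.

Local Notation Qm := (Qmod Q).
Local Notation Qb := (Qbar Q).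
Local Notation S := (soc_mx Qm).
Local Notation I := (genideal (socQ Q)).
Local Notation kld := (killed I).

Definition Qincl : 'M[K]_(rdim Qm, rdim (reg A)) := val_submod (1%:M : 'M_(\rank Q)).
Lemma Qincl_hom : ishom Qm (reg A) Qincl.
Proof.
move=> a; rewrite /Qincl -val_submodE -[X in val_submod X]mul1mx.
by rewrite (submod_val (U := Q)).
Qed.
Lemma Qincl_free : row_free Qincl.
Proof. by rewrite /row_free val_submod1. Qed.

Lemma S_neq0 : S != 0.
Proof. by have [] := soc_least indQ inQ. Qed.
Lemma S_least k (U : 'M[K]_(k, rdim Qm)) :
  (forall a, (U *m Qm a <= U)%MS) -> U != 0 -> (S <= U)%MS.
Proof. by have [_] := soc_least indQ inQ; apply. Qed.

Lemma ker_hom_stable M N f : ishom M N f -> forall a, (kermx f *m M a <= kermx f)%MS.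
Proof. by move=> hf a; apply/sub_kermxP; rewrite -mulmxA hf mulmxA mulmx_ker mul0mx. Qed.

Lemma S_ker N h : ishom Qm N h -> S *m h != 0 -> row_free h.
Proof.
move=> hh nz; rewrite -kermx_eq0; apply/contraT => k0; case/negP: nz.
by apply/eqP/sub_kermxP/S_least => //; apply: ker_hom_stable hh.
Qed.

Lemma S_im M u : ishom M Qm u -> u != 0 -> (S <= u)%MS.
Proof. by move=> hu; apply: S_least => a; rewrite -hu submxMl. Qed.

(** An endomorphism of Q either kills S or is injective; in the second case the
image of S is a nonzero submodule, so it contains S, and the dimensions agree. *)
Lemma S_endo h : ishom Qm Qm h -> (S *m h <= S)%MS.
Proof.
move=> hh; case: (eqVneq (S *m h) 0) => [->|nz]; first exact: sub0mx.
have le : (S <= S *m h)%MS.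
  apply: S_least => // a; rewrite -mulmxA -hh mulmxA.
  by apply: submxMr; apply: (@soc_stable _ _ Qm).
by rewrite -(geq_leqif (mxrank_leqif_sup le)) mxrankM_maxl.
Qed.

Lemma socQP (s : A) : socQ Q s <-> exists t : 'rV_(rdim Qm), (t <= S)%MS /\ v2r s = t *m Qincl.
Proof.
have e : (val_submod S :=: S *m Qincl)%MS by rewrite [val_submod S]val_submodE.
split=> [|[t [tS sE]]]; rewrite /socQ /=; last first.
  by rewrite [val_submod _]val_submodE sE submxMr.
rewrite [val_submod _]val_submodE => /submxP[D ->]; exists (D *m S).
by rewrite submxMl mulmxA.
Qed.

Lemma socQ_act X (x : 'rV_(rdim X)) (s : A) (t : 'rV_(rdim Qm)) : v2r s = t *m Qincl ->
  x *m X s = t *m (Qincl *m regmap x).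
Proof. by move=> sE; rewrite mulmxA -sE mul_regmap v2rK. Qed.

Lemma Qmono X (x : 'rV_(rdim X)) : ishom Qm X (Qincl *m regmap x).
Proof. exact: ishomM Qincl_hom (regmap_hom x). Qed.

(** If x s <> 0 for some s in S, then the map from Q to X given by x does not
kill S, hence it is injective. *)
Lemma Q_embeds X : ~ kld X -> exists g, ishom Qm X g /\ row_free g.
Proof.
move=> nk; have [s ss nz] : exists2 s, socQ Q s & X s != 0.
  apply: contrapT => H; apply: nk; apply: killed_gen => s ss.
  by apply/eqP; apply: contrapT => /negP nz; apply: H; exists s.
have [t [tS sE]] := (socQP s).1 ss.
have /row_subPn[i] : ~~ (X s <= (0 : 'M_(rdim X)))%MS by rewrite submx0.
rewrite submx0 rowE => nzi; exists (Qincl *m regmap (delta_mx 0 i)); split; first exact: Qmono.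
apply: S_ker; first exact: Qmono.
apply: contra nzi => /eqP S0; rewrite (socQ_act _ sE).
by case/submxP: tS => D ->; rewrite -mulmxA S0 mulmx0.
Qed.

Lemma embed_split X g : ishom Qm X g -> row_free g ->
  exists2 r, ishom X Qm r & g *m r = 1%:M.
Proof. by move=> hg fg; have [r hr rE] := injP inQ hg fg (@ishom1 _ _ Qm); exists r. Qed.

Lemma Q_retract X : ~ kld X -> retract Qm X.
Proof.
case/Q_embeds=> g [hg fg]; have [r hr gr] := embed_split hg fg.
by exists g, r.
Qed.

(** Let r : A -> Q be a retraction of the inclusion, and let s in A be the value
of t in S. Then t = r(s) = r(1) s, and s acts on N by zero. *)
Lemma killed_S N h : kld N -> ishom Qm N h -> S *m h = 0.
Proof.
move=> kN hh; have [r hr jr] := embed_split Qincl_hom Qincl_free.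
apply/row_matrixP => i; rewrite row0 row_mul.
set t := row i S; have tS : (t <= S)%MS by apply: row_sub.
pose s : A := r2v (t *m Qincl : 'rV_(dim A)).
have ss : socQ Q s by apply/socQP; exists t; rewrite r2vK.
have hrh : ishom (reg A) N (r *m h) by apply: ishomM.
rewrite -[t]mulmx1 -jr -(mulmxA t) -(mulmxA Qincl).
have -> : t *m (Qincl *m (r *m h)) = t *m Qincl *m regmap (v2r (fdone A) *m (r *m h)).
  by rewrite -(regmapP hrh) mulmxA.
by rewrite mul_regmap [N _](kN _ (genideal_in ss)) mulmx0.
Qed.

Lemma Q_not_killed : ~ kld Qm.
Proof.
move=> kQ; case/negP: S_neq0; apply/eqP.
by have := killed_S kQ (@ishom1 _ _ Qm); rewrite mulmx1.
Qed.

Lemma not_retract_killed X : kld X -> ~ retract Qm X.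
Proof. by move=> kX r; apply: Q_not_killed; apply: killed_retract r kX. Qed.

Definition Qpi : 'M[K]_(rdim Qm, rdim Qb) := in_factmod (soc Qm) 1%:M.
Lemma Qpi_hom : ishom Qm Qb Qpi.
Proof.
move=> a; rewrite /Qpi -in_factmodE -[in LHS](mul1mx (Qm a)).
by rewrite -(factmod_in (soc Qm)).
Qed.
Lemma Qpi_full : row_full Qpi.
Proof. by apply/row_fullP; exists (val_factmod 1%:M); rewrite -in_factmodE val_factmodK. Qed.
Lemma Qpi_ker k (U : 'M_(k, rdim Qm)) : (U *m Qpi == 0) = (U <= S)%MS.
Proof. by rewrite -in_factmodE in_factmod_eq0. Qed.
Lemma Qpi_kermx : (kermx Qpi <= S)%MS.
Proof. by rewrite -Qpi_ker mulmx_ker. Qed.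

Lemma Qbar_killed : kld Qb.
Proof.
apply: killed_gen => s /socQP[t [tS sE]]; apply: (row_full_canl Qpi_full).
rewrite mulmx0 -Qpi_hom; apply/eqP; rewrite Qpi_ker.
apply/row_subP => i; rewrite rowE (socQ_act _ sE).
apply: submx_trans (submxMr _ tS) _; apply: S_endo; exact: Qmono.
Qed.

Lemma Qpi_univ N h : kld N -> ishom Qm N h -> exists2 h', ishom Qb N h' & Qpi *m h' = h.
Proof.
move=> kN hh; apply: (factor_surj hh Qpi_hom Qpi_full).
by apply: submx_trans Qpi_kermx _; apply/sub_kermxP/killed_S.
Qed.

Lemma Qbar_indec : (0 < rdim Qb)%N -> indecomposable Qb.
Proof.
have [Qb' QbE] := killedE Qbar_killed => Q0.
have i : iso (tensor (quo_mor I) Qm) Qb'.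
  have hpi : ishom Qm (res (quo_mor I) Qb') (castmx (erefl, congr1 (@rdim _ _) QbE) Qpi).
    by move: Qpi_hom; case: _ / QbE.
  apply: tensor_eq hpi _ _; first by move: Qpi_full; case: _ / QbE.
  move=> N' h' hh'; have [h'' hh'' hE] := Qpi_univ (@killed_res _ _ _ N') hh'.
  apply/sub_kermxP; rewrite -hE mulmxA.
  have -> : kermx (castmx (erefl, congr1 (@rdim _ _) QbE) Qpi) *m Qpi = 0.
    by case: _ / QbE => /=; rewrite castmx_id mulmx_ker.
  by rewrite mul0mx.
rewrite QbE; apply/res_indec; apply: (indec_iso i); apply: tensor_indec => //.
by rewrite (iso_dim i); move: Q0; rewrite QbE.
Qed.

(** Qbar is projective among the modules over A/I: a lift of Q -> Qbar to a map
Q -> C kills S. *)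
Lemma Qbar_split C w : kld C -> ishom C Qb w -> row_full w -> retract Qb C.
Proof.
move=> kC hw fw; have [u hu uw] := projP prQ hw fw Qpi_hom.
have [u' hu' uE] := Qpi_univ kC hu; exists u', w; split=> //.
by apply: (row_full_canl Qpi_full); rewrite mulmxA uE uw mulmx1.
Qed.

Lemma retract_Qbar_dsum C : retract Qb (dsum Qm C) <-> retract Qb C.
Proof.
split=> r; last exact: retract_trans r (retract_inr _ _).
case: (posnP (rdim Qb)) => [|Q0]; first exact: retract0.
have indb := Qbar_indec Q0; case/(indec_dsum indb): r => // r.
case: Q_not_killed; apply: killed_retract Qbar_killed.
exact/iso_retract/iso_sym/retract_indec.
Qed.

(** An extension E of modules over A/I which is not itself a module over A/I
contains Q, and a retraction E -> Q restricts to a map u on the subobject. It is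
nonzero because S, which C kills, lies in the subobject; it is not surjective
because A/I-modules do not map onto Q. *)
Lemma nonkilled_ext E G C p q : ishom G E p -> ishom E C q -> row_full q ->
  (p :=: kermx q)%MS -> kld G -> kld C -> ~ kld E ->
  exists u Y k w, [/\ ishom G Qm u, u != 0, ishom Qm Y k & row_full k] /\
   [/\ (kermx k :=: u)%MS, ishom C Y w, row_full w & (0 < rdim Y)%N].
Proof.
move=> hp hq fq pq kG kC nkE; have [g [hg fg]] := Q_embeds nkE.
have [r hr gr] := embed_split hg fg.
pose u := p *m r; have hu : ishom G Qm u by apply: ishomM.
have u0 : u != 0.
  apply/eqP => u0; case/negP: S_neq0; apply/eqP.
  have : (S *m g <= p)%MS.
    by rewrite pq; apply/sub_kermxP; rewrite -mulmxA; apply: killed_S => //; apply: ishomM.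
  case/submxP=> D DE; rewrite -[LHS]mulmx1 -gr mulmxA DE -mulmxA -/u u0; exact: mulmx0.
have [Y [k [hk fk kE]]] := coker_ex hu.
have [|w hw wE] := factor_surj (ishomM hr hk) hq fq.
  by rewrite -pq; apply/sub_kermxP; rewrite mulmxA; apply/sub_kermxP; rewrite kE.
exists u, Y, k, w; split=> //; split=> //.
  apply: (@row_full_mull _ _ _ _ q); rewrite wE row_fullM //.
  by apply/row_fullP; exists g.
rewrite lt0n; apply/eqP => Y0; apply: Q_not_killed; apply: killed_surj hu _ kG.
rewrite -sub1mx -kE; apply/sub_kermxP; apply/matrixP => i j.
by move: (ltn_ord j); rewrite {2}Y0.
Qed.

(** The cokernel Y of a nonzero map to Q is a quotient of Qbar, since the image
contains S. *)
Lemma coker_Qbar G u Y k : ishom G Qm u -> u != 0 -> ishom Qm Y k -> row_full k ->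
  (kermx k :=: u)%MS -> exists k', [/\ ishom Qb Y k', row_full k', Qpi *m k' = k &
    (u *m Qpi :=: kermx k')%MS].
Proof.
move=> hu u0 hk fk kE.
have [|k' hk' k'E] := factor_surj hk Qpi_hom Qpi_full.
  by apply: submx_trans Qpi_kermx _; rewrite kE; apply: S_im.
exists k'; split=> //; first by apply: (@row_full_mull _ _ _ _ Qpi); rewrite k'E.
apply/eqmxP/andP; split.
  by apply/sub_kermxP; rewrite -mulmxA k'E; apply/sub_kermxP; rewrite kE.
have /row_fullP[B B1] := Qpi_full.
have : (kermx k' *m B <= u)%MS.
  rewrite -kE; apply/sub_kermxP; rewrite -k'E mulmxA -(mulmxA _ B) B1 mulmx1.
  exact: mulmx_ker.
by move/(submxMr Qpi); rewrite -mulmxA B1 mulmx1.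
Qed.

(** An extension E over A that is not one over A/I gives C -> Y onto a proper
quotient of Q. Over A/I this map lifts along Qbar -> Y, whose kernel is generated
by N, and the lift is onto because Qbar is local. *)
Lemma ext0_lift C N : kld N -> kld C -> ext0 kld C N ->
  ~ retract Qb C \/ hom_zero N Qm -> ext0 allmod C N.
Proof.
move=> kN kC H alt; apply: ext0_section => // E G p q _ hp hq fq pq NG.
have kG := killed_fac NG kN.
case: (pselect (kld E)) => [kE|nkE].
  exact: H kE hp hq fq pq NG (@ishom1 _ _ C).
have [u [Y [k [w [[hu u0 hk fk] [kE hw fw Y0]]]]]] := nonkilled_ext hp hq fq pq kG kC nkE.
case: alt => [nr|z]; last first.
  by case/negP: u0; apply/eqP; move/(fac_nohom NG)/hom_zeroP: z; apply.
case: nr; have [k' [hk' fk' k'E upi]] := coker_Qbar hu u0 hk fk kE.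
have [l hl lE] := H _ _ _ _ _ _ Qbar_killed (ishomM hu Qpi_hom) hk' fk' upi NG hw.
apply: (Qbar_split kC hl); apply: (indec_proj_local indQ prQ Qpi_hom Qpi_full hk' fk' Y0 hl).
by rewrite lE.
Qed.

Definition diagpi C : 'M[K]_(rdim (dsum Qm C), rdim (dsum Qb C)) :=
  col_mx (Qpi *m inl_mx Qb C) (inr_mx Qb C).
Lemma diagpi_hom C : ishom (dsum Qm C) (dsum Qb C) (diagpi C).
Proof.
by apply: ishom_col; [apply: ishomM Qpi_hom (inl_hom _ _)|apply: inr_hom].
Qed.
Lemma diagpi_full C : row_full (diagpi C).
Proof.
have /row_fullP[B B1] := Qpi_full.
apply/row_fullP; exists (col_mx (B *m inl_mx Qm C) (inr_mx Qm C)).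
rewrite mul_col_mx -mulmxA inl_col mulmxA B1 mul1mx inr_col [RHS](@dsum_colE _ _ Qb C).
by rewrite !mulmx1.
Qed.
Lemma diagpi_univ C N h : kld N -> ishom (dsum Qm C) N h ->
  exists2 h', ishom (dsum Qb C) N h' & diagpi C *m h' = h.
Proof.
move=> kN hh; have [a ha aE] := Qpi_univ kN (ishomM (inl_hom _ _) hh).
exists (col_mx a (inr_mx Qm C *m h)).
  by apply: ishom_col => //; apply: ishomM (inr_hom _ _) hh.
by rewrite /diagpi mul_col_mx -mulmxA inl_col inr_col aE -dsum_colE.
Qed.

Lemma fac_bar C Y : kld Y -> fac (dsum Qm C) Y -> fac (dsum Qb C) Y.
Proof.
move=> kY; apply: fac_sub => f hf; have [f' hf' <-] := diagpi_univ kY hf.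
by exists f' => //; apply: submxMl.
Qed.

Lemma fac_diag C : fac (dsum Qm C) (dsum Qb C).
Proof. exact: surj_fac (@diagpi_hom C) (@diagpi_full C). Qed.

Lemma ext0_bar C : ext0 allmod (dsum Qm C) (dsum Qm C) -> ext0 kld (dsum Qb C) (dsum Qb C).
Proof.
move=> H E X G p q w kE hp hq fq pq NG hw.
have [l hl lE] := H E X G p q _ Logic.I hp hq fq pq (fac_trans (@fac_diag C) NG)
  (ishomM (@diagpi_hom C) hw).
have [l' hl' l'E] := diagpi_univ kE hl; exists l' => //.
by apply: (row_full_canl (@diagpi_full C)); rewrite mulmxA l'E.
Qed.

(** Let Y in Fac(Q + C) be the kernel of an extension of C. If Y is a module over
A/I, it is generated by Qbar + C, hence by N. Otherwise Y contains Q, which splits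
off the whole extension, and induction on the dimension applies to the rest. *)
Lemma ext0_addQ C N : ext0 allmod C N -> fac N (dsum Qb C) ->
  ext0 allmod (dsum Qm C) (dsum Qm C).
Proof.
move=> H NQC; apply: ext0_dsum; first exact: ext0_proj.
apply: ext0_section => // E G p q _; have [n] := ubnP (rdim E).
elim: n E p q => // n IH E p q leE hp hq fq pq MG.
have [Y [p1 [i [hp1 hi fp1 fi pE]]]] := im_ex hp.
have iq : (i :=: kermx q)%MS.
  by apply: eqmx_trans pq; rewrite pE; apply/eqmx_sym/eqmxMfull.
have MY : fac (dsum Qm C) Y by apply: fac_surj hp1 fp1 MG.
case: (pselect (kld Y)) => [kY|nkY].
  have NY : fac N Y by apply: fac_trans NQC _; apply: fac_bar.
  exact: (H E C Y i q 1%:M Logic.I hi hq fq iq NY (@ishom1 _ _ C)).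
have [g [hg fg]] := Q_embeds nkY.
have hgi : ishom Qm E (g *m i) by apply: ishomM.
have fgi : row_free (g *m i).
  have /row_freeP[a ga] := fg; have /row_freeP[b ib] := fi.
  by apply/row_freeP; exists (b *m a); rewrite mulmxA -(mulmxA g) ib mulmx1.
have [r hr gr] := embed_split hgi fgi.
have [E' [j [t [hj ht jt [jr gt e1 jE]]]]] := retract_compl hgi hr gr.
have iq0 : i *m q = 0 by apply/sub_kermxP; rewrite iq.
have tq : t *m (j *m q) = q.
  have -> : t *m (j *m q) = (1%:M - r *m (g *m i)) *m q by rewrite -e1 addrAC subrr add0r mulmxA.
  by rewrite mulmxBl mul1mx -!mulmxA iq0 !mulmx0 subr0.
have fq' : row_full (j *m q) by apply: (@row_full_mull _ _ _ _ t); rewrite tq.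
have [|||s hs sq] := IH E' (p *m t) (j *m q) _ (ishomM hp ht) (ishomM hj hq) fq'.
- have := iso_dim (biprod_iso hgi hr hj ht gr jt gt jr e1) => /= dE.
  have [Q0 _] := indQ; apply: leq_trans (_ : rdim E <= n)%N; last by rewrite -ltnS.
  by rewrite dE -[X in (X < _)%N]add0n ltn_add2r.
- apply/eqmxP/andP; split.
    by apply/sub_kermxP; rewrite -mulmxA tq; apply/sub_kermxP; rewrite pq.
  have : (kermx (j *m q) *m j <= p)%MS.
    by rewrite pq; apply/sub_kermxP; rewrite -mulmxA mulmx_ker.
  by move/(submxMr t); rewrite -mulmxA jt mulmx1.
- exact: MG.
by exists (s *m j); [apply: ishomM|rewrite -mulmxA].
Qed.

(** With J the image of a nonzero map M -> Q, a lift of Qbar -> Q/J along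
Q -> Q/J would be surjective, as Q is local, but Q is not a quotient of Qbar. *)
Lemma ext0_Qbar_hom M : kld M -> ext0 allmod M M -> retract Qb M -> hom_zero M Qm.
Proof.
move=> kM H r; apply/hom_zeroP => u hu; apply/eqP/contraT => u0.
have [Y [k [hk fk kE]]] := coker_ex hu.
have [k' [hk' fk' k'E _]] := coker_Qbar hu u0 hk fk kE.
have H' : ext0 allmod Qb M := ext0_retract r H.
have [l hl lE] := H' _ _ _ _ _ _ Logic.I hu hk fk (eqmx_sym kE) (@fac_refl _ _ M) hk'.
have Y0 : (0 < rdim Y)%N.
  rewrite lt0n; apply/eqP => Y0; case: Q_not_killed; apply: killed_surj hu _ kM.
  rewrite -sub1mx -kE; apply/sub_kermxP; apply/matrixP => i j.
  by move: (ltn_ord j); rewrite {2}Y0.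
have full1 : row_full (1%:M : 'M[K]_(rdim Qm)) by rewrite row_full_unit unitmx1.
have fl : row_full l.
  apply: (indec_proj_local indQ prQ (@ishom1 _ _ Qm) full1 hk fk Y0 hl).
  by rewrite lE.
by case: Q_not_killed; apply: killed_surj hl fl Qbar_killed.
Qed.

End ProjectiveInjective.

(** * Trading Q for Q/S *)

Section Exchange.
Variables (K : fieldType) (A : fdalg K) (Q : submodule (reg A)).
Hypotheses (indQ : indecomposable (Qmod Q)) (prQ : projective_mod (Qmod Q))
  (inQ : injective_mod (Qmod Q)).
Implicit Types M N P X Y Z C E G U V W : rmod A.

Local Notation Qm := (Qmod Q).
Local Notation Qb := (Qbar Q).
Local Notation S := (soc_mx Qm).
Local Notation I := (genideal (socQ Q)).
Local Notation kld := (killed I).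

Lemma soc_module : exists T s, [/\ ishom T Qm s, row_free s, (s :=: S)%MS,
  (0 < rdim T)%N & forall X f, ishom X T f -> f != 0 -> row_full f].
Proof.
have [T [s [hs fs sE]]] := sub_ex (@soc_stable _ _ Qm); exists T, s; split=> //.
  rewrite lt0n; apply/eqP => T0; case/negP: (S_neq0 indQ inQ); apply/eqP.
  have s0 : s = 0 by apply/matrixP => i; move: (ltn_ord i); rewrite {2}T0.
  by apply/eqP; rewrite -submx0 -sE s0 sub0mx.
move=> X f hf f0; have fs0 : f *m s != 0.
  by apply: contra_neq f0 => f0; apply: (row_free_canr fs); rewrite mul0mx.
have := S_im indQ inQ (ishomM hf hs) fs0; rewrite -sE => /submxP[D DE].
apply/row_fullP; exists D; apply: (row_free_canr fs).
by rewrite mul1mx -mulmxA -DE.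
Qed.

(** P is the projective cover of S. A nonzero map P -> N has its kernel inside
the maximal submodule of P, so S is a quotient of the image and, Q being
injective, N maps to Q; in the other direction S lies in the image of N -> Q and
P -> S lifts to N. A map from another indecomposable projective to Q whose
composite to Qbar is zero lands in S. *)
Lemma soc_cover : exists P, [/\ suppset Qm (cls P),
  forall N, hom_zero P N <-> hom_zero N Qm &
  forall P', indecomposable P' -> projective_mod P' -> hom_zero P' Qb ->
    ~ hom_zero P' Qm -> iso P' P].
Proof.
have [T [s [hs fs sE T0 simT]]] := soc_module.
have [P [t [indP rP ht t0]]] : exists P t,
    [/\ indecomposable P, retract P (reg A), ishom P T t & t != 0].
  have [s1 [inds iA]] := indec_decomp (reg A).
  apply: contrapT => H; have z : hom_zero (reg A) T.
    suff z : hom_zero (bigdsum s1) T by apply: hom_zero_isol (iso_sym iA) z.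
    have : forall P, P \in s1 -> hom_zero P T.
      move=> P sP; apply/hom_zeroP => t ht; apply/eqP/contraT => t0; case: H.
      exists P, t; split=> //; first exact: inds.
      exact: retract_isor (iso_sym iA) (mem_bigdsum sP).
    elim: (s1) => [_|P s2 IH z2]; first exact: hom_zero_dim0.
    have /hom_zeroP zP : hom_zero P T by apply: z2; rewrite inE eqxx.
    have /hom_zeroP zs : hom_zero (bigdsum s2) T.
      by apply: IH => R sR; apply: z2; rewrite inE sR orbT.
    apply/hom_zeroP => f hf; rewrite [f]dsum_colE.
    rewrite (zP _ (ishomM (inl_hom _ _) hf)) (zs _ (ishomM (inr_hom _ _) hf)).
    exact: col_mx0.
  have /row_fullP[B B1] : row_full (0 : 'M[K]_(rdim (reg A), rdim T)).
    by apply: (@fac_reg _ _ T) => f hf; rewrite ((hom_zeroP _ _).1 z f hf) sub0mx.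
  by move: T0; rewrite -(mxrank1 K (rdim T)) -B1 mulmx0 mxrank0.
have prP := proj_retract rP (@proj_reg _ _).
have ft : row_full t := simT _ _ ht t0.
have ts0 : t *m s != 0.
  by apply: contra_neq t0 => t0; apply: (row_free_canr fs); rewrite mul0mx.
have full1 : row_full (1%:M : 'M[K]_(rdim P)) by rewrite row_full_unit unitmx1.
exists P; split.
- apply/suppsetP; split=> // /hom_zeroP z; case/negP: ts0; apply/eqP.
  by apply: z; apply: ishomM.
- move=> N; split=> /hom_zeroP z; apply/hom_zeroP => f hf; apply/eqP/contraT => f0.
    have [W [f1 [i [hf1 hi ff1 fi fE]]]] := im_ex hf.
    have i0 : i != 0.
      by apply: contra_neq f0 => i0; rewrite fE i0 mulmx0.
    have Si := S_im indQ inQ hi i0.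
    have [|t' ht' t'E] := factor_inj hs hi fi; first by rewrite sE.
    have [g hg gE] := projP prP hf1 ff1 (ishomM ht ht').
    case/negP: ts0; rewrite -t'E mulmxA -gE (z _ hg).
    by rewrite !mul0mx.
  have [W [f1 [i [hf1 hi ff1 fi fE]]]] := im_ex hf.
  have f10 : f1 != 0 by apply: contra_neq f0 => f10; rewrite fE f10 mul0mx.
  have [k [j [hj fj jE]]] := ker_ex hf1.
  have jt : j *m t = 0.
    apply/eqP/contraT => jt0; have fjt := simT _ _ (ishomM hj ht) jt0.
    have fj' := indec_proj_local indP prP (@ishom1 _ _ P) full1 ht ft T0 hj fjt.
    case/negP: f10; apply/eqP; apply: (row_full_canl fj').
    by rewrite mulmx0; apply/sub_kermxP; rewrite jE.
  have [|t' ht' t'E] := factor_surj ht hf1 ff1.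
    by rewrite -jE; apply/sub_kermxP.
  have [h hh hE] := injP inQ hi fi (ishomM ht' hs).
  case/negP: ts0; rewrite -t'E -mulmxA -hE (z _ hh).
  by rewrite !mulmx0.
- move=> P' indP' prP' /hom_zeroP z nz.
  have [f hf f0] : exists2 f, ishom P' Qm f & f != 0.
    apply: contrapT => H; apply: nz; apply/hom_zeroP => f hf.
    by apply/eqP/contraT => f0; case: H; exists f.
  have [|f' hf' f'E] := factor_inj hf hs fs.
    by rewrite sE -Qpi_ker; apply/eqP/z; apply: ishomM hf (@Qpi_hom _ _ Q).
  have f'0 : f' != 0 by apply: contra_neq f0 => f'0; rewrite -f'E f'0 mul0mx.
  have ff' := simT _ _ hf' f'0.
  have [a ha aE] := projP prP hf' ff' ht.
  have [b hb bE] := projP prP' ht ft hf'.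
  apply/iso_sym/retract_indec => //.
  apply: (unit_retract ha hb); apply: (indec_fixr indP (ishomM ha hb) (m := t)) => //.
  by rewrite -mulmxA bE aE.
Qed.

Definition soc_proj := projT1 (cid soc_cover).
Lemma soc_proj_hom N : hom_zero soc_proj N <-> hom_zero N Qm.
Proof. by rewrite /soc_proj; case: cid => P /= [_ H _]. Qed.
Lemma soc_proj_supp : suppset Qm (cls soc_proj).
Proof. by rewrite /soc_proj; case: cid => P /= []. Qed.
Lemma soc_proj_uniq P' : indecomposable P' -> projective_mod P' -> hom_zero P' Qb ->
  ~ hom_zero P' Qm -> iso P' soc_proj.
Proof. by rewrite /soc_proj; case: cid => P /= [_ _]; apply. Qed.

Lemma hom_zero_dsum P M N : hom_zero P M -> hom_zero P N -> hom_zero P (dsum M N).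
Proof.
move=> /hom_zeroP zM /hom_zeroP zN; apply/hom_zeroP => f hf.
rewrite [f]dsum_rowE (zM _ (ishomM hf (fst_hom _ _))) (zN _ (ishomM hf (snd_hom _ _))).
exact: row_mx0.
Qed.

Lemma suppset_Q C : suppset (dsum Qm C) = cls soc_proj |` suppset (dsum Qb C).
Proof.
apply/seteqP; split=> c.
  rewrite -[c]clsK => /suppsetP[indc rc nz].
  have prc := proj_retract rc (@proj_reg _ _).
  case: (pselect (hom_zero (repr c) (dsum Qb C))) => z; last first.
    by right; apply/suppsetP.
  left; apply/clsP; apply: soc_proj_uniq => //.
    exact: (proj_nohom prc (fac_retract (retract_inl _ _)) z).
  move=> zQ; apply: nz; apply: hom_zero_dsum => //.
  exact: (proj_nohom prc (fac_retract (retract_inr _ _)) z).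
case=> [->|]; last exact: (suppset_fac (@fac_diag _ _ Q C)).
by apply: (suppset_fac (fac_retract (retract_inl _ _))); apply: soc_proj_supp.
Qed.

Lemma soc_proj_mem N : suppset N (cls soc_proj) <-> ~ hom_zero N Qm.
Proof.
have /suppsetP[indP rP _] := soc_proj_supp; split=> [/suppsetP[_ _ nz] /soc_proj_hom//|nz].
by apply/suppsetP; split=> // /soc_proj_hom.
Qed.

(** The two conditions of support_tau_tiltingP, over A and over A/I for modules
regarded as A-modules. *)
Definition stt_criterion M := ext0 allmod M M /\ nsummands M = ncard (suppset M).
Definition stt_criterion_bar N := ext0 kld N N /\ nsummands N = ncard (suppset N).

Lemma bound_killed N : kld N -> ext0 kld N N -> (nsummands N <= ncard (suppset N))%N.
Proof.
move=> /killedE[N' ->] /res_ext0 H; rewrite res_nsummands res_ncard_supp.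
exact: nsummands_le_supp.
Qed.

Lemma stt_criterion_killed N : kld N ->
  (stt_criterion N <-> stt_criterion_bar N /\ (~ retract Qb N \/ hom_zero N Qm)).
Proof.
move=> kN; split=> [[eN cN]|[[eN cN] alt]].
  split; first by split=> //; apply: ext0_cl eN.
  case: (pselect (retract Qb N)) => r; [right|by left].
  exact: ext0_Qbar_hom.
by split=> //; apply: (@ext0_lift _ _ Q).
Qed.

(** Adding Q adds one summand, and it adds one element to the support exactly
when S is not a composition factor of N. *)
Lemma stt_criterion_addQ N : kld N -> retract Qb N ->
  (stt_criterion (dsum Qm N) <-> stt_criterion_bar N /\ hom_zero N Qm).
Proof.
move=> kN rN; have nQN : ~ retract Qm N by apply: not_retract_killed.
have cnt : nsummands (dsum Qm N) = (nsummands N).+1 by apply: nsummands_dsum.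
have fN : fac N (dsum Qb N) by apply: fac_dsum; [apply: fac_retract|apply: fac_refl].
have sE : suppset (dsum Qb N) = suppset N.
  apply/seteqP; split; apply: suppset_fac => //.
  exact/fac_retract/retract_inr.
have key : hom_zero N Qm -> ncard (suppset (dsum Qm N)) = (ncard (suppset N)).+1.
  move=> z; rewrite suppset_Q sE ncardU1 //; first exact: finite_suppset.
  by move/soc_proj_mem.
split=> [[eM cM]|[[eN cN] z]].
  have eN : ext0 allmod N N.
    apply: ext0_retract (retract_inr Qm N) _.
    by apply: ext0_fac eM; apply/fac_retract/retract_inr.
  have z := ext0_Qbar_hom indQ prQ inQ kN eN rN.
  split=> //; split; first exact: ext0_cl eN.
  by move: cM; rewrite cnt key // => -[].
split; last by rewrite cnt key // cN.
apply: (@ext0_addQ K A Q indQ prQ inQ N N) => //.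
by apply: (@ext0_lift _ _ Q) => //; right.
Qed.

(** The exchange keeps the number of summands, so the support must not change;
over A/I, nsummands_le_supp forces S to be a composition factor of Qbar + C. *)
Lemma stt_criterion_exchange C : kld C -> ~ retract Qb C ->
  (stt_criterion (dsum Qm C) <-> stt_criterion_bar (dsum Qb C) /\ ~ hom_zero (dsum Qb C) Qm).
Proof.
move=> kC nC.
have Q0 : (0 < rdim Qb)%N.
  by rewrite lt0n; apply/eqP => Q0; apply: nC; apply: retract0.
have indb := Qbar_indec indQ prQ inQ Q0.
have kN : kld (dsum Qb C) by apply: killed_dsum (Qbar_killed indQ inQ) kC.
have cA : nsummands (dsum Qm C) = (nsummands C).+1.
  by apply: nsummands_dsum => //; apply: not_retract_killed.
have cB : nsummands (dsum Qb C) = (nsummands C).+1 by apply: nsummands_dsum.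
have key : suppset (dsum Qb C) (cls soc_proj) -> suppset (dsum Qm C) = suppset (dsum Qb C).
  by move=> sP; rewrite suppset_Q; apply/setUidPr => _ ->.
split=> [[eM cM]|[[eN cN] nz]].
  have eN := ext0_bar inQ eM.
  have sub : suppset (dsum Qb C) `<=` suppset (dsum Qm C).
    by rewrite suppset_Q; apply: subsetUr.
  have e : suppset (dsum Qb C) = suppset (dsum Qm C).
    apply: ncard_sub_eq => //; first exact: finite_suppset.
    by rewrite -cM cA -cB; apply: bound_killed.
  split; last by apply/soc_proj_mem; rewrite e suppset_Q; left.
  by split=> //; rewrite e -cM cA cB.
have sP : suppset (dsum Qb C) (cls soc_proj) by apply/soc_proj_mem.
split; last by rewrite key // cA -cB.
apply: (@ext0_addQ K A Q indQ prQ inQ C (dsum Qb C)); last exact: fac_refl.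
apply: (@ext0_lift _ _ Q) => //; last by left.
exact: ext0_retract (retract_inr Qb C) eN.
Qed.

End Exchange.

(** * The classification *)

Section Classification.
Variables (K : fieldType) (A : fdalg K) (Q : submodule (reg A)).
Hypotheses (indQ : indecomposable (Qmod Q)) (prQ : projective_mod (Qmod Q))
  (inQ : injective_mod (Qmod Q)).

Local Notation Qm := (Qmod Q).
Local Notation Qb := (Qbar Q).
Local Notation I := (genideal (socQ Q)).
Local Notation kld := (killed I).
Local Notation rs N := (res (Abar_mor Q) N).

Lemma stt_criterion_bar_iso (M N : rmod A) : iso M N -> stt_criterion_bar Q M <-> stt_criterion_bar Q N.
Proof.
move=> i; rewrite /stt_criterion_bar (nsummands_iso i) (suppset_iso i).
by split=> -[e c]; split=> //; apply: ext0_iso e => //; apply: iso_sym.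
Qed.

Lemma sttiltP (R : fdalg K) (M : rmod R) : sttilt R (cls M) <-> basic_mod M /\ stt_criterion M.
Proof.
split=> [[N [bN /support_tau_tiltingP sN] /clsP i]|[bM sM]].
  split; first exact: basic_iso i bN.
  have [eN cN] := sN; split; first exact: ext0_iso i eN.
  by rewrite -(nsummands_iso i) -(suppset_iso i).
by exists M => //; split=> //; apply/support_tau_tiltingP.
Qed.

Lemma stt_criterion_res (N : rmod (Abar Q)) : stt_criterion N <-> stt_criterion_bar Q (rs N).
Proof.
split=> -[e c]; split.
- exact/res_ext0.
- by rewrite res_nsummands c res_ncard_supp.
- exact/res_ext0.
- by rewrite -(res_nsummands N) c res_ncard_supp.
Qed.

Lemma in_add_Q (M : rmod A) : in_add Qm M <-> retract Qm M.
Proof. exact: in_add_indec. Qed.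
Lemma in_add_Qbar (M : rmod A) : in_add Qb M <-> retract Qb M.
Proof.
case: (posnP (rdim Qb)) => [Q0|Q0]; last exact/in_add_indec/Qbar_indec.
by split=> _; [apply: retract0|apply: retract_in_add; apply: retract0].
Qed.

Lemma retract_repr (R : fdalg K) (X M : rmod R) : retract X (repr (cls M)) <-> retract X M.
Proof.
by split; apply: retract_isor; [apply: repr_cls|apply/iso_sym/repr_cls].
Qed.
Lemma retract_repbar (X : rmod A) (N : rmod (Abar Q)) :
  retract X (repbar (cls N)) <-> retract X (rs N).
Proof.
have i : iso (repbar (cls N)) (rs N) by apply/res_iso/repr_cls.
by split; apply: retract_isor => //; apply: iso_sym.
Qed.

Lemma in_addQE (M : rmod A) : in_add Qm (rep (cls M)) = retract Qm M.
Proof. by apply/propext; rewrite -retract_repr; apply: in_add_Q. Qed.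
Lemma in_addQbarE (M : rmod A) : in_add Qb (rep (cls M)) = retract Qb M.
Proof. by apply/propext; rewrite -retract_repr; apply: in_add_Qbar. Qed.
Lemma in_addQQbarE (c : isoclass A) :
  in_add (dsum Qm Qb) (rep c) = (in_add Qm (rep c) /\ in_add Qb (rep c)).
Proof.
apply/propext; split=> [r|[]]; last exact: in_add_dsum.
by split; apply: in_add_retract r; [apply: retract_inl|apply: retract_inr].
Qed.

Lemma setM1P (M : rmod A) : setM1 Q (cls M) <->
  [/\ basic_mod M, stt_criterion M, ~ retract Qm M & ~ retract Qb M].
Proof.
by rewrite /setM1 /= in_addQE in_addQbarE (propext (sttiltP M)); split=> [[[]]|[]].
Qed.
Lemma setM2mP (M : rmod A) : setM2m Q (cls M) <->
  [/\ basic_mod M, stt_criterion M, ~ retract Qm M & retract Qb M].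
Proof.
by rewrite /setM2m /= in_addQE in_addQbarE (propext (sttiltP M)); split=> [[[]]|[]].
Qed.
Lemma setM2pP (M : rmod A) : setM2p Q (cls M) <->
  [/\ basic_mod M, stt_criterion M, retract Qm M & retract Qb M].
Proof.
rewrite /setM2p /= in_addQQbarE in_addQE in_addQbarE (propext (sttiltP M)).
by split=> [[[b s] []]|[]].
Qed.
Lemma setM3P (M : rmod A) : setM3 Q (cls M) <->
  [/\ basic_mod M, stt_criterion M, retract Qm M & ~ retract Qb M].
Proof.
by rewrite /setM3 /= in_addQE in_addQbarE (propext (sttiltP M)); split=> [[[]]|[]].
Qed.

Lemma sttilt_barP (N : rmod (Abar Q)) : sttilt (Abar Q) (cls N) <->
  basic_mod (rs N) /\ stt_criterion_bar Q (rs N).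
Proof.
split=> [/sttiltP[b s]|[b s]]; first by split; [apply/res_basic|apply/stt_criterion_res].
by apply/sttiltP; split; [apply/res_basic; apply: b|apply/stt_criterion_res].
Qed.
Lemma in_add_repbarE (N : rmod (Abar Q)) : in_add Qb (repbar (cls N)) = retract Qb (rs N).
Proof. by apply/propext; rewrite -retract_repbar; apply: in_add_Qbar. Qed.
Lemma hom_zero_repbarE (N : rmod (Abar Q)) :
  hom_zero (repbar (cls N)) Qm = hom_zero (rs N) Qm.
Proof.
have i : iso (repbar (cls N)) (rs N) by apply/res_iso/repr_cls.
by apply/propext; split; apply: hom_zero_isol => //; apply: iso_sym.
Qed.

Lemma setN1P (N : rmod (Abar Q)) : setN1 Q (cls N) <->
  [/\ basic_mod (rs N), stt_criterion_bar Q (rs N) & ~ retract Qb (rs N)].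
Proof.
by rewrite /setN1 /= in_add_repbarE (propext (sttilt_barP N)); split=> [[[]]|[]].
Qed.
Lemma setN2P (N : rmod (Abar Q)) : setN2 Q (cls N) <->
  [/\ basic_mod (rs N), stt_criterion_bar Q (rs N), retract Qb (rs N) & hom_zero (rs N) Qm].
Proof.
rewrite /setN2 /= in_add_repbarE hom_zero_repbarE (propext (sttilt_barP N)).
by split=> [[[]]|[]].
Qed.
Lemma setN3P (N : rmod (Abar Q)) : setN3 Q (cls N) <->
  [/\ basic_mod (rs N), stt_criterion_bar Q (rs N), retract Qb (rs N) & ~ hom_zero (rs N) Qm].
Proof.
rewrite /setN3 /= in_add_repbarE hom_zero_repbarE (propext (sttilt_barP N)).
by split=> [[[]]|[]].
Qed.

Lemma alphaE (M : rmod A) (N : rmod (Abar Q)) : basic_mod N ->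
  (forall X, in_add X N <-> in_add X (tensor (Abar_mor Q) M)) -> alphaQ Q (cls M) = cls N.
Proof.
move=> bN HN.
have iT : iso (tensor (Abar_mor Q) (repr (cls M))) (tensor (Abar_mor Q) M).
  exact/tensor_iso/repr_cls.
have isoadd (R : fdalg K) (X Y Y' : rmod R) : iso Y Y' -> in_add X Y -> in_add X Y'.
  by move=> i XY; apply: in_add_trans XY _; apply/retract_in_add/iso_retract.
apply: xget_unique.
  exists N => //; split=> // X; rewrite HN; split; apply: isoadd => //; exact: iso_sym.
move=> _ [N' [bN' HN'] <-]; apply/clsP; apply: basic_unique => // X indX.
rewrite -!(in_add_indec _ indX) HN HN'; split; apply: isoadd => //; exact: iso_sym.
Qed.

Lemma tensor_exchange (C : rmod A) (N : rmod (Abar Q)) : iso (dsum Qb C) (rs N) ->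
  iso (tensor (Abar_mor Q) (dsum Qm C)) N.
Proof.
case/isoP=> f [g [hf hg fg gf]].
have ff : row_full f by apply/row_fullP; exists g.
apply: (tensor_eq (ishomM (@diagpi_hom _ _ Q C) hf)).
  by rewrite row_fullM // diagpi_full.
move=> N' h' hh'; have [h'' hh'' <-] := diagpi_univ inQ (@killed_res _ _ _ N') hh'.
apply/sub_kermxP; rewrite -[h'']mul1mx -fg !mulmxA -[X in X *m _ *m _]mulmxA.
by rewrite mulmx_ker !mul0mx.
Qed.

(** The three ways in which a module over A matches one over A/I: M = N,
M = Q + N, and M = Q + C with N = Qbar + C. As relations on isomorphism classes
they avoid choosing complements. *)
Definition corr_same c d := exists N : rmod (Abar Q), [/\ basic_mod N, c = cls (rs N) & d = cls N].
Definition corr_add c d := exists N : rmod (Abar Q),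
  [/\ basic_mod N, retract Qb (rs N), c = cls (dsum Qm (rs N)) & d = cls N].
Definition corr_exch c d := exists (N : rmod (Abar Q)) C,
  [/\ basic_mod N, ~ retract Qb C, iso (rs N) (dsum Qb C), c = cls (dsum Qm C) & d = cls N].

Lemma corr_same_alpha c d : corr_same c d -> alphaQ Q c = d.
Proof.
case=> N [bN -> ->]; apply: alphaE => // X.
have i := tensor_res N.
by split=> XY; apply: in_add_trans XY _; apply/retract_in_add/iso_retract => //; apply: iso_sym.
Qed.
Lemma corr_add_alpha c d : corr_add c d -> alphaQ Q c = d.
Proof.
case=> N [bN rb -> ->]; apply: alphaE => // X.
have [Qb' QbE] := killedE (Qbar_killed indQ inQ).
have i : iso (tensor (Abar_mor Q) (dsum Qm (rs N))) (dsum Qb' N).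
  by apply: tensor_exchange; rewrite res_dsum QbE; apply: iso_refl.
have rb' : retract Qb' N by apply/res_retract; rewrite -QbE.
split=> XY; apply: in_add_trans XY _.
  apply/retract_in_add; apply: retract_isor (iso_sym i) (retract_inr _ _).
apply: in_add_retract (iso_retract i) _.
by apply: in_add_dsum; apply: retract_in_add => //; apply: retract_refl.
Qed.
Lemma corr_exch_alpha c d : corr_exch c d -> alphaQ Q c = d.
Proof.
case=> N [C [bN nb iN -> ->]]; apply: alphaE => // X.
have i := tensor_exchange (iso_sym iN).
by split=> XY; apply: in_add_trans XY _; apply/retract_in_add/iso_retract => //; apply: iso_sym.
Qed.

Lemma corr_same_inj c c' d : corr_same c d -> corr_same c' d -> c = c'.
Proof.
case=> N [_ -> ->] [N' [_ -> /clsP i]]; apply/clsP; exact/res_iso.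
Qed.
Lemma corr_add_inj c c' d : corr_add c d -> corr_add c' d -> c = c'.
Proof.
case=> N [_ _ -> ->] [N' [_ _ -> /clsP i]]; apply/clsP; apply: iso_dsum (iso_refl _) _.
exact/res_iso.
Qed.
Lemma not_retract_indec C : ~ retract Qb C -> indecomposable Qb.
Proof.
move=> nb; apply: Qbar_indec => //; rewrite lt0n; apply/eqP => Q0.
by apply: nb; apply: retract0.
Qed.
Lemma corr_exch_inj c c' d : corr_exch c d -> corr_exch c' d -> c = c'.
Proof.
case=> N [C [_ nb iN -> ->]] [N' [C' [_ _ iN' -> /clsP i]]]; apply/clsP.
apply: iso_dsum (iso_refl _) _; apply: (dsum_cancel (not_retract_indec nb)).
apply: iso_trans (iso_sym iN) _; apply: iso_trans _ iN'; exact/res_iso.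
Qed.

Lemma corr_same_M1 c d : corr_same c d -> setM1 Q c <-> setN1 Q d.
Proof.
case=> N [bN -> ->]; rewrite setM1P setN1P.
have kN : kld (rs N) by apply: killed_res.
split=> [[b s _ nb]|[b s nb]].
  by split=> //; have [] := (stt_criterion_killed indQ prQ inQ kN).1 s.
split=> //; last exact: not_retract_killed.
by apply/(stt_criterion_killed indQ prQ inQ kN); split=> //; left.
Qed.
Lemma corr_same_M2m c d : corr_same c d -> setM2m Q c <-> setN2 Q d.
Proof.
case=> N [bN -> ->]; rewrite setM2mP setN2P.
have kN : kld (rs N) by apply: killed_res.
split=> [[b s _ rb]|[b s rb z]].
  by have [s' [//|z]] := (stt_criterion_killed indQ prQ inQ kN).1 s.
split=> //; last exact: not_retract_killed.
by apply/(stt_criterion_killed indQ prQ inQ kN); split=> //; right.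
Qed.
Lemma corr_add_M2p c d : corr_add c d -> setM2p Q c <-> setN2 Q d.
Proof.
case=> N [bN rb -> ->]; rewrite setM2pP setN2P.
have kN : kld (rs N) by apply: killed_res.
split=> [[b s _ _]|[b s _ z]].
  have [s' z] := (stt_criterion_addQ indQ prQ inQ kN rb).1 s.
  by split=> //; apply: basic_retract b (retract_inr _ _).
split.
- by apply: basic_dsum => //; apply: not_retract_killed.
- exact/(stt_criterion_addQ indQ prQ inQ kN rb).
- exact: retract_inl.
- exact: retract_trans rb (retract_inr _ _).
Qed.
Lemma corr_exch_killed (N : rmod (Abar Q)) C : iso (rs N) (dsum Qb C) -> kld C.
Proof.
move=> i; apply: killed_retract (@killed_res _ _ _ N).
exact: retract_isor (iso_sym i) (retract_inr _ _).
Qed.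
Lemma corr_exch_M3 c d : corr_exch c d -> setM3 Q c <-> setN3 Q d.
Proof.
case=> N [C [bN nb i -> ->]]; rewrite setM3P setN3P.
have kC := corr_exch_killed i.
have bC : basic_mod C.
  apply: (@basic_retract _ _ _ (rs N)); first exact/res_basic.
  exact: retract_isor (iso_sym i) (retract_inr _ _).
split=> [[b s _ _]|[b s _ z]].
  have [s' z] := (stt_criterion_exchange indQ prQ inQ kC nb).1 s; split.
  - exact/res_basic.
  - exact/(stt_criterion_bar_iso i).
  - exact: retract_isor (iso_sym i) (retract_inl _ _).
  - by move=> z'; apply: z; apply: hom_zero_isol i z'.
split.
- by apply: basic_dsum => //; apply: not_retract_killed.
- apply/(stt_criterion_exchange indQ prQ inQ kC nb); split; first exact/(stt_criterion_bar_iso i).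
  by move=> z'; apply: z; apply: hom_zero_isol (iso_sym i) z'.
- exact: retract_inl.
- by move/(retract_Qbar_dsum indQ prQ inQ).
Qed.

Lemma kld_of (M : rmod A) : ~ retract Qm M -> kld M.
Proof. by move=> nQ; apply: contrapT => nk; apply: nQ; apply: Q_retract. Qed.

Lemma corr_same_dom c : sttilt A c -> ~ retract Qm (repr c) -> exists d, corr_same c d.
Proof.
rewrite -{1}[c]clsK => /sttiltP[b _] /kld_of/killedE[N NE].
exists (cls N), N; split=> //; last by rewrite -NE clsK.
by apply/res_basic; rewrite -[res _ _]NE.
Qed.
Lemma corr_same_cod d : sttilt (Abar Q) d -> exists c, corr_same c d.
Proof.
rewrite -[d]clsK => /sttilt_barP[b _].
by exists (cls (rs (repr d))), (repr d); split=> //; apply/res_basic.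
Qed.

Lemma split_Q (M : rmod A) : basic_mod M -> retract Qm M ->
  exists C, [/\ iso M (dsum Qm C), kld C & basic_mod C].
Proof.
move=> bM rQ; have /summandP[C i] := rQ; exists C; split=> //.
  by apply: kld_of; apply: basic_not_retract => //; apply: basic_iso i bM.
by apply: basic_retract bM _; apply: retract_isor (iso_sym i) (retract_inr _ _).
Qed.

Lemma corr_add_dom c : setM2p Q c -> exists d, corr_add c d.
Proof.
rewrite -[c]clsK => /setM2pP[b _ rQ rb]; have [C [i kC bC]] := split_Q b rQ.
have [N NE] := killedE kC; exists (cls N), N; split=> //.
- by apply/res_basic; rewrite -[res _ _]NE.
- rewrite -[res _ _]NE; apply/(retract_Qbar_dsum indQ prQ inQ).
  exact: retract_isor i rb.
- by apply/clsP; rewrite -[res _ _]NE.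
Qed.
Lemma corr_add_cod d : setN2 Q d -> exists c, corr_add c d.
Proof.
rewrite -[d]clsK => /setN2P[b _ rb _].
by exists (cls (dsum Qm (rs (repr d)))), (repr d); split=> //; apply/res_basic.
Qed.

Lemma corr_exch_dom c : setM3 Q c -> exists d, corr_exch c d.
Proof.
rewrite -[c]clsK => /setM3P[b _ rQ nb]; have [C [i kC bC]] := split_Q b rQ.
have nbC : ~ retract Qb C.
  move=> r; apply: nb; apply: retract_isor (iso_sym i) _.
  exact: retract_trans r (retract_inr _ _).
have [N NE] := killedE (killed_dsum (Qbar_killed indQ inQ) kC).
exists (cls N), N, C; split=> //.
- apply/res_basic; rewrite -[res _ _]NE; apply: basic_dsum => //.
  exact: not_retract_indec nbC.
- by rewrite -[rs N]NE; apply: iso_refl.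
- exact/clsP.
Qed.

(** If Q is simple, then Qbar = 0 is a summand of every module. The case
Hom(N, Q) <> 0 does not occur then: such a map would be onto S = Q. *)
Lemma Qbar0_nohom N : kld N -> rdim Qb = 0%N -> hom_zero N Qm.
Proof.
move=> kN Q0; apply/hom_zeroP => f hf; apply/eqP/contraT => f0.
have : (1%:M <= f)%MS.
  apply: submx_trans (S_im indQ inQ hf f0); rewrite -Qpi_ker.
  by apply/eqP/matrixP => i j; move: (ltn_ord j); rewrite {2}Q0.
rewrite sub1mx => ff; case: (Q_not_killed indQ inQ); exact: killed_surj hf ff kN.
Qed.

Lemma corr_exch_exchange d C : setN3 Q d -> iso (repbar d) (dsum Qb C) ->
  corr_exch (cls (dsum Qm C)) d.
Proof.
rewrite -{1}[d]clsK => /setN3P[b _ rb nz] i; exists (repr d), C; split=> //.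
- exact/res_basic.
- apply: basic_not_retract; last exact: basic_iso i b.
  apply: Qbar_indec => //; rewrite lt0n; apply/eqP => Q0; apply: nz.
  by apply: Qbar0_nohom Q0; apply: killed_res.
- by rewrite clsK.
Qed.
Lemma corr_exch_cod d : setN3 Q d -> exists c, corr_exch c d.
Proof.
move=> N3d; move: (N3d); rewrite -{1}[d]clsK => /setN3P[_ _ rb _].
have /summandP[C i] := rb; exists (cls (dsum Qm C)); exact: corr_exch_exchange.
Qed.

Lemma corr_bij (X : set (isoclass A)) (Y : set (isoclass (Abar Q))) (R : _ -> _ -> Prop) :
  (forall c, X c -> exists d, R c d) -> (forall d, Y d -> exists c, R c d) ->
  (forall c d, R c d -> alphaQ Q c = d) -> (forall c d, R c d -> X c <-> Y d) ->
  (forall c c' d, R c d -> R c' d -> c = c') -> set_bij X Y (alphaQ Q).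
Proof.
move=> dom cod fE XY inj; split.
- by move=> c Xc; have [d Rcd] := dom _ Xc; rewrite /= (fE _ _ Rcd); apply/(XY _ _ Rcd).
- move=> c c'; rewrite !inE => Xc Xc' e.
  have [d Rcd] := dom _ Xc; have [d' Rcd'] := dom _ Xc'.
  have dd' : d = d' by rewrite -(fE _ _ Rcd) -(fE _ _ Rcd').
  by apply: (inj _ _ d) => //; rewrite dd'.
- by move=> d Yd; have [c Rcd] := cod _ Yd; exists c; [apply/(XY _ _ Rcd)|apply: fE].
Qed.

Lemma bij_M1 : set_bij (setM1 Q) (setN1 Q) (alphaQ Q).
Proof.
apply: (corr_bij _ _ corr_same_alpha corr_same_M1 corr_same_inj) => [c [s nQ _]|d [/corr_same_cod//]].
by apply: corr_same_dom => // /in_add_Q.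
Qed.
Lemma bij_M2m : set_bij (setM2m Q) (setN2 Q) (alphaQ Q).
Proof.
apply: (corr_bij _ _ corr_same_alpha corr_same_M2m corr_same_inj) => [c [s nQ _]|d [/corr_same_cod//]].
by apply: corr_same_dom => // /in_add_Q.
Qed.
Lemma bij_M2p : set_bij (setM2p Q) (setN2 Q) (alphaQ Q).
Proof.
exact: (corr_bij corr_add_dom corr_add_cod corr_add_alpha corr_add_M2p corr_add_inj).
Qed.
Lemma bij_M3 : set_bij (setM3 Q) (setN3 Q) (alphaQ Q).
Proof.
exact: (corr_bij corr_exch_dom corr_exch_cod corr_exch_alpha corr_exch_M3 corr_exch_inj).
Qed.

Lemma sttilt_cases c : sttilt A c -> [\/ setM1 Q c, setM2m Q c, setM2p Q c | setM3 Q c].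
Proof.
move=> s; case: (pselect (in_add Qm (rep c))) => rQ;
  case: (pselect (in_add Qb (rep c))) => rb.
- by apply: Or43; rewrite /setM2p /= in_addQQbarE.
- exact: Or44.
- exact: Or42.
- exact: Or41.
Qed.
Lemma sttilt_bar_cases d : sttilt (Abar Q) d -> [\/ setN1 Q d, setN2 Q d | setN3 Q d].
Proof.
move=> s; case: (pselect (in_add Qb (repbar d))) => rb; last by apply: Or31.
by case: (pselect (hom_zero (repbar d) Qm)) => z; [apply: Or32|apply: Or33].
Qed.

Lemma setM_disjoint c :
  [/\ setM1 Q c -> ~ setM2m Q c, setM1 Q c -> ~ setM2p Q c, setM1 Q c -> ~ setM3 Q c,
      setM2m Q c -> ~ setM2p Q c & (setM2m Q c -> ~ setM3 Q c) /\ (setM2p Q c -> ~ setM3 Q c)].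
Proof.
rewrite /setM1 /setM2m /setM2p /setM3 /= in_addQQbarE.
by split; [| | | |split]; case=> *; case=> *; tauto.
Qed.

Lemma sttilt_union : sttilt A = setM1 Q `|` (setM2m Q `|` (setM2p Q `|` (setM3 Q `|` set0))).
Proof.
apply/seteqP; split=> c.
  by case/sttilt_cases=> H; [left|right; left|right; right; left|right; right; right; left].
by case=> [[]//|[[]//|[[]//|[[]//|[]]]]].
Qed.

Lemma setI_eq0 (T : Type) (X Y : set T) : (forall x, X x -> ~ Y x) -> X `&` Y = set0.
Proof. by move=> H; apply/seteqP; split=> // x [/H]. Qed.

Lemma disjoint_M : disjoint_union (sttilt A) [:: setM1 Q; setM2m Q; setM2p Q; setM3 Q].
Proof.
split; first by rewrite !big_cons big_nil sttilt_union.
have D := setM_disjoint.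
move=> [|[|[|[|i]]]] [|[|[|[|j]]]] //= _ _; apply: setI_eq0 => c;
  by have [? ? ? ? [? ?]] := D c.
Qed.

Lemma inflateE : inflate (setN1 Q `|` setN2 Q) = setM1 Q `|` setM2m Q.
Proof.
have rel d : sttilt (Abar Q) d -> corr_same (cls (repbar d)) d.
  rewrite -{1}[d]clsK => /sttilt_barP[b _]; exists (repr d).
  by split=> //; [apply/res_basic|rewrite clsK].
apply/seteqP; split=> c.
  case=> d [] Nd <-; have /rel r : sttilt (Abar Q) d by case: Nd.
    by left; apply/(corr_same_M1 r).
  by right; apply/(corr_same_M2m r).
case=> Mc.
  have [d r] : exists d, corr_same c d.
    by case: Mc => s nQ _; apply: corr_same_dom => // /in_add_Q.
  have Nd := (corr_same_M1 r).1 Mc; exists d; first by left.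
  by apply: (corr_same_inj (rel d _) r); case: Nd.
have [d r] : exists d, corr_same c d.
  by case: Mc => s nQ _; apply: corr_same_dom => // /in_add_Q.
have Nd := (corr_same_M2m r).1 Mc; exists d; first by right.
by apply: (corr_same_inj (rel d _) r); case: Nd.
Qed.

Lemma add_QE : add_Q (setN2 Q) = setM2p Q.
Proof.
have rel d : setN2 Q d -> corr_add (cls (dsum Qm (repbar d))) d.
  rewrite -{1}[d]clsK => /setN2P[b _ rb _]; exists (repr d).
  by split=> //; [apply/res_basic|rewrite clsK].
apply/seteqP; split=> c; first by case=> d Nd <-; apply/(corr_add_M2p (rel _ Nd)).
move=> Mc; have [d r] := corr_add_dom Mc; have Nd := (corr_add_M2p r).1 Mc.
by exists d => //; apply: (corr_add_inj (rel d Nd) r).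
Qed.

Lemma exchange_QE : exchange_Q (setN3 Q) = setM3 Q.
Proof.
apply/seteqP; split=> c.
  by case=> d [C [Nd i ->]]; apply/(corr_exch_M3 (corr_exch_exchange Nd i)).
move=> Mc; have [d r] := corr_exch_dom Mc; have Nd := (corr_exch_M3 r).1 Mc.
have [N [C [_ _ i -> dE]]] := r; exists d, C; split=> //.
by apply: iso_trans i; apply/res_iso; rewrite dE; apply: repr_cls.
Qed.

Lemma disjoint_N : disjoint_union (sttilt A)
  [:: inflate (setN1 Q `|` setN2 Q); add_Q (setN2 Q); exchange_Q (setN3 Q)].
Proof.
rewrite inflateE add_QE exchange_QE; split.
  by rewrite !big_cons big_nil sttilt_union setUA.
have D := setM_disjoint.
move=> [|[|[|i]]] [|[|[|j]]] //= _ _; apply: setI_eq0 => c;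
  have [? ? ? ? [? ?]] := D c; by [case|].
Qed.

Lemma setN12_disjoint : setN1 Q `&` setN2 Q = set0.
Proof. by apply: setI_eq0 => d [_ nb] []. Qed.

Lemma bij_all : set_bij (sttilt A) (sttilt_bar_N2 Q) (alphaQ_all Q).
Proof.
have D := setM_disjoint.
have [f1 i1 s1] := bij_M1; have [f2 i2 s2] := bij_M2m.
have [fp ip sp] := bij_M2p; have [f3 i3 s3] := bij_M3.
have aP c : setM2p Q c -> alphaQ_all Q c = inr (alphaQ Q c).
  by move=> Mc; rewrite /alphaQ_all asboolT.
have aN c : ~ setM2p Q c -> alphaQ_all Q c = inl (alphaQ Q c).
  by move=> Mc; rewrite /alphaQ_all asboolF.
split.
- move=> c s; case: (pselect (setM2p Q c)) => [Mc|nMc].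
    by right; rewrite /= aP //; exists (alphaQ Q c) => //; apply: fp.
  left; rewrite /= aN //; exists (alphaQ Q c) => //.
  by case: (sttilt_cases s) => // Mc; [case: (f1 _ Mc)|case: (f2 _ Mc)|case: (f3 _ Mc)].
- move=> c c'; rewrite !inE => s s'.
  case: (pselect (setM2p Q c)) => [Mc|nMc]; case: (pselect (setM2p Q c')) => [Mc'|nMc'].
  + by rewrite !aP // => -[]; apply: ip; rewrite inE.
  + by rewrite aP // aN.
  + by rewrite aN // aP.
  rewrite !aN // => -[e].
  case: (sttilt_cases s) => // Mc; case: (sttilt_cases s') => // Mc'.
  + by apply: i1; rewrite ?inE.
  + by have [_ nb] := f1 _ Mc; have [_ b _] := f2 _ Mc'; rewrite /= e in nb.
  + by have [_ nb] := f1 _ Mc; have [_ b _] := f3 _ Mc'; rewrite /= e in nb.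
  + by have [_ nb] := f1 _ Mc'; have [_ b _] := f2 _ Mc; rewrite /= e in b.
  + by apply: i2; rewrite ?inE.
  + by have [_ _ z] := f2 _ Mc; have [_ _ nz] := f3 _ Mc'; rewrite /= e in z.
  + by have [_ nb] := f1 _ Mc'; have [_ b _] := f3 _ Mc; rewrite /= e in b.
  + by have [_ _ z] := f2 _ Mc'; have [_ _ nz] := f3 _ Mc; rewrite /= e in nz.
  + by apply: i3; rewrite ?inE.
- move=> x [[d sd <-]|[d Nd <-]]; last first.
    by have [c Mc <-] := sp _ Nd; exists c; [case: Mc|apply: aP].
  case: (sttilt_bar_cases sd) => Nd.
  + have [c Mc <-] := s1 _ Nd; exists c; first by case: Mc.
    by apply: aN; have [_ H _ _ _] := D c; apply: H.
  + have [c Mc <-] := s2 _ Nd; exists c; first by case: Mc.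
    by apply: aN; have [_ _ _ H _] := D c; apply: H.
  + have [c Mc <-] := s3 _ Nd; exists c; first by case: Mc.
    by apply: aN => Mp; have [_ _ _ _ [_ H]] := D c; apply: H Mp Mc.
Qed.

Lemma bij_M2p_inr : set_bij (setM2p Q) [set inr d | d in setN2 Q]
  (fun c => inr (alphaQ Q c) : isoclass (Abar Q) + isoclass (Abar Q)).
Proof.
have [fp ip sp] := bij_M2p; split.
- by move=> c Mc; exists (alphaQ Q c) => //; apply: fp.
- by move=> c c' Mc Mc' [e]; apply: ip.
- by move=> _ [d Nd <-]; have [c Mc <-] := sp _ Nd; exists c.
Qed.

End Classification.

Theorem theorem3p5 (K : closedFieldType) (L : falgType K)
    (Q : submodule (reg (fdalg_of L))) :
  basic_mod (reg (fdalg_of L)) ->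
  direct_summand Q ->
  indecomposable (Qmod Q) ->
  projective_mod (Qmod Q) ->
  injective_mod (Qmod Q) ->
  disjoint_union (sttilt (fdalg_of L))
    [:: setM1 Q; setM2m Q; setM2p Q; setM3 Q] /\
  [/\ set_bij (setM1 Q) (setN1 Q) (alphaQ Q),
      set_bij (setM2m Q) (setN2 Q) (alphaQ Q),
      set_bij (setM2p Q) [set inr d | d in setN2 Q]
        (fun c => inr (alphaQ Q c) : isoclass (Abar Q) + isoclass (Abar Q)),
      set_bij (setM3 Q) (setN3 Q) (alphaQ Q) &
      set_bij (sttilt (fdalg_of L)) (sttilt_bar_N2 Q) (alphaQ_all Q)] /\
  setN1 Q `&` setN2 Q = set0 /\
  disjoint_union (sttilt (fdalg_of L))
    [:: inflate (setN1 Q `|` setN2 Q);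
        add_Q (setN2 Q);
        exchange_Q (setN3 Q)].
Proof.
move=> _ _ indQ prQ inQ; split; first exact: disjoint_M.
split; last by split; [apply: setN12_disjoint|apply: disjoint_N].
by split; [apply: bij_M1|apply: bij_M2m|apply: bij_M2p_inr|apply: bij_M3|apply: bij_all].
Qed.
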